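(* Let $X$ and $Y$ be symmetric spaces on $[0,1]$ such that $X\subseteq Y$ and $Y$ has the Fatou property. (i) Suppose there exists a constant $C$ such that the estimate $$\Bigl\|\sum_{i=1}^n f_i\Bigr\|_Y\le C\,\Bigl\|\sum_{i=1}^n \bar f_i\Bigr\|_X \qquad (n\in\mathbb{N})$$ holds for every sequence $\{f_k\}_{k=1}^\infty\subset X$ of independent random variables satisfying $\sum_{k=1}^n\lambda(\{f_k\ne 0\})\le 1$ for all $n\in\mathbb{N}$. Then the Kruglov operator $K$ acts boundedly from $X$ into $Y$ and $\|K\|_{X\to Y}\le C$. (ii) If the Kruglov operator $K$ acts boundedly from $X$ into $Y$, then for every sequence $\{f_k\}_{k=1}^\infty\subset X$ of independent random variables and every $n\in\mathbb{N}$ $$\Bigl\|\sum_{i=1}^n f_i\Bigr\|_Y\le \alpha\,\|K\|_{X\to Y}\,\|F\|_{Z_X},$$ where $F=\sum_{i=1}^n\bar f_i$ and $\alpha>0$ is a universal constant which does not depend on $X$ and $Y$.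
   Context: $\lambda$ is Lebesgue measure; random variables are measurable functions on $([0,1],\lambda)$. For a measurable function $f$, $f^*$ denotes the decreasing rearrangement of $|f|$. A symmetric space $X$ on an interval $I$ ($I=[0,1]$ or $(0,\infty)$) is a Banach space of (classes of) measurable functions on $I$ such that $f\in X$ and $g^*\le f^*$ imply $g\in X$ and $\|g\|_X\le\|f\|_X$; always normalized by $\|\chi_{(0,1)}\|_X=1$. $X$ has the Fatou property if for every sequence $(f_n)\subset X$ of nonnegative functions with $f_n\uparrow f$ a.e. and $\lim_n\|f_n\|_X<\infty$ one has $f\in X$ and $\|f\|_X=\lim_n\|f_n\|_X$. Disjointification: for $f_1,\dots,f_n$, $\{\bar f_k\}_{k=1}^n$ denotes a sequence of functions on $(0,\infty)$ with pairwise disjoint supports such that $\bar f_k$ is equimeasurable with $f_k$, and $F:=\sum_{k=1}^n\bar f_k$ on $(0,\infty)$ (e.g. $F(t)=\sum_{k=1}^n f_k(t-k+1)\chi_{[k-1,k]}(t)$). When $\sum_k\lambda(\{f_k\neq0\})\le1$, $\|\sum_i\bar f_i\|_X$ means $\|F^*\chi_{[0,1]}\|_X$. Moreover $\|F\|_{Z_X}:=\|F^*\chi_{[0,1]}\|_X+\|F^*\chi_{[1,\infty)}\|_{L_1}$. Kruglov operator: let $\{B_n\}_{n\ge1}$ be pairwise disjoint measurable subsets of $[0,1]$ with $\lambda(B_n)=\frac1{e\,n!}$, and let $(\Omega,\mathcal P)=\prod_{n=0}^\infty([0,1],\lambda_n)$ with each $\lambda_n$ Lebesgue measure on $[0,1]$.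 For $f\in L_1[0,1]$, $$Kf(\omega_0,\omega_1,\dots)=\sum_{n=1}^\infty\sum_{k=1}^n f(\omega_k)\chi_{B_n}(\omega_0).$$ $K$ is a positive linear operator $L_1[0,1]\to L_1(\Omega,\mathcal P)$. For a symmetric space $Y$ on $[0,1]$, $\|Kf\|_Y$ means $\|(Kf)^*\|_Y$; $K$ acts boundedly from $X$ into $Y$ if $\|K\|_{X\to Y}:=\sup_{\|f\|_X\le1}\|Kf\|_Y<\infty$. *)

(* Defs.v *)
From HB Require Import structures.
From mathcomp Require Import all_boot all_order all_algebra.
From mathcomp Require Import all_classical all_reals all_analysis.

Set Implicit Arguments.
Unset Strict Implicit.
Unset Printing Implicit Defensive.
Import Order.TTheory GRing.Theory Num.Theory.
Import numFieldNormedType.Exports.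
Local Open Scope classical_set_scope.
Local Open Scope ring_scope.

Definition I01 {R : realType} : set R := `[0, 1]%classic.

(** Functions on a measurable set [D] are represented by total functions whose
    values off [D] are irrelevant. *)

(** [rearr mu D f] is the decreasing rearrangement of [|f|] on [(D, mu)].
    The [inf] is taken in [R]; for [t > 0] the set is nonempty as soon as [mu]
    is finite on [D `&` [set x | f x != 0]], which is the case in all the uses
    below.  For [t = 0] the set may be empty (and then [inf] is [0]). *)
Definition rearr (R : realType) (T : Type) (mu : set T -> \bar R) (D : set T)
    (f : T -> R) (t : R) : R :=
  inf [set s | 0 <= s /\
    (mu (D `&` [set x | (s < `|f x|)%R]) <= t%:E)%E].

(** A Banach space of classes of measurable functions is given by the set of
    all representatives of its elements and by the norm of representatives.
    That [ss_norm] vanishes on null functions and that membership and norm only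
    depend on the class follow from [ss_symm]. *)
Record symspace (R : realType) := SymSpace {
  ss_car : set (R -> R) ;
  ss_norm : (R -> R) -> R ;
  ss_meas : forall f, ss_car f -> measurable_fun (@I01 R) f ;
  ss_zero : ss_car (fun=> 0) ;
  ss_add : forall f g, ss_car f -> ss_car g -> ss_car (f \+ g) ;
  ss_scale : forall (a : R) f, ss_car f -> ss_car (a \*: f) ;
  ss_normD : forall f g, ss_car f -> ss_car g ->
    ss_norm (f \+ g) <= ss_norm f + ss_norm g ;
  ss_normZ : forall (a : R) f, ss_car f ->
    ss_norm (a \*: f) = `|a| * ss_norm f ;
  ss_norm_eq0 : forall f, ss_car f -> ss_norm f = 0 ->
    {ae lebesgue_measure, forall x, I01 x -> f x = 0} ;
  ss_complete : forall u : nat -> R -> R, (forall n, ss_car (u n)) ->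
    (forall e : R, 0 < e -> exists N : nat, forall m n : nat,
      (N <= m)%N -> (N <= n)%N -> ss_norm (u m \- u n) < e) ->
    exists2 f, ss_car f &
      (fun n => ss_norm (u n \- f)) @ \oo --> (0 : R) ;
  ss_symm : forall f g, ss_car f -> measurable_fun (@I01 R) g ->
    (forall t, 0 < t ->
       rearr lebesgue_measure I01 g t <= rearr lebesgue_measure I01 f t) ->
    ss_car g /\ ss_norm g <= ss_norm f ;
  ss_normalized : ss_car (\1_(`]0, 1[%classic : set R)) /\
    ss_norm (\1_(`]0, 1[%classic : set R)) = 1
}.

(** With the value [+oo] off [X], finiteness of a norm includes membership. *)
Definition enorm (R : realType) (X : symspace R) (f : R -> R) : \bar R :=
  if `[< ss_car X f >] then (ss_norm X f)%:E else +oo%E.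

Definition fatou_property (R : realType) (X : symspace R) : Prop :=
  forall (u : nat -> R -> R) (f : R -> R) (l : R),
    (forall n, ss_car X (u n)) -> measurable_fun (@I01 R) f ->
    (forall n, {ae lebesgue_measure, forall x, I01 x -> 0 <= u n x}) ->
    {ae lebesgue_measure, forall x, I01 x ->
      nondecreasing_seq (u ^~ x) /\ u ^~ x @ \oo --> f x} ->
    (fun n => ss_norm X (u n)) @ \oo --> l ->
    ss_car X f /\ ss_norm X f = l.

Definition independent_seq (R : realType) (f : nat -> R -> R) : Prop :=
  forall (J : seq nat) (A : nat -> set R), uniq J ->
    (forall i, measurable (A i)) ->
    lebesgue_measure (I01 `&` \bigcap_(i in [set` J]) (f i @^-1` A i)) =
    (\prod_(i <- J) lebesgue_measure (I01 `&` (f i @^-1` A i)))%E.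

(** The indices are shifted by one, and the intervals are half-open so that the
    summands have disjoint supports. *)
Definition disj_sum (R : realType) (f : nat -> R -> R) (n : nat) (t : R) : R :=
  \sum_(k < n) f k (t - k%:R) * \1_(`[k%:R, k.+1%:R[%classic : set R) t.

Definition rearr_pos (R : realType) (F : R -> R) : R -> R :=
  rearr lebesgue_measure (`]0, +oo[%classic : set R) F.

Definition head_norm (R : realType) (X : symspace R) (F : R -> R) : \bar R :=
  enorm X (rearr_pos F \* \1_(@I01 R)).

Definition ZX_norm (R : realType) (X : symspace R) (F : R -> R) : \bar R :=
  (head_norm X F +
   'N[@lebesgue_measure R]_1
     [EFin \o (rearr_pos F \* \1_(`[1%R, +oo[%classic : set R))%R])%E.

Definition coord_sets (R : realType) : set (set (nat -> R)) :=
  \bigcup_n preimage_set_system setT (fun w : nat -> R => w n) measurable.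

Definition Omega (R : realType) := g_sigma_algebraType (@coord_sets R).

Definition cube (R : realType) : set (nat -> R) :=
  [set w | forall n, I01 (w n)].

(** [P] is the infinite product of copies of the Lebesgue measure on [0,1]
    (a single measure [P] satisfies this); it is carried by [cube]. *)
Definition product_lebesgue (R : realType) (P : probability (Omega R) R)
    : Prop :=
  forall (n : nat) (A : nat -> set R), (forall i, measurable (A i)) ->
    P [set w : nat -> R | forall i, (i < n)%N -> A i (w i)] =
    (\prod_(i < n) lebesgue_measure (I01 `&` A i))%E.

(** The sets are indexed by [n >= 1]: [B 0] plays no role. *)
Definition kruglov_partition (R : realType) (B : nat -> set R) : Prop :=
  [/\ forall n, (1 <= n)%N -> measurable (B n) /\ B n `<=` I01,
      trivIset [set n | (1 <= n)%N] B &
      forall n, (1 <= n)%N ->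
        lebesgue_measure (B n) = ((expR 1 * n`!%:R)^-1)%:E].

(** For each [w] at most one of the terms indexed by [n] is nonzero. *)
Definition kruglov (R : realType) (B : nat -> set R) (f : R -> R)
    (w : nat -> R) : R :=
  limn (fun N => \sum_(1 <= n < N) \sum_(1 <= k < n.+1)
    f (w k) * \1_(B n) (w 0%N)).

Definition kruglov_norm (R : realType) (P : probability (Omega R) R)
    (B : nat -> set R) (X Y : symspace R) : \bar R :=
  ereal_sup [set enorm Y (rearr P (@cube R) (kruglov B f)) |
    f in [set f | ss_car X f /\ ss_norm X f <= 1]].

(* Main.v *)
From HB Require Import structures.
Require Import Defs.
From mathcomp Require Import all_boot all_order all_algebra.
From mathcomp Require Import all_classical all_reals all_analysis.
From mathcomp Require Import measurable_realfun.
From mathcomp Require Import ring lra zify.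
Set Implicit Arguments.
Unset Strict Implicit.
Unset Printing Implicit Defensive.
Import Order.TTheory GRing.Theory Num.Theory.
Import numFieldNormedType.Exports.
Local Open Scope classical_set_scope.
Local Open Scope ring_scope.

(** Write [mu01] for the Lebesgue measure on the unit interval.  Everything is
    read off distribution functions: if the tails of [|g|] lie below those of
    [|f|], then [g] is in every symmetric space containing [f], with a smaller
    norm.  Binary digits turn one uniform variable into an independent sequence
    [unif k] of them, so every independent sequence [f k] has the joint law of
    the [f k (unif k)], and every event on the product space can be
    computed on the unit interval (mu01_independent, product_lebesgueE).
    Conditioning on the block [B j] that contains the coordinate of index zero,
    the tail of the Kruglov operator is a Poisson mixture (kruglov_tail):
      P (|K f| > s) = sum_j 1 / (e j!) P (|f(U_1) + ... + f(U_j)| > s).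

    Part (i).  Let [g = |f|] and let [g_1, ..., g_n] be independent, each one
    equal to an independent copy of [g] with probability [1 / n] and to zero
    otherwise.  Their disjoint sum has the law of [g], so the hypothesis bounds
    the norm in [Y] of their sum by [C] times the norm of [g].  The tail of
    this sum is the binomial mixture, with parameters [n] and [1 / n], of the
    tails of [g(U_1) + ... + g(U_j)] (thin_sum_tail).  Binomial weights
    dominate Poisson weights up to a factor that tends to one
    (binw_ge_poisson), which gives functions increasing to the rearrangement of
    [K f], with norms at most [C]; the Fatou property concludes
    (inball_rearr_kruglov).

    Part (ii).  Replacing [f k] by [|f k|], assume [f k >= 0].  Suppose first
    that the disjoint sum has the law of some [G] on the unit interval.  Adding
    an independent variable [f k] acts on nonnegative functions as an operator
    below [1 + T_k], where [T_k] averages translates over the set where [f k]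
    is not zero.  The [T_k] commute and are positive, hence
      prod_k (1 + T_k) <= exp (sum_k T_k),
    and [sum_k T_k] depends on the disjoint sum only, so it is the operator
    of [G].  Reading the exponential series on the indicator of a ray gives
      P (sum_k f k > s) <= e P (K G > s)
    (psum_tail_le).  As [e <= 3], cutting the sum into three independent pieces
    bounds its norm by three times the norm of [K G] (inball_indep_sum).

    In general let [F] be the rearrangement of the disjoint sum and
    [a := F 1].  The parts of the [f k] above the level [a] have total mass at
    most one, and the first case applies to them.  What is below [a] is cut
    into horizontal layers of height [c], each a sum of independent indicators.
    Such a sum, of total mass [m], splits into at most [2 m + 1] blocks of mass
    at most one, to each of which the first case applies
    (inball_above_sum); summing over the layers, the masses in excess of one
    add up to at most the integral of [F] over [[1, +oo[], and the remaining
    terms to a multiple of [a], which is at most the norm of the part of [F] on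
    the unit interval (inball_sum_ge0). *)

(** * Lebesgue measure on the unit interval *)

Lemma measurable_I01 (R : realType) : measurable (@I01 R).
Proof. exact: measurable_itv. Qed.

Definition mu01 (R : realType) : set (measurableTypeR R) -> \bar R :=
  mrestr (@lebesgue_measure R) (@measurable_I01 R).

HB.instance Definition _ (R : realType) := Measure.on (@mu01 R).

Lemma mu01_setT (R : realType) : @mu01 R setT = 1%E.
Proof.
by rewrite /mu01 /mrestr setTI lebesgue_measure_itv/= lte01 oppr0 adde0.
Qed.

HB.instance Definition _ (R : realType) :=
  Measure_isProbability.Build _ _ _ (@mu01 R) (@mu01_setT R).

Lemma mu01E (R : realType) (A : set R) :
  mu01 A = lebesgue_measure (I01 `&` A).
Proof. by rewrite /mu01 /mrestr setIC. Qed.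

(** Half-lines form a pi-system generating the Borel sets. *)
Lemma eq_measure_rays (R : realType)
    (m1 m2 : {measure set (measurableTypeR R) -> \bar R}) :
  (m1 setT < +oo)%E -> m1 setT = m2 setT ->
  (forall u : R, m1 `]u, +oo[%classic = m2 `]u, +oo[%classic) ->
  forall A, measurable A -> m1 A = m2 A.
Proof.
move=> m1oo m12T m12 A mA.
pose G : set (set R) := [set B | B = setT \/ exists u : R, B = `]u, +oo[%classic].
apply: (@measure_unique _ R (measurableTypeR R) G (fun=> setT)) => //.
- rewrite [LHS]RGenOInfty.measurableE; apply/seteqP; split; apply: smallest_sub.
  + exact: smallest_sigma_algebra.
  + by move=> B [x ->]; apply: sub_sigma_algebra; right; exists x.
  + exact: smallest_sigma_algebra.
  + move=> B [->|[x ->]]; last by apply: sub_sigma_algebra; exists x.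
    exact: (@measurableT _ (g_sigma_algebraType (@RGenOInfty.G R))).
- move=> B C [->|[x ->]] [->|[y ->]]; rewrite ?setTI ?setIT; [left|right|right|right] => //.
  + by exists y.
  + by exists x.
  + exists (Num.max x y); apply/seteqP; split => z /=; rewrite !in_itv/= !andbT gt_max.
      by move=> [-> ->].
    by move=> /andP[].
- by left.
- by rewrite bigcup_const//; exists 0%N.
- by move=> B [->|[x ->]].
Qed.

Definition cylinders (R : realType) : set (set (nat -> R)) :=
  [set E | exists n (A : nat -> set R), (forall i, measurable (A i)) /\
    E = [set w | forall i, (i < n)%N -> A i (w i)]].

Lemma measurable_coord (R : realType) (k : nat) :
  measurable_fun setT (fun w : Omega R => (w k : R)).
Proof.
move=> _ A mA; rewrite setTI; apply: sub_sigma_algebra.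
by exists k => //; exists A => //; rewrite setTI.
Qed.

Lemma measurable_cylinder (R : realType) (n : nat) (A : nat -> set R) :
  (forall i, measurable (A i)) ->
  measurable ([set w | forall i, (i < n)%N -> A i (w i)] : set (Omega R)).
Proof.
move=> mA.
rewrite (_ : mkset _ =
  \bigcap_(i in [set i | (i < n)%N]) ((fun w : Omega R => (w i : R)) @^-1` A i)).
  apply: bigcap_measurableType => i _.
  by rewrite -[X in measurable X]setTI; exact: measurable_coord.
by apply/seteqP; split => w.
Qed.

(** Cylinders form a pi-system generating the product sigma-algebra. *)
Lemma eq_measure_cylinders (R : realType) (m1 m2 : {measure set (Omega R) -> \bar R}) :
  (m1 setT < +oo)%E ->
  (forall n (A : nat -> set R), (forall i, measurable (A i)) ->
    m1 [set w | forall i, (i < n)%N -> A i (w i)] =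
    m2 [set w | forall i, (i < n)%N -> A i (w i)]) ->
  forall E, measurable E -> m1 E = m2 E.
Proof.
move=> m1oo m12 E mE.
apply: (@measure_unique _ R (Omega R) (@cylinders R) (fun=> setT)) => //.
- apply/seteqP; split; apply: smallest_sub; try exact: smallest_sigma_algebra.
  + move=> B [k _ [A mA <-]]; rewrite setTI; apply: sub_sigma_algebra.
    exists k.+1, (fun i => if i == k then A else setT); split.
      by move=> i; case: ifP.
    apply/seteqP; split => w /=.
      by move=> Aw i _; case: eqP => // ->.
    by move=> /(_ k (ltnSn k)); rewrite eqxx.
  + by move=> B [n [A [mA ->]]]; exact: measurable_cylinder.
- move=> B C [n [A [mA ->]]] [p [A' [mA' ->]]].
  exists (maxn n p), (fun i => (if (i < n)%N then A i else setT) `&`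
                             (if (i < p)%N then A' i else setT)); split.
    by move=> i; apply: measurableI; case: ifP.
  apply/seteqP; split => w /=.
    move=> [Aw Aw'] i ilt; split; case: ifP => //; [exact: Aw|exact: Aw'].
  move=> H; split=> i ilt; have := H i.
    by rewrite leq_max ilt /= => /(_ isT)[].
  by rewrite leq_max ilt orbT /= => /(_ isT)[_].
- move=> _; exists 0%N, (fun=> setT); split => //.
  by apply/seteqP; split.
- by rewrite bigcup_const//; exists 0%N.
- by move=> B [n [A [mA ->]]]; exact: m12.
Qed.

(** The measure structure on a pushforward depends on a proof of measurability,
    which is bundled here so that the result is of measure type. *)
Definition image_measure d1 d2 (T1 : measurableType d1) (T2 : measurableType d2)
    (R : realType) (m : {measure set T1 -> \bar R}) (f : T1 -> T2)
    (mf : measurable_fun setT f) : {measure set T2 -> \bar R}.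
Proof.
by refine (HB.pack (pushforward m f) (Measure.on (pushforward m f))); exact: mf.
Defined.

(** * Independent uniform variables from binary digits *)

Definition bit (R : realType) (x : R) : nat := ((2^-1 : R) <= x)%R.

Definition dbl (R : realType) (x : R) : R := 2 * x - (bit x)%:R.

(** The integer whose binary digits are the digits of [x] at the places
    1, 3, ..., 2 n - 1; those of [dbl x] are at the places 2, 4, ..., 2 n. *)
Fixpoint odd_bits (R : realType) (n : nat) (x : R) : nat :=
  if n is p.+1 then (bit x * 2 ^ p + odd_bits p (dbl (dbl x)))%N else 0%N.

Lemma measurable_bit (R : realType) : measurable_fun setT (fun x : R => (bit x)%:R : R).
Proof.
rewrite (_ : (fun _ => _) = \1_(`[2^-1, +oo[%classic : set R)); last first.
  apply/funext => x; rewrite indicE /bit; congr (_%:R); congr nat_of_bool.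
  by apply/idP/idP; rewrite inE /= in_itv /= andbT.
by apply: measurable_indic; exact: measurable_itv.
Qed.

Lemma measurable_dbl (R : realType) : measurable_fun setT (@dbl R).
Proof.
apply: measurable_funB; last exact: measurable_bit.
exact: measurable_funM.
Qed.

Lemma bit_le1 (R : realType) (x : R) : (bit x <= 1)%N.
Proof. by rewrite /bit leq_b1. Qed.

Lemma measurable_bit_eq (R : realType) (a : nat) : measurable [set x : R | bit x = a].
Proof.
rewrite (_ : mkset _ = (fun x : R => (bit x)%:R : R) @^-1` [set a%:R]).
  by rewrite -[X in measurable X]setTI; apply: measurable_bit.
by apply/seteqP; split => x /= [];[move-> | move/eqP; rewrite eqr_nat => /eqP].
Qed.

Lemma lebesgue_itv_bounded (R : realType) (b1 b2 : bool) (x y : R) : x <= y ->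
  lebesgue_measure [set` Interval (BSide b1 x) (BSide b2 y)] = (y - x)%:E.
Proof.
rewrite lebesgue_measure_itv /= lte_fin le_eqVlt => /orP[/eqP->|->] //.
by rewrite ltxx subrr.
Qed.

(** The first binary digit of a uniform variable is fair, and independent of the
    uniform variable given by the remaining digits. *)
Lemma mu01_bit_dbl (R : realType) (a : nat) (E : set R) : (a <= 1)%N -> measurable E ->
  mu01 ([set x | bit x = a] `&` (@dbl R) @^-1` E) = ((2^-1)%:E * mu01 E)%E.
Proof.
move=> a1 mE.
pose M1 : {measure set (measurableTypeR R) -> \bar R} :=
  image_measure (T1 := measurableTypeR R) (T2 := measurableTypeR R)
    (mrestr (@mu01 R) (@measurable_bit_eq R a)) (@measurable_dbl R).
have h0 : 0 <= 2^-1 :> R by [].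
pose M2 : {measure set (measurableTypeR R) -> \bar R} :=
  mscale (NngNum h0) (@mu01 R).
have Eq (u : R) : M1 `]u, +oo[%classic = M2 `]u, +oo[%classic.
  rewrite /M1 /M2 /= /pushforward /mrestr /mscale /= !mu01E /I01 setIA.
  rewrite setIAC -setIA.
  have [u0|u0] := ltP u 0.
    rewrite (_ : _ `&` `]u, +oo[ = `[0, 1]%classic); last first.
      by apply/seteqP; split => x /=; rewrite !in_itv/= andbT; [case|move=> /andP[? ?]; split; lra].
    rewrite lebesgue_itv_bounded ?ler01 // subr0 mule1.
    case: a a1 M1 => [|[|//]] _ _.
      rewrite (_ : _ `&` _ = `[0, 2^-1[%classic) ?lebesgue_itv_bounded ?subr0 //.
      apply/seteqP; split => x /=; rewrite /dbl /bit !in_itv/= andbT; case: (leP 2^-1 x) => ? /=;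
      first [by move=> [? []] | by move=> [? [? ?]]; lra | by move=> ?; lra |
             by move=> ?; split; [lra|split => //; lra]].
    rewrite (_ : _ `&` _ = `[2^-1, 1]%classic) ?lebesgue_itv_bounded //.
    - by congr EFin; lra.
    - by lra.
    apply/seteqP; split => x /=; rewrite /dbl /bit !in_itv/= andbT; case: (leP 2^-1 x) => ? /=;
      first [by move=> [? []] | by move=> [? [? ?]]; lra | by move=> ?; lra |
             by move=> ?; split; [lra|split => //; lra]].
  have [u1|u1] := ltP u 1; last first.
    rewrite (_ : _ `&` `]u, +oo[ = set0); last first.
      by apply/seteqP; split => x //=; rewrite !in_itv/= andbT; lra.
    rewrite measure0 mule0 (_ : _ `&` _ = set0) ?measure0//.
    apply/seteqP; split => x //=; rewrite /dbl /bit !in_itv/= andbT.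
    by case: (leP 2^-1 x) => ? /=; move=> [? [? ?]]; lra.
  rewrite (_ : _ `&` `]u, +oo[ = `]u, 1]%classic); last first.
    by apply/seteqP; split => x /=; rewrite !in_itv/= andbT; lra.
  rewrite lebesgue_itv_bounded ?(ltW u1)// -EFinM.
  case: a a1 M1 => [|[|//]] _ _.
    rewrite (_ : _ `&` _ = `]u / 2, 2^-1[%classic) ?lebesgue_itv_bounded.
    - by congr EFin; lra.
    - by lra.
    apply/seteqP; split => x /=; rewrite /dbl /bit !in_itv/= andbT; case: (leP 2^-1 x) => ? /=;
      first [by move=> [? []] | by move=> [? [? ?]]; lra | by move=> ?; lra |
             by move=> ?; split; [lra|split => //; lra]].
  rewrite (_ : _ `&` _ = `](u + 1) / 2, 1]%classic) ?lebesgue_itv_bounded //.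
  - by congr EFin; lra.
  - by lra.
  apply/seteqP; split => x /=; rewrite /dbl /bit !in_itv/= andbT; case: (leP 2^-1 x) => ? /=;
      first [by move=> [? []] | by move=> [? [? ?]]; lra | by move=> ?; lra |
             by move=> ?; split; [lra|split => //; lra]].
have EqT : M1 setT = M2 setT.
  have -> : M2 setT = M2 `]-1, +oo[%classic.
    rewrite /M2 /= /mscale /= !mu01E /I01 setIT; congr (_ * lebesgue_measure _)%E.
    by apply/seteqP; split => x /=; rewrite !in_itv/= andbT; [move=> ?; split => //; lra|case].
  rewrite -Eq /M1 /= /pushforward /mrestr !mu01E /I01; congr lebesgue_measure.
  apply/seteqP; split => x /=; rewrite /dbl /bit !in_itv/= andbT; last by move=> [? []].
  by case: (leP 2^-1 x) => ? /= [? [_ <-]]; split => //; split => //; lra.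
transitivity (M1 E).
  by rewrite /M1 /= /pushforward /mrestr setIC.
rewrite (@eq_measure_rays _ M1 M2) //.
by rewrite EqT /M2 /= /mscale/= [mu01 _]mu01_setT mule1 ltry.
Qed.

Lemma odd_bits_lt (R : realType) (n : nat) (x : R) : (odd_bits n x < 2 ^ n)%N.
Proof.
elim: n x => [//|n IH] x /=.
by have := IH (dbl (dbl x)); have := bit_le1 x; rewrite expnS; nia.
Qed.

Lemma odd_bits_refine (R : realType) (n : nat) (x : R) :
  (2 * odd_bits n x <= odd_bits n.+1 x <= 2 * odd_bits n x + 1)%N.
Proof.
elim: n x => [|n IH] x; first by rewrite /= expn0; have := bit_le1 x; lia.
have := IH (dbl (dbl x)); rewrite [odd_bits n.+2 x]/= -/(odd_bits n.+1 _).
move: (odd_bits n.+1 (dbl (dbl x))) => p.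
by rewrite [odd_bits n.+1 x]/= expnS; have := bit_le1 x; nia.
Qed.

(** The numbers whose digits are the digits of [x] at odd places, and those at
    even places. *)
Definition split1 (R : realType) (x : R) : R :=
  sup (range (fun n => (odd_bits n x)%:R / (2 ^ n)%:R : R)).

Definition split2 (R : realType) (x : R) : R := split1 (dbl x).

Lemma split1_bounds (R : realType) (n : nat) (x : R) :
  (odd_bits n x)%:R / (2 ^ n)%:R <= split1 x <= ((odd_bits n x).+1)%:R / (2 ^ n)%:R.
Proof.
have p0 k : 0 < (2 ^ k)%:R :> R by rewrite ltr0n expn_gt0.
have up k : (odd_bits (n + k) x)%:R / (2 ^ (n + k))%:R <=
     ((odd_bits n x).+1)%:R / (2 ^ n)%:R :> R.
  rewrite ler_pdivrMr// mulrAC ler_pdivlMr// -!natrM ler_nat expnD.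
  suff : (odd_bits (n + k) x < (odd_bits n x).+1 * 2 ^ k)%N.
    by move: (expn_gt0 2 n) => /=; nia.
  elim: k => [|k IH]; first by rewrite addn0 expn0 muln1.
  by rewrite addnS expnS; have := odd_bits_refine (n + k) x; nia.
have dn k : (odd_bits k x)%:R / (2 ^ k)%:R <=
     ((odd_bits n x).+1)%:R / (2 ^ n)%:R :> R.
  have [nk|kn] := leqP n k; first by have := up (k - n)%N; rewrite subnKC.
  rewrite ler_pdivrMr// mulrAC ler_pdivlMr// -!natrM ler_nat.
  rewrite -(subnKC (ltnW kn)); move: (n - k)%N => j.
  suff : (odd_bits k x * 2 ^ j <= odd_bits (k + j) x)%N.
    by rewrite expnD; move: (expn_gt0 2 k) => /=; nia.
  elim: j => [|j IH]; first by rewrite addn0 expn0 muln1.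
  by rewrite addnS expnS; have := odd_bits_refine (k + j) x; nia.
apply/andP; split.
  apply: ub_le_sup; last by exists n.
  by exists (((odd_bits n x).+1)%:R / (2 ^ n)%:R) => _ [k _ <-]; exact: dn.
apply: ge_sup => [|_ [k _ <-]]; last exact: dn.
by exists ((odd_bits n x)%:R / (2 ^ n)%:R), n.
Qed.

Lemma split1_I01 (R : realType) (x : R) : 0 <= split1 x <= 1.
Proof. by have := split1_bounds 0 x; rewrite /= mul0r divr1. Qed.

Lemma measurable_odd_bits (R : realType) (n : nat) :
  measurable_fun setT (fun x : R => (odd_bits n x)%:R : R).
Proof.
elim: n => [|n IH] /=; first exact: measurable_cst.
under eq_fun do rewrite natrD natrM.
apply: measurable_funD; first by apply: measurable_funM => //; exact: measurable_bit.
apply: (measurableT_comp IH).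
by apply: measurableT_comp; exact: measurable_dbl.
Qed.

Lemma measurable_split1 (R : realType) : measurable_fun setT (@split1 R).
Proof.
apply: (@measurable_fun_cvg _ _ _ _ (fun n x => (odd_bits n x)%:R / (2 ^ n)%:R)).
  by move=> n; apply: measurable_funM => //; exact: measurable_odd_bits.
move=> x _; apply: nondecreasing_cvgn.
  apply/nondecreasing_seqP => n.
  rewrite ler_pdivrMr ?ltr0n ?expn_gt0// mulrAC ler_pdivlMr ?ltr0n ?expn_gt0//.
  by rewrite -!natrM ler_nat expnS; have := odd_bits_refine n x; nia.
exists 1 => _ [n _ <-]; rewrite ler_pdivrMr ?ltr0n ?expn_gt0// mul1r ler_nat.
exact/ltnW/odd_bits_lt.
Qed.

Lemma measurable_split2 (R : realType) : measurable_fun setT (@split2 R).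
Proof.
by apply: measurableT_comp; [exact: measurable_split1|exact: measurable_dbl].
Qed.

Lemma measurable_odd_bits_lt (R : realType) (n i : nat) :
  measurable [set x : R | (odd_bits n x < i)%N].
Proof.
rewrite (_ : mkset _ = (fun x : R => (odd_bits n x)%:R : R) @^-1` [set` `]-oo, i%:R[ ]).
  by rewrite -[X in measurable X]setTI; apply: measurable_odd_bits.
by apply/seteqP; split => x /=; rewrite in_itv /= ltr_nat.
Qed.

(** The first [2 n] binary digits of a uniform variable are independent and
    fair, and splitting off the first pair of digits is a recursion on [n]. *)
Lemma mu01_odd_bits (R : realType) (n i j : nat) :
  mu01 [set x : R | (odd_bits n x < i)%N /\ (odd_bits n (dbl x) < j)%N] =
  ((minn i (2 ^ n) * minn j (2 ^ n))%:R / (4 ^ n)%:R)%:E.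
Proof.
elim: n i j => [|n IH] i j.
  rewrite !expn0 divr1 /=; case: i => [|i].
    by rewrite (_ : mkset _ = set0) ?measure0 ?min0n//; apply/seteqP; split => // x [].
  case: j => [|j].
    by rewrite (_ : mkset _ = set0) ?measure0 ?min0n ?minn0 ?muln0//; apply/seteqP; split => // x [].
  rewrite (_ : minn _ _ * _ = 1)%N; last by lia.
  rewrite (_ : mkset _ = setT) ?[mu01 _]mu01_setT//.
  by apply/seteqP; split.
have m2 (k : nat) : measurable [set x : R | (odd_bits n (dbl x) < k)%N].
  rewrite -[X in measurable X]setTI.
  exact: (measurable_dbl measurableT (measurable_odd_bits_lt n k)).
pose E a c : set R := [set x | (odd_bits n x < i - a * 2 ^ n)%N /\
   (odd_bits n (dbl x) < j - c * 2 ^ n)%N].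
have mE a c : measurable (E a c).
  exact: measurableI (measurable_odd_bits_lt _ _) (m2 _).
pose D a c : set R := [set x | bit x = a] `&` (@dbl R) @^-1`
   ([set x | bit x = c] `&` (@dbl R) @^-1` E a c).
have mbE a c : measurable ([set x | bit x = c] `&` (@dbl R) @^-1` E a c).
  apply: measurableI; first exact: measurable_bit_eq.
  by rewrite -[X in measurable X]setTI; exact: measurable_dbl.
have mD a c : measurable (D a c).
  apply: measurableI; first exact: measurable_bit_eq.
  by rewrite -[X in measurable X]setTI; exact: measurable_dbl.
have muD a c : (a <= 1)%N -> (c <= 1)%N -> mu01 (D a c) =
    ((minn (i - a * 2 ^ n) (2 ^ n) * minn (j - c * 2 ^ n) (2 ^ n))%:R / (4 ^ n.+1)%:R)%:E.
  move=> a1 c1; rewrite mu01_bit_dbl// mu01_bit_dbl// IH -!EFinM; congr EFin.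
  rewrite [in RHS]expnS [in RHS](natrM R 4); set p := (4 ^ n)%:R.
  have p0 : p != 0 :> R by rewrite pnatr_eq0 -lt0n expn_gt0.
  by move: ((minn _ _ * _)%:R) => k; field.
rewrite (_ : mkset _ = (D 0%N 0%N `|` D 0%N 1%N) `|` (D 1%N 0%N `|` D 1%N 1%N)); last first.
  apply/seteqP; split => x /=; rewrite /D /E /=.
    move=> []; have := bit_le1 x; have := bit_le1 (dbl x).
    by case: (bit x) => [|[|//]]; case: (bit (dbl x)) => [|[|//]] _ _ H1 H2;
      [left; left|left; right|right; left|right; right]; do 2 (split => //); lia.
  by move=> [[]|[]] [-> [-> [H1 H2]]]; split; lia.
rewrite (_ : mu01 _ = ((mu01 (D 0%N 0%N) + mu01 (D 0%N 1%N)) +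
    (mu01 (D 1%N 0%N) + mu01 (D 1%N 1%N)))%E); last first.
  rewrite measureU; [|by apply: measurableU; exact: mD|by apply: measurableU; exact: mD|].
  - congr (_ + _)%E; (rewrite measureU; [|exact: mD|exact: mD|]) => //.
    + by apply/seteqP; split => // x [[_ [/= e _]] [_ [/= e' _]]]; rewrite e in e'.
    + by apply/seteqP; split => // x [[_ [/= e _]] [_ [/= e' _]]]; rewrite e in e'.
  - by apply/seteqP; split => // x [[] [/= e _] [] [/= e' _]]; rewrite e in e'.
rewrite !muD// -!EFinD; congr EFin; rewrite -!mulrDl -!natrD; congr (_%:R / _).
have H k : minn k (2 ^ n.+1) = (minn (k - 0 * 2 ^ n) (2 ^ n) + minn (k - 1 * 2 ^ n) (2 ^ n))%N.
  by rewrite expnS; lia.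
by rewrite !H mulnDl !mulnDr addnA.
Qed.

Lemma eq_measure_cdf (R : realType)
    (m1 m2 : {measure set (measurableTypeR R) -> \bar R}) :
  (m1 setT < +oo)%E -> m1 setT = m2 setT ->
  (forall u : R, m1 `]-oo, u]%classic = m2 `]-oo, u]%classic) ->
  forall A, measurable A -> m1 A = m2 A.
Proof.
move=> m1oo m12T m12; apply: eq_measure_rays => // u.
have split (m : {measure set (measurableTypeR R) -> \bar R}) :
    m setT = (m `]-oo, u]%classic + m `]u, +oo[%classic)%E.
  rewrite -measureU//.
  - congr (m _); apply/seteqP; split => x //= _; rewrite !in_itv/= andbT.
    by apply/orP; case: (leP x u).
  - by apply/seteqP; split => x //=; rewrite !in_itv/= andbT leNgt; case=> /negP.
have fin : m1 `]-oo, u]%classic \is a fin_num.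
  rewrite ge0_fin_numE//; apply: le_lt_trans m1oo.
  by rewrite [in leRHS]split leeDl.
move: m12T; rewrite (split m1) (split m2) -m12.
by move=> /eqP; rewrite eq_le !leeD2lE// -eq_le => /eqP.
Qed.

Lemma mu01_le (R : realType) (u : R) :
  mu01 `]-oo, u]%classic = (Num.max 0 (Num.min u 1))%:E.
Proof.
rewrite mu01E /I01; have [u0|u0] := ltP u 0.
  rewrite (_ : _ `&` _ = set0) ?measure0.
    by rewrite min_l ?max_l//; lra.
  by apply/seteqP; split => x //=; rewrite !in_itv/=; lra.
have [u1|u1] := ltP u 1.
  rewrite (_ : _ `&` _ = `[0, u]%classic).
    by rewrite lebesgue_itv_bounded// subr0 max_r.
  by apply/seteqP; split => x /=; rewrite !in_itv/=; lra.
rewrite (_ : _ `&` _ = `[0, 1]%classic).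
  by rewrite lebesgue_itv_bounded// subr0 max_r.
by apply/seteqP; split => x /=; rewrite !in_itv/=; lra.
Qed.

Lemma measurable_le_set (R : realType) (f : R -> R) (u : R) :
  measurable_fun setT f -> measurable [set x | f x <= u].
Proof.
move=> mf; rewrite (_ : mkset _ = f @^-1` [set` `]-oo, u] ]).
  by rewrite -[X in measurable X]setTI; apply: mf.
by apply/seteqP; split => x /=; rewrite in_itv.
Qed.

(** The events are sandwiched between events on the first [2 n] digits, whose
    probabilities differ from [u * v] by a multiple of [1 / 2 ^ n]. *)
Lemma mu01_split_cdf01 (R : realType) (u v : R) : 0 <= u <= 1 -> 0 <= v <= 1 ->
  mu01 ([set x | split1 x <= u] `&` [set x | split2 x <= v]) = (u * v)%:E.
Proof.
move=> u01 v01; set E := _ `&` _.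
have mE : measurable E.
  by apply: measurableI; apply: measurable_le_set;
    [exact: measurable_split1|exact: measurable_split2].
have mG n i j : measurable [set x : R | (odd_bits n x < i)%N /\ (odd_bits n (dbl x) < j)%N].
  apply: measurableI; first exact: measurable_odd_bits_lt.
  rewrite -[X in measurable X]setTI.
  exact: (@measurable_dbl R measurableT _ (@measurable_odd_bits_lt R n j)).
have Efin : mu01 E \is a fin_num by exact: fin_num_measure.
rewrite -(fineK Efin); congr EFin; set F := fine _.
have FE : mu01 E = F%:E by rewrite fineK.
have bnd n : `|F - u * v| <= 3 / (2 ^ n)%:R.
  have p0 : 0 < (2 ^ n)%:R :> R by rewrite ltr0n expn_gt0.
  have p1 : 1 <= (2 ^ n)%:R :> R by rewrite ler1n expn_gt0.
  have := @truncn_itv _ (u * (2 ^ n)%:R).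
  have := @truncn_itv _ (v * (2 ^ n)%:R).
  set j := Num.truncn (v * _); set i := Num.truncn _.
  move=> /(_ ltac:(nra)) /andP[j1 j2] /(_ ltac:(nra)) /andP[i1 i2].
  have in2 : (i <= 2 ^ n)%N by rewrite -(ler_nat R); nra.
  have jn2 : (j <= 2 ^ n)%N by rewrite -(ler_nat R); nra.
  have low : (mu01 [set x : R | (odd_bits n x < i)%N /\ (odd_bits n (dbl x) < j)%N] <= mu01 E)%E.
    apply: le_measure; rewrite ?inE//; first exact: mG.
    move=> x /= [H1 H2]; split => /=.
      have /andP[_ /le_trans] := split1_bounds n x; apply.
      by rewrite ler_pdivrMr//; apply: le_trans i1; rewrite ler_nat.
    have /andP[_ /le_trans] := split1_bounds n (dbl x); apply.
    by rewrite ler_pdivrMr//; apply: le_trans j1; rewrite ler_nat.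
  have upp : (mu01 E <= mu01 [set x : R | (odd_bits n x < i.+1)%N /\ (odd_bits n (dbl x) < j.+1)%N])%E.
    apply: le_measure; rewrite ?inE//; first exact: mG.
    move=> x /= [H1 H2]; split.
      rewrite -(ltr_nat R); apply: le_lt_trans i2; rewrite -ler_pdivrMr//.
      by apply: le_trans H1; have /andP[] := split1_bounds n x.
    rewrite -(ltr_nat R); apply: le_lt_trans j2; rewrite -ler_pdivrMr//.
    by apply: le_trans H2; have /andP[] := split1_bounds n (dbl x).
  move: low upp; rewrite !mu01_odd_bits FE !lee_fin.
  rewrite (minn_idPl in2) (minn_idPl jn2).
  have -> : (4 ^ n)%:R = (2 ^ n)%:R * (2 ^ n)%:R :> R by rewrite -natrM -expnMn.
  move: p0 p1 i1 i2 j1 j2; set p := (2 ^ n)%:R => p0 p1 i1 i2 j1 j2.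
  rewrite ler_pdivrMr ?mulr_gt0// => low.
  rewrite ler_pdivlMr ?mulr_gt0// => upp.
  rewrite ler_pdivlMr// -(ler_pM2r p0).
  have upp' : F * (p * p) <= (i%:R + 1) * (j%:R + 1).
    apply: le_trans upp _; rewrite !natr1 -natrM ler_nat.
    by apply: leq_mul; exact: geq_minl.
  rewrite -mulrA -[X in `|_| * X](gtr0_norm (mulr_gt0 p0 p0)) -normrM ler_norml.
  rewrite mulrBl (_ : u * v * (p * p) = (u * p) * (v * p)); last by ring.
  have {u01} : 0 <= u * p <= p by nra.
  have {v01} : 0 <= v * p <= p by nra.
  rewrite natrM in low; rewrite -!natr1 in i2 j2.
  move: i1 i2 j1 j2 low upp'; move: (u * p) (v * p) (F * (p * p)) => a b f.
  have ji0 : 0 <= i%:R :> R by []. have jj0 : 0 <= j%:R :> R by [].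
  move: i%:R j%:R ji0 jj0 => i' j' *.
  have : a * b <= (i' + 1) * (j' + 1) by apply: ler_pM; lra.
  have : i' * j' <= a * b by apply: ler_pM; lra.
  by move=> *; lra.
apply/eqP; rewrite -subr_eq0 -normr_le0; apply/ler_addgt0Pr => e e0; rewrite add0r.
pose n := (Num.truncn (3 / e)).+1.
have n2 : 3 / e < (2 ^ n)%:R.
  have /andP[_ H] := truncn_itv (ltW (divr_gt0 (ltr0n R 3) e0)).
  by apply: lt_le_trans H _; rewrite ler_nat; exact/ltnW/ltn_expl.
apply: le_trans (bnd n) _.
rewrite ler_pdivrMr ?ltr0n ?expn_gt0//.
by move: n2; rewrite ltr_pdivrMr// => /ltW; rewrite mulrC.
Qed.

Lemma split2_I01 (R : realType) (x : R) : 0 <= split2 x <= 1.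
Proof. exact: split1_I01. Qed.

Lemma mu01_split_cdf (R : realType) (u v : R) :
  mu01 ([set x | split1 x <= u] `&` [set x | split2 x <= v]) =
  (mu01 `]-oo, u]%classic * mu01 `]-oo, v]%classic)%E.
Proof.
rewrite !mu01_le -EFinM.
have H (w z : R) : 0 <= w -> 0 <= z <= 1 -> (z <= w) = (z <= Num.max 0 (Num.min w 1)).
  by move=> w0 z01; case: (leP w 1) => ?; rewrite max_r//; apply/idP/idP; lra.
have [u0|u0] := ltP u 0.
  have -> : Num.max 0 (Num.min u 1) = 0 by rewrite min_l ?max_l//; lra.
  rewrite mul0r (_ : _ `&` _ = set0) ?measure0//; apply/seteqP; split => // x /= [].
  by have := split1_I01 x; lra.
have [v0|v0] := ltP v 0.
  have -> : Num.max 0 (Num.min v 1) = 0 by rewrite min_l ?max_l//; lra.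
  rewrite mulr0 (_ : _ `&` _ = set0) ?measure0//; apply/seteqP; split => // x /= [_].
  by have := split2_I01 x; lra.
rewrite -mu01_split_cdf01; first last.
- by case: (leP v 1) => ?; rewrite max_r//; lra.
- by case: (leP u 1) => ?; rewrite max_r//; lra.
by congr mu01; apply/seteqP; split => x /=;
  rewrite -!H// ?split1_I01 ?split2_I01.
Qed.

(** The product formula for rays extends to Borel sets in one variable at a
    time, the other one being fixed. *)
Lemma mu01_split (R : realType) (A B : set R) : measurable A -> measurable B ->
  mu01 (@split1 R @^-1` A `&` @split2 R @^-1` B) = (mu01 A * mu01 B)%E.
Proof.
move=> mA mB.
have m1 := @measurable_split1 R; have m2 := @measurable_split2 R.
have pm1 (C : set R) : measurable C -> measurable (@split1 R @^-1` C).
  by move=> mC; rewrite -[X in measurable X]setTI; exact: m1.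
have pm2 (C : set R) : measurable C -> measurable (@split2 R @^-1` C).
  by move=> mC; rewrite -[X in measurable X]setTI; exact: m2.
have fing (C : set R) : measurable C -> (fine (mu01 C))%:E = mu01 C.
  by move=> mC; rewrite fineK//; exact: fin_num_measure.
have g0 (C : set R) : 0 <= fine (mu01 C) by exact: fine_ge0.
have step1 (v : R) (C : set R) : measurable C ->
    mu01 (@split1 R @^-1` C `&` [set x | split2 x <= v]) = (mu01 C * mu01 `]-oo, v]%classic)%E.
  move=> mC.
  pose M1 : {measure set (measurableTypeR R) -> \bar R} :=
    image_measure (T1 := measurableTypeR R) (T2 := measurableTypeR R)
     (mrestr (@mu01 R) (measurable_le_set v m2)) m1.
  pose M2 : {measure set (measurableTypeR R) -> \bar R} :=
    mscale (NngNum (g0 `]-oo, v]%classic)) (@mu01 R).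
  have M1E D : M1 D = mu01 (@split1 R @^-1` D `&` [set x | split2 x <= v]) by [].
  have M2E D : M2 D = (mu01 D * mu01 `]-oo, v]%classic)%E.
    by rewrite /M2/= /mscale/= fing// muleC.
  rewrite -M1E -M2E; apply: eq_measure_cdf => //.
  - by rewrite M1E (le_lt_trans (probability_le1 _ _)) ?ltry//; apply: measurableI;
      [exact: pm1|exact: measurable_le_set].
  - rewrite M1E M2E -[X in mu01 (X `&` _)](_ : [set x | split1 x <= 1] = _); last first.
      by apply/seteqP; split => // x _ /=; case/andP: (split1_I01 x).
    rewrite mu01_split_cdf; congr (_ * _)%E.
    by rewrite mu01_le minxx max_r// [RHS]mu01_setT.
  - by move=> u; rewrite M1E M2E -mu01_split_cdf; congr (mu01 (_ `&` _)).
pose M1 : {measure set (measurableTypeR R) -> \bar R} :=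
  image_measure (T1 := measurableTypeR R) (T2 := measurableTypeR R)
   (mrestr (@mu01 R) (pm1 _ mA)) m2.
pose M2 : {measure set (measurableTypeR R) -> \bar R} :=
  mscale (NngNum (g0 A)) (@mu01 R).
have M1E D : M1 D = mu01 (@split1 R @^-1` A `&` @split2 R @^-1` D).
  by rewrite setIC.
have M2E D : M2 D = (mu01 A * mu01 D)%E by rewrite /M2/= /mscale/= fing.
rewrite -M1E -M2E; apply: eq_measure_cdf => //.
- by rewrite M1E (le_lt_trans (probability_le1 _ _)) ?ltry//; apply: measurableI;
    [apply pm1|apply pm2].
- rewrite M1E M2E -[X in mu01 (_ `&` X)](_ : [set x | split2 x <= 1] = _); last first.
    by apply/seteqP; split => // x _ /=; case/andP: (split2_I01 x).
  by rewrite step1// mu01_le minxx max_r// [mu01 setT]mu01_setT.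
- by move=> u; rewrite M1E M2E -step1//; congr (mu01 (_ `&` _)).
Qed.

Definition unif (R : realType) (k : nat) (x : R) : R := split1 (iter k (@split2 R) x).

Lemma unifS (R : realType) (k : nat) (x : R) : unif k.+1 x = unif k (split2 x).
Proof. by rewrite /unif iterSr. Qed.

Lemma unif_I01 (R : realType) (k : nat) (x : R) : 0 <= unif k x <= 1.
Proof. exact: split1_I01. Qed.

Lemma measurable_unif (R : realType) (k : nat) : measurable_fun setT (@unif R k).
Proof.
elim: k => [|k IH]; first exact: measurable_split1.
rewrite (_ : @unif R k.+1 = @unif R k \o @split2 R).
  by apply: measurableT_comp; [exact: IH|exact: measurable_split2].
by apply/funext => x; rewrite unifS.
Qed.

Lemma measurable_preimage (R : realType) (f : R -> R) (A : set R) :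
  measurable_fun setT f -> measurable A -> measurable (f @^-1` A).
Proof. by move=> mf mA; rewrite -[X in measurable X]setTI; exact: mf. Qed.

Lemma measurable_seq_cyl (R : realType) (f : nat -> R -> R) (n : nat) (A : nat -> set R) :
  (forall k, measurable_fun setT (f k)) -> (forall k, measurable (A k)) ->
  measurable [set x : R | forall i, (i < n)%N -> A i (f i x)].
Proof.
move=> mf mA; rewrite (_ : mkset _ = \bigcap_(i in [set i | (i < n)%N]) (f i @^-1` A i)).
  by apply: bigcap_measurableType => i _; exact: measurable_preimage.
by apply/seteqP; split => w.
Qed.

Lemma mu01_unif (R : realType) (n : nat) (A : nat -> set R) :
  (forall k, measurable (A k)) ->
  mu01 [set x | forall i, (i < n)%N -> A i (unif i x)] = (\prod_(i < n) mu01 (A i))%E.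
Proof.
elim: n A => [|n IH] A mA.
  rewrite big_ord0 (_ : mkset _ = setT) ?[mu01 _]mu01_setT//.
  by apply/seteqP; split.
rewrite big_ord_recl -(IH (fun i => A i.+1))// -mu01_split//.
  congr mu01; apply/seteqP; split => x /=.
    move=> H; split; first exact: (H 0%N).
    by move=> i ilt; rewrite -unifS; exact: H.
  by move=> [H0 H] [|i] ilt//; rewrite unifS; exact: H.
exact: (@measurable_seq_cyl R (@unif R) n (fun i => A i.+1) (@measurable_unif R)).
Qed.

Lemma measurable_into_Omega d (T : measurableType d) (R : realType) (f : T -> Omega R) :
  (forall k, measurable_fun setT (fun x => f x k : R)) -> measurable_fun setT f.
Proof.
move=> mf; apply: (@measurability _ _ _ _ _ f (@coord_sets R)) => //.
move=> _ [_ [k _ [A mA <-]] <-].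
by rewrite !setTI; rewrite -[X in measurable X]setTI; exact: mf.
Qed.

Definition Useq (R : realType) (x : R) : Omega R := fun k => unif k x.

Lemma measurable_Useq (R : realType) : measurable_fun setT (@Useq R : measurableTypeR R -> Omega R).
Proof. by apply: measurable_into_Omega => k; exact: measurable_unif. Qed.

(** This transports computations on the product space, known through its
    cylinders only, to the unit interval. *)
Lemma product_lebesgueE (R : realType) (P : probability (Omega R) R) (E : set (Omega R)) :
  product_lebesgue P -> measurable E -> P E = mu01 (@Useq R @^-1` E).
Proof.
move=> HP mE.
pose M : {measure set (Omega R) -> \bar R} :=
  image_measure (T1 := measurableTypeR R) (@mu01 R) (@measurable_Useq R).
apply: (@eq_measure_cylinders R P M) => //.
  by rewrite (le_lt_trans (probability_le1 _ measurableT)) ?ltry.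
move=> n A mA; rewrite [LHS](HP n A mA) /M /= /pushforward.
by rewrite [RHS](mu01_unif n mA); apply: eq_bigr => i _; rewrite mu01E.
Qed.

(** * Averages of translates *)

Lemma integral_split (R : realType) (k : measurableTypeR R * measurableTypeR R -> \bar R) :
  measurable_fun setT k -> (forall z, 0 <= k z)%E ->
  (\int[@mu01 R]_y k (split1 y, split2 y) =
   \int[@mu01 R]_u \int[@mu01 R]_v k (u, v))%E.
Proof.
move=> mk k0.
have mf : measurable_fun setT
    ((fun y => (split1 y, split2 y)) : measurableTypeR R -> measurableTypeR R * measurableTypeR R).
  by apply/measurable_fun_pairP; split; [exact: measurable_split1|exact: measurable_split2].
have -> : (\int[@mu01 R]_y k (split1 y, split2 y) =
    \int[pushforward (@mu01 R) (fun y => (split1 y, split2 y) :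
       measurableTypeR R * measurableTypeR R)]_z k z)%E.
  by rewrite ge0_integral_pushforward.
rewrite -[RHS](fubini_tonelli1 (m1 := @mu01 R) (m2 := @mu01 R)) //.
pose M : {measure set (measurableTypeR R * measurableTypeR R) -> \bar R} :=
  image_measure (T1 := measurableTypeR R) (@mu01 R) mf.
rewrite -[LHS]/(\int[M]_z k z)%E.
apply: eq_measure_integral => A mA _; symmetry.
by apply: product_measure_unique => // C D mC mD; exact: mu01_split.
Qed.

(** The functions on which averaging operators act: arbitrary values, infinity
    included, so that no integrability is ever required. *)
Definition testfun (R : realType) (h : R -> \bar R) :=
  measurable_fun setT h /\ (forall x, 0 <= h x)%E.

(** For [w = 1] this is the expectation of [h (x + g U)], that is, the action on
    [h] of adding an independent copy of [g]; a weight [w] restricts the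
    expectation to part of the range of [U]. *)
Definition tr (R : realType) (w g : R -> R) (h : R -> \bar R) (x : R) : \bar R :=
  (\int[@mu01 R]_u ((w u)%:E * h (x + g u)%R))%E.

Definition weight (R : realType) (w : R -> R) :=
  measurable_fun setT w /\ (forall x, 0 <= w x).

Lemma measurable_tr_integrand (R : realType) (w g : R -> R) (h : R -> \bar R) (x : R) :
  weight w -> measurable_fun setT g -> testfun h ->
  measurable_fun setT (fun u => (w u)%:E * h (x + g u)%R)%E.
Proof.
move=> [mw w0] mg [mh h0].
apply: emeasurable_funM; first exact: measurableT_comp.
by apply: measurableT_comp => //; apply: measurable_funD.
Qed.

Lemma testfun_tr_integrand (R : realType) (w g : R -> R) (h : R -> \bar R) (x : R) :
  weight w -> measurable_fun setT g -> testfun h ->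
  testfun (fun u => (w u)%:E * h (x + g u)%R)%E.
Proof.
move=> W mg G; split; first exact: measurable_tr_integrand.
by move=> u; rewrite mule_ge0 ?lee_fin; [|exact: W.2|exact: G.2].
Qed.

Lemma mu01_integralZl (R : realType) (c : R) (f : R -> \bar R) : 0 <= c -> testfun f ->
  (\int[@mu01 R]_u (c%:E * f u) = c%:E * \int[@mu01 R]_u f u)%E.
Proof.
by move=> c0 [mf f0]; rewrite ge0_integralZl.
Qed.

Lemma testfun_tr (R : realType) (w g : R -> R) (h : R -> \bar R) :
  weight w -> measurable_fun setT g -> testfun h -> testfun (tr w g h).
Proof.
move=> [mw w0] mg [mh h0]; split; last first.
  by move=> x; apply: integral_ge0 => u _; rewrite mule_ge0// lee_fin.
pose f (z : measurableTypeR R * measurableTypeR R) := ((w z.2)%:E * h (z.1 + g z.2)%R)%E.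
have f0 z : (0 <= f z)%E by rewrite mule_ge0// lee_fin.
have mf : measurable_fun setT f.
  apply: emeasurable_funM.
    by apply: measurableT_comp => //; apply: (measurableT_comp mw); exact: measurable_snd.
  apply: (measurableT_comp mh); apply: measurable_funD; first exact: measurable_fst.
  by apply: (measurableT_comp mg); exact: measurable_snd.
exact: (measurable_fun_fubini_tonelli_F (m2 := @mu01 R) _ mf f0).
Qed.

Lemma trD (R : realType) (w g : R -> R) (h1 h2 : R -> \bar R) :
  weight w -> measurable_fun setT g -> testfun h1 -> testfun h2 ->
  tr w g (fun x => h1 x + h2 x)%E = (fun x => tr w g h1 x + tr w g h2 x)%E.
Proof.
move=> W mg G1 G2; apply/funext => x; rewrite /tr -ge0_integralD//.
- by apply: eq_integral => u _; rewrite ge0_muleDr//; [case: G1 => _; apply|case: G2 => _; apply].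
- by move=> u _; rewrite mule_ge0// ?lee_fin; [case: W => _; apply|case: G1 => _; apply].
- exact: measurable_tr_integrand.
- by move=> u _; rewrite mule_ge0// ?lee_fin; [case: W => _; apply|case: G2 => _; apply].
- exact: measurable_tr_integrand.
Qed.

Lemma trZ (R : realType) (w g : R -> R) (h : R -> \bar R) (c : R) : 0 <= c ->
  weight w -> measurable_fun setT g -> testfun h ->
  tr w g (fun x => c%:E * h x)%E = (fun x => c%:E * tr w g h x)%E.
Proof.
move=> c0 W mg G; apply/funext => x.
rewrite /tr -(mu01_integralZl c0 (testfun_tr_integrand x W mg G)).
by apply: eq_integral => u _; rewrite muleCA.
Qed.

Lemma le_tr (R : realType) (w g : R -> R) (h1 h2 : R -> \bar R) :
  weight w -> measurable_fun setT g -> testfun h1 -> testfun h2 ->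
  (forall x, h1 x <= h2 x)%E -> (forall x, tr w g h1 x <= tr w g h2 x)%E.
Proof.
move=> W mg G1 G2 h12 x; apply: ge0_le_integral => //.
- by move=> u _; rewrite mule_ge0// ?lee_fin; [case: W => _; apply|case: G1 => _; apply].
- exact: measurable_tr_integrand.
- exact: measurable_tr_integrand.
- by move=> u _; rewrite lee_wpmul2l// lee_fin; case: W => _; apply.
Qed.

(** Translations commute, and the two averages are exchanged by Tonelli. *)
Lemma tr_comm (R : realType) (w1 g1 w2 g2 : R -> R) (h : R -> \bar R) :
  weight w1 -> measurable_fun setT g1 -> weight w2 -> measurable_fun setT g2 -> testfun h ->
  tr w1 g1 (tr w2 g2 h) = tr w2 g2 (tr w1 g1 h).
Proof.
move=> W1 m1 W2 m2 G; apply/funext => x.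
pose f (z : measurableTypeR R * measurableTypeR R) :=
  ((w1 z.1)%:E * ((w2 z.2)%:E * h (x + g1 z.1 + g2 z.2)%R))%E.
have [mw1 w10] := W1; have [mw2 w20] := W2; have [mh h0] := G.
have f0 z : (0 <= f z)%E by rewrite !mule_ge0// lee_fin.
have mf : measurable_fun setT f.
  apply: emeasurable_funM.
    by apply: measurableT_comp => //; apply: (measurableT_comp mw1); exact: measurable_fst.
  apply: emeasurable_funM.
    by apply: measurableT_comp => //; apply: (measurableT_comp mw2); exact: measurable_snd.
  apply: (measurableT_comp mh); apply: measurable_funD; last first.
    by apply: (measurableT_comp m2); exact: measurable_snd.
  apply: measurable_funD => //.
  by apply: (measurableT_comp m1); exact: measurable_fst.
have := fubini_tonelli (m1 := @mu01 R) (m2 := @mu01 R) _ mf f0.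
rewrite /fubini_F /fubini_G /f /= => E.
transitivity (\int[@mu01 R]_u \int[@mu01 R]_v
   ((w1 u)%:E * ((w2 v)%:E * h (x + g1 u + g2 v)%R)))%E.
  by apply: eq_integral => u _;
    rewrite -(mu01_integralZl (w10 u) (testfun_tr_integrand (x + g1 u) W2 m2 G)).
rewrite E; apply: eq_integral => v _.
rewrite -(mu01_integralZl (w20 v) (testfun_tr_integrand (x + g2 v) W1 m1 G)).
by apply: eq_integral => u _; rewrite muleCA [(x + g1 u + g2 v)%R]addrAC.
Qed.

Lemma testfunD (R : realType) (h1 h2 : R -> \bar R) :
  testfun h1 -> testfun h2 -> testfun (fun x => h1 x + h2 x)%E.
Proof.
move=> [m1 p1] [m2 p2]; split; first exact: emeasurable_funD.
by move=> x; rewrite adde_ge0.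
Qed.

Lemma testfunZ (R : realType) (c : R) (h : R -> \bar R) : 0 <= c ->
  testfun h -> testfun (fun x => c%:E * h x)%E.
Proof.
move=> c0 [m p]; split; last by move=> x; rewrite mule_ge0.
by apply: emeasurable_funM => //; exact: measurable_cst.
Qed.

Lemma testfun0 (R : realType) : testfun (fun _ : R => 0%E : \bar R).
Proof. by split => //; exact: measurable_cst. Qed.

(** Only these properties of averages of translates enter the exponential
    inequality.  The axioms are restricted to test functions because integrals of
    other functions are not additive. *)
Definition posop (R : realType) (A : (R -> \bar R) -> R -> \bar R) :=
  [/\ forall h, testfun h -> testfun (A h),
      forall h1 h2, testfun h1 -> testfun h2 ->
        A (fun x => h1 x + h2 x)%E = (fun x => A h1 x + A h2 x)%E,
      forall (c : R) h, 0 <= c -> testfun h ->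
        A (fun x => c%:E * h x)%E = (fun x => c%:E * A h x)%E &
      forall h1 h2, testfun h1 -> testfun h2 -> (forall x, h1 x <= h2 x)%E ->
        forall x, (A h1 x <= A h2 x)%E].

Definition commop (R : realType) (A B : (R -> \bar R) -> R -> \bar R) :=
  forall h, testfun h -> A (B h) = B (A h).

Definition addop (R : realType) (A B : (R -> \bar R) -> R -> \bar R) h (x : R) : \bar R :=
  (A h x + B h x)%E.

Lemma posop_tr (R : realType) (w g : R -> R) :
  weight w -> measurable_fun setT g -> posop (tr w g).
Proof.
move=> W mg; split.
- by move=> h; exact: testfun_tr.
- by move=> h1 h2; exact: trD.
- by move=> c h c0; exact: trZ.
- by move=> h1 h2; exact: le_tr.
Qed.

Lemma posop_add (R : realType) (A B : (R -> \bar R) -> R -> \bar R) :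
  posop A -> posop B -> posop (addop A B).
Proof.
move=> [gA dA zA lA] [gB dB zB lB]; split.
- by move=> h gh; apply: testfunD; [exact: gA|exact: gB].
- move=> h1 h2 g1 g2; apply/funext => x.
  by rewrite /addop dA// dB// addeACA.
- move=> c h c0 gh; apply/funext => x; rewrite /addop zA// zB// ge0_muleDr//.
    exact: (gA _ gh).2.
  exact: (gB _ gh).2.
- by move=> h1 h2 g1 g2 h12 x; apply: leeD; [exact: lA|exact: lB].
Qed.

Lemma posop_zero (R : realType) : @posop R (fun _ _ => 0%E).
Proof.
split => //.
- by move=> *; apply/funext => x; rewrite adde0.
- by move=> *; apply/funext => x; rewrite mule0.
Qed.

Lemma testfun_iter (R : realType) (A : (R -> \bar R) -> R -> \bar R) j h :
  posop A -> testfun h -> testfun (iter j A h).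
Proof. by move=> [gA _ _ _] gh; elim: j => //= j IH; exact: gA. Qed.

Lemma le_iter (R : realType) (A B : (R -> \bar R) -> R -> \bar R) j h :
  posop A -> posop B -> (forall h, testfun h -> forall x, A h x <= B h x)%E -> testfun h ->
  forall x, (iter j A h x <= iter j B h x)%E.
Proof.
move=> pA pB AB gh; elim: j => [//|j IH] x /=.
apply: le_trans (AB _ (testfun_iter j pB gh) x).
by have [gA dA zA lA] := pA; apply: lA => //; exact: testfun_iter.
Qed.

Lemma binomial_step (R : realType) (n : R) (b x y : \bar R) :
  0 <= n -> (0 <= x)%E -> (0 <= y)%E ->
  (b + (n + 1)%:E * x <= (x + b) + n%:E * (y + x))%E.
Proof.
move=> n0 x0 y0; rewrite EFinD ge0_muleDl ?lee_fin// mul1e.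
rewrite (addeC x b) -addeA (addeC x) leeD2l// leeD2r//.
by apply: lee_wpmul2l; rewrite ?lee_fin// leeDr.
Qed.

(** Only the first two terms of the binomial formula for [(A + B) ^ (j + 1)] are
    kept. *)
Lemma iter_addop_ge (R : realType) (A B : (R -> \bar R) -> R -> \bar R) j h :
  posop A -> posop B -> commop A B -> testfun h -> forall x,
  (iter j.+1 B h x + (j.+1%:R : R)%:E * A (iter j B h) x <= iter j.+1 (addop A B) h x)%E.
Proof.
move=> pA pB cAB gh; have [gA dA zA lA] := pA; have [gB dB zB lB] := pB.
have [gS dS zS lS] := posop_add pA pB.
elim: j => [|j IH] x.
  by rewrite /= mul1e addeC.
rewrite -[iter j.+2 (addop A B) h]/(addop A B (iter j.+1 (addop A B) h)).
have gBj k : testfun (iter k B h) by exact: testfun_iter.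
have G : testfun (fun x => iter j.+1 B h x + (j.+1%:R : R)%:E * A (iter j B h) x)%E.
  by apply: testfunD => //; apply: testfunZ => //; exact: gA.
have := lS _ _ G (testfun_iter j.+1 (posop_add pA pB) gh) IH x.
apply: le_trans.
rewrite dS//; last by apply: testfunZ => //; exact: gA.
rewrite zS//; last exact: gA.
rewrite /addop -cAB//.
rewrite -[B (iter j.+1 B h)]/(iter j.+2 B h) -[B (iter j B h)]/(iter j.+1 B h).
rewrite -[j.+2%:R]natr1; apply: binomial_step => //.
- exact: (gA _ (gBj _)).2.
- exact: (gA _ (gA _ (gBj _))).2.
Qed.

Fixpoint sumop (R : realType) (A : nat -> (R -> \bar R) -> R -> \bar R) (n : nat) :
    (R -> \bar R) -> R -> \bar R :=
  if n is p.+1 then addop (A 0%N) (sumop (fun i => A i.+1) p) else (fun _ _ => 0%E).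

(** The product of the operators [1 + A i], for [i < n]. *)
Fixpoint prod1op (R : realType) (A : nat -> (R -> \bar R) -> R -> \bar R) (n : nat)
    (h : R -> \bar R) : R -> \bar R :=
  if n is p.+1 then
    (fun x => prod1op (fun i => A i.+1) p h x + A 0%N (prod1op (fun i => A i.+1) p h) x)%E
  else h.

Definition expop (R : realType) (J : nat) (A : (R -> \bar R) -> R -> \bar R) h (x : R) : \bar R :=
  (\sum_(j < J) ((j`!%:R)^-1 : R)%:E * iter j A h x)%E.

Lemma posop_sumop (R : realType) (A : nat -> (R -> \bar R) -> R -> \bar R) (n : nat) :
  (forall i, posop (A i)) -> posop (sumop A n).
Proof.
elim: n A => [|n IH] A pA /=; first exact: posop_zero.
by apply: posop_add => //; exact: IH.
Qed.

Lemma commop_sumop (R : realType) A0 (A : nat -> (R -> \bar R) -> R -> \bar R) (n : nat) :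
  posop A0 -> (forall i, posop (A i)) ->
  (forall i, commop A0 (A i)) -> commop A0 (sumop A n).
Proof.
move=> pA0; elim: n A => [|n IH] A pA cA h gh /=.
  have [_ _ zA _] := pA0; have := zA 0 _ (lexx _) gh.
  under eq_fun do rewrite mul0e.
  by move=> ->; apply/funext => x; rewrite mul0e.
have [_ dA _ _] := pA0; rewrite /addop dA; first last.
- by have [gS _ _ _] := @posop_sumop R (fun i => A i.+1) n (fun i => pA i.+1); exact: gS.
- by have [gS _ _ _] := pA 0%N; exact: gS.
by apply/funext => x; rewrite cA// (IH (fun i => A i.+1)).
Qed.

Lemma testfun_prod1op (R : realType) (A : nat -> (R -> \bar R) -> R -> \bar R) (n : nat) h :
  (forall i, posop (A i)) -> testfun h -> testfun (prod1op A n h).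
Proof.
move=> pA gh; elim: n A pA => [|n IH] A pA //=.
apply: testfunD; first exact: IH.
by have [gS _ _ _] := pA 0%N; apply: gS; exact: IH.
Qed.

Lemma testfun_expop (R : realType) (A : (R -> \bar R) -> R -> \bar R) (J : nat) h :
  posop A -> testfun h -> testfun (expop J A h).
Proof.
move=> pA gh; have gi j : testfun (iter j A h) by exact: testfun_iter.
elim: J => [|J IH].
  rewrite (_ : expop 0 A h = fun=> 0%E); first exact: testfun0.
  by apply/funext => x; rewrite /expop big_ord0.
rewrite (_ : expop J.+1 A h = fun x => expop J A h x + ((J`!%:R)^-1 : R)%:E * iter J A h x)%E.
  by apply: testfunD => //; apply: testfunZ.
by apply/funext => x; rewrite /expop big_ord_recr.
Qed.

(** Induction step for [prod (1 + A i) <= exp (sum A i)]: multiplying by [1 + A]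
    costs one more term of the exponential series. *)
Lemma expop_addop_ge (R : realType) (A B : (R -> \bar R) -> R -> \bar R) J h :
  posop A -> posop B -> commop A B -> testfun h -> forall x,
  (expop J.+1 B h x + A (expop J B h) x <= expop J.+1 (addop A B) h x)%E.
Proof.
move=> pA pB cAB gh x; have [gA dA zA lA] := pA.
have gBj k : testfun (iter k B h) by exact: testfun_iter.
have -> : A (expop J B h) x = (\sum_(j < J) ((j`!%:R)^-1 : R)%:E * A (iter j B h) x)%E.
  elim: J => [|J IH].
    rewrite big_ord0 (_ : expop 0 B h = fun x => 0%:E * h x)%E.
      by rewrite zA// mul0e.
    by apply/funext => y; rewrite /expop big_ord0 mul0e.
  rewrite big_ord_recr /= -IH.
  have -> : expop J.+1 B h = (fun x => expop J B h x + ((J`!%:R)^-1 : R)%:E * iter J B h x)%E.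
    by apply/funext => y; rewrite /expop big_ord_recr.
  rewrite dA ?zA//; [exact: testfun_expop|exact: testfunZ].
rewrite /expop !big_ord_recl /= -addeA leeD2l// -big_split /=.
apply: lee_sum => j _; rewrite /bump /= add1n -!iterS.
have := iter_addop_ge j pA pB cAB gh x.
have f0 : (0 <= ((j.+1`!%:R)^-1 : R)%:E)%E by rewrite lee_fin.
move=> /(lee_wpmul2l f0); apply: le_trans.
rewrite ge0_muleDr; last by apply: mule_ge0 => //; exact: (gA _ (gBj _)).2.
  rewrite muleA -EFinM factS natrM invfM [(_^-1 * _^-1)%R]mulrC -mulrA mulVf ?pnatr_eq0//.
  by rewrite mulr1.
exact: (gBj j.+1).2.
Qed.

(** The product has degree [n] in the [A i], so that truncated series suffice. *)
Lemma prod1op_le_expop (R : realType) (A : nat -> (R -> \bar R) -> R -> \bar R) (n J : nat) h :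
  (forall i, posop (A i)) -> (forall i j, commop (A i) (A j)) -> testfun h -> (n <= J)%N ->
  forall x, (prod1op A n h x <= expop J.+1 (sumop A n) h x)%E.
Proof.
move=> pA cA gh; elim: n J A pA cA => [|n IH] J A pA cA nJ x /=.
  rewrite /expop big_ord_recl /= invr1 mul1e leeDl// sume_ge0// => j _.
  by rewrite mule_ge0.
case: J nJ => // J nJ.
have pS : posop (sumop (fun i => A i.+1) n) by exact: posop_sumop.
apply: le_trans (expop_addop_ge J.+1 _ pS _ gh x) => //; last first.
  exact: commop_sumop.
apply: leeD; first by apply: IH => //; exact: leqW.
have [gA dA zA lA] := pA 0%N; apply: lA; last exact: IH.
- exact: testfun_prod1op.
- exact: testfun_expop.
Qed.

(** A sum of independent variables with the laws of the [f k]. *)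
Definition psum (R : realType) (f : nat -> R -> R) (n : nat) (y : R) : R :=
  \sum_(k < n) f k (unif k y).

(** The operator [h |-> E h (x + S)] of the sum [S] of independent variables with
    the laws of [f 0, ..., f (n - 1)]. *)
Fixpoint conv (R : realType) (f : nat -> R -> R) (n : nat) (h : R -> \bar R) : R -> \bar R :=
  if n is p.+1 then tr (fun=> 1) (f 0%N) (conv (fun i => f i.+1) p h) else h.

Lemma weight1 (R : realType) : @weight R (fun=> 1).
Proof. by split => //; exact: measurable_cst. Qed.

Lemma mu01_integral_cst (R : realType) (c : \bar R) :
  (\int[@mu01 R]_y cst c y = c)%E.
Proof.
rewrite integral_cst; last exact: measurableT.
by rewrite -[RHS]mule1 -(mu01_setT R).
Qed.

Lemma psumS (R : realType) (f : nat -> R -> R) (n : nat) (y : R) :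
  psum f n.+1 y = f 0%N (split1 y) + psum (fun i => f i.+1) n (split2 y).
Proof.
by rewrite /psum big_ord_recl; congr (_ + _); apply: eq_bigr => i _; rewrite -unifS.
Qed.

Lemma measurable_psum (R : realType) (f : nat -> R -> R) (n : nat) :
  (forall k, measurable_fun setT (f k)) -> measurable_fun setT (psum f n).
Proof.
move=> mf; rewrite /psum; apply: measurable_sum => k.
by apply: (measurableT_comp (mf k)); exact: measurable_unif.
Qed.

Lemma testfun_conv (R : realType) (f : nat -> R -> R) (n : nat) h :
  (forall k, measurable_fun setT (f k)) -> testfun h -> testfun (conv f n h).
Proof.
move=> mf gh; elim: n f mf => [|n IH] f mf //=.
by apply: testfun_tr; [exact: weight1| |exact: IH].
Qed.

(** Tonelli: the variables are integrated out one after the other. *)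
Lemma integral_psum (R : realType) (f : nat -> R -> R) (n : nat) h x :
  (forall k, measurable_fun setT (f k)) -> testfun h ->
  (\int[@mu01 R]_y h (x + psum f n y)%R = conv f n h x)%E.
Proof.
move=> mf gh; elim: n f mf x => [|n IH] f mf x /=.
  rewrite (eq_integral (cst (h x))).
    by rewrite mu01_integral_cst.
  by move=> y _; rewrite /psum big_ord0 addr0.
pose k (z : measurableTypeR R * measurableTypeR R) :=
  h (x + f 0%N z.1 + psum (fun i => f i.+1) n z.2)%R.
have k0 z : (0 <= k z)%E by exact: gh.2.
have mk : measurable_fun setT k.
  apply: (measurableT_comp gh.1); apply: measurable_funD.
    by apply: measurable_funD => //; apply: (measurableT_comp (mf 0%N)); exact: measurable_fst.
  apply: (measurableT_comp (measurable_psum n (fun i => mf i.+1))).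
  exact: measurable_snd.
transitivity (\int[@mu01 R]_y k (split1 y, split2 y))%E.
  by apply: eq_integral => y _; rewrite psumS addrA.
rewrite integral_split//; apply: eq_integral => u _.
by rewrite -IH// mul1e.
Qed.

Lemma testfun_indic (R : realType) (A : set R) : measurable A ->
  testfun (fun x => (\1_A x)%:E : \bar R).
Proof.
move=> mA; split; last by move=> x; rewrite lee_fin.
by apply: measurableT_comp => //; exact: measurable_indic.
Qed.

Lemma mu01_psum (R : realType) (f : nat -> R -> R) (n : nat) (A : set R) :
  (forall k, measurable_fun setT (f k)) -> measurable A ->
  mu01 (psum f n @^-1` A) = conv f n (fun x => (\1_A x)%:E) 0.
Proof.
move=> mf mA; rewrite -integral_psum//; last exact: testfun_indic.
rewrite -[X in mu01 X]setIT -[LHS](@integral_indic _ _ _ (@mu01 R) setT measurableT).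
  by apply: eq_integral => y _; rewrite add0r.
exact: (measurable_preimage (measurable_psum n mf)).
Qed.

Definition nz (R : realType) (f : R -> R) : R -> R := \1_[set x | f x != 0].

Lemma measurable_nz_set (R : realType) (f : R -> R) : measurable_fun setT f ->
  measurable [set x | f x != 0].
Proof.
move=> mf; rewrite (_ : mkset _ = f @^-1` (~` [set 0])).
  by apply: measurable_preimage => //; exact: measurableC.
by apply/seteqP; split => x /=; [move/eqP|move=> /eqP].
Qed.

Lemma weight_nz (R : realType) (f : R -> R) : measurable_fun setT f -> weight (nz f).
Proof.
by move=> mf; split => //; apply: measurable_indic; exact: measurable_nz_set.
Qed.

(** Where [f] vanishes the translate of [h] is [h] itself. *)
Lemma tr_le_nz (R : realType) (f : R -> R) h x : measurable_fun setT f -> testfun h ->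
  (tr (fun=> 1%R) f h x <= h x + tr (nz f) f h x)%E.
Proof.
move=> mf gh.
have -> : (h x + tr (nz f) f h x =
    \int[@mu01 R]_u (cst (h x) u + (nz f u)%:E * h (x + f u)%R))%E.
  rewrite ge0_integralD//.
  - by rewrite mu01_integral_cst.
  - by move=> u _; exact: gh.2.
  - by move=> u _; rewrite mule_ge0// ?lee_fin//; exact: gh.2.
  - by have [] := testfun_tr_integrand x (weight_nz mf) mf gh.
have [m1 p1] := testfun_tr_integrand x (weight_nz mf) mf gh.
have [m2 p2] := testfun_tr_integrand x (@weight1 R) mf gh.
apply: ge0_le_integral => //.
- by apply: emeasurable_funD => //; exact: measurable_cst.
- move=> u _; rewrite mul1e /nz indicE /=; case: (boolP (f u == 0)) => fu.
    by rewrite (eqP fu) addr0 leeDl// mule_ge0 ?lee_fin//; exact: gh.2.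
  by rewrite mem_set// mul1e leeDr//; exact: gh.2.
Qed.

Lemma conv_le_prod1op (R : realType) (f : nat -> R -> R) (n : nat) h :
  (forall k, measurable_fun setT (f k)) -> testfun h -> forall x,
  (conv f n h x <= prod1op (fun k => tr (nz (f k)) (f k)) n h x)%E.
Proof.
move=> mf gh; elim: n f mf => [|n IH] f mf x //=.
have gc : testfun (conv (fun i => f i.+1) n h) by exact: testfun_conv.
have gp : testfun (prod1op (fun i => tr (nz (f i.+1)) (f i.+1)) n h).
  by apply: testfun_prod1op => // i; apply: posop_tr => //; exact: weight_nz.
apply: le_trans (tr_le_nz x (mf 0%N) gc) _; apply: leeD; first exact: IH.
by apply: le_tr => //; [exact: weight_nz|exact: IH].
Qed.

Lemma sumopE (R : realType) (A : nat -> (R -> \bar R) -> R -> \bar R) n h x :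
  sumop A n h x = (\sum_(k < n) A k h x)%E.
Proof.
elim: n A => [|n IH] A /=; first by rewrite big_ord0.
by rewrite big_ord_recl /addop IH.
Qed.

(** The operator depends only on the law of [f] away from zero, which is what
    disjoint sums preserve. *)
Lemma tr_nzE (R : realType) (f : R -> R) h x (mf : measurable_fun setT f) : testfun h ->
  tr (nz f) f h x =
  (\int[image_measure (T1 := measurableTypeR R) (T2 := measurableTypeR R)
      (@mu01 R) mf]_(y in [set y | y != 0%R]) h (x + y)%R)%E.
Proof.
move=> gh.
have mN : measurable [set y : R | y != 0].
  by apply: (@measurable_nz_set _ id); exact: measurable_id.
have -> : (\int[image_measure (T1 := measurableTypeR R) (T2 := measurableTypeR R)
      (@mu01 R) mf]_(y in [set y | y != 0%R]) h (x + y)%R =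
   \int[pushforward (@mu01 R) (f : measurableTypeR R -> measurableTypeR R)]_(y in [set y | y != 0%R]) h (x + y)%R)%E by [].
rewrite ge0_integral_pushforward//.
- rewrite integral_mkcond; apply: eq_integral => u _.
  by rewrite /nz patchE indicE; case: ifPn => _; rewrite ?mul1e ?mul0e.
- apply: measurable_funTS; apply: (measurableT_comp gh.1).
  by apply: measurable_funD => //; exact: measurable_cst.
- by move=> y _; exact: gh.2.
Qed.

(** The hypothesis on tails says that the law of [G] away from zero is the sum of
    the laws of the [f k]. *)
Lemma sumop_tr_nz (R : realType) (G : R -> R) (f : nat -> R -> R) (n : nat) h :
  (forall k, measurable_fun setT (f k)) -> measurable_fun setT G ->
  (forall k x, 0 <= f k x) -> (forall x, 0 <= G x) ->
  (forall s, 0 <= s ->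
    mu01 [set x | s < G x] = (\sum_(k < n) mu01 [set x | s < f k x]%R)%E) ->
  testfun h -> forall x,
  sumop (fun k => tr (nz (f k)) (f k)) n h x = tr (nz G) G h x.
Proof.
move=> mf mG f0 G0 HG gh x; rewrite sumopE.
pose mu_ (g : R -> R) (mg : measurable_fun setT g) :
    {measure set (measurableTypeR R) -> \bar R} :=
  image_measure (T1 := measurableTypeR R) (T2 := measurableTypeR R) (@mu01 R) mg.
pose D : set (measurableTypeR R) := [set y : R | y != 0].
have mD : measurable D by apply: (@measurable_nz_set _ id); exact: measurable_id.
rewrite (tr_nzE x mG gh) -/(mu_ _ mG).
under eq_bigr => k _ do rewrite (tr_nzE x (mf k) gh) -/(mu_ _ (mf k)).
have mh : measurable_fun D (fun y => h (x + y)%R).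
  apply: measurable_funTS; apply: (measurableT_comp gh.1).
  by apply: measurable_funD => //; exact: measurable_cst.
rewrite -(@ge0_integral_measure_sum _ _ _ (fun k => mu_ _ (mf k)) D mD
   (fun y => h (x + y)%R) _ mh n); last by move=> y _; exact: gh.2.
apply: eq_measure_integral => A mA AD.
pose M1 : {measure set (measurableTypeR R) -> \bar R} := mrestr (msum (fun k => mu_ _ (mf k)) n) mD.
pose M2 : {measure set (measurableTypeR R) -> \bar R} := mrestr (mu_ _ mG) mD.
suff : M1 A = M2 A by rewrite /M1 /M2 /= /mrestr (setIidl AD).
have M1E B : M1 B = (\sum_(k < n) mu01 (f k @^-1` (B `&` D)))%E by [].
have M2E B : M2 B = mu01 (G @^-1` (B `&` D)) by [].
have gt0 (g : R -> R) u : (forall y, 0 <= g y) ->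
    g @^-1` (`]u, +oo[%classic `&` D) = [set y | Num.max u 0 < g y].
  move=> g0; apply/seteqP; split => y /=; rewrite in_itv/= andbT gt_max.
    by move=> [-> gy]; rewrite lt0r gy g0.
  by move=> /andP[-> gy]; split => //; rewrite /D /= gt_eqF.
have gtT (g : R -> R) : (forall y, 0 <= g y) -> g @^-1` (setT `&` D) = [set y | 0 < g y].
  by move=> g0; apply/seteqP; split => y /=; rewrite /D /= lt0r g0 andbT; [case|].
have E : M1 setT = M2 setT.
  rewrite M1E M2E gtT// HG//; apply: eq_bigr => k _; rewrite gtT//.
apply: eq_measure_rays => //.
- rewrite E M2E (le_lt_trans (probability_le1 _ _)) ?ltry//.
  by apply: (measurable_preimage mG); rewrite setTI.
- move=> u; rewrite M1E M2E gt0// HG ?le_max ?lexx ?orbT//.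
  by apply: eq_bigr => k _; rewrite gt0.
Qed.

Lemma conv_const (R : realType) (g : R -> R) (j : nat) h :
  conv (fun=> g) j h = iter j (tr (fun=> 1) g) h.
Proof. by elim: j => //= j ->. Qed.

Lemma gt_setE (R : realType) (f : R -> R) (s : R) :
  [set x | s < f x] = f @^-1` `]s, +oo[%classic.
Proof. by apply/seteqP; split => x /=; rewrite in_itv/= andbT. Qed.

Lemma tr_nz_le (R : realType) (f : R -> R) h x : measurable_fun setT f -> testfun h ->
  (tr (nz f) f h x <= tr (fun=> 1%R) f h x)%E.
Proof.
move=> mf gh.
have [m1 p1] := testfun_tr_integrand x (weight_nz mf) mf gh.
have [m2 p2] := testfun_tr_integrand x (@weight1 R) mf gh.
apply: ge0_le_integral => // u _.
by apply: lee_wpmul2r; [exact: gh.2|rewrite lee_fin /nz indicE; case: (_ \in _)].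
Qed.

Lemma le_expop (R : realType) (A B : (R -> \bar R) -> R -> \bar R) J h :
  posop A -> posop B -> (forall h, testfun h -> forall x, A h x <= B h x)%E -> testfun h ->
  forall x, (expop J A h x <= expop J B h x)%E.
Proof.
move=> pA pB AB gh x; apply: lee_sum => j _.
by apply: lee_wpmul2l; [rewrite lee_fin|exact: le_iter].
Qed.

(** The operator of the sum is at most [prod (1 + T_k)], hence at most the
    exponential of [sum T_k], which is the operator of [G] restricted to its
    nonzero values; the powers of the latter are below the operators of sums of
    independent copies of [G]. *)
Lemma psum_tail_le (R : realType) (G : R -> R) (f : nat -> R -> R) (n : nat) :
  (forall k, measurable_fun setT (f k)) -> measurable_fun setT G ->
  (forall k x, 0 <= f k x) -> (forall x, 0 <= G x) ->
  (forall s, 0 <= s ->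
    mu01 [set x | s < G x] = (\sum_(k < n) mu01 [set x | s < f k x]%R)%E) ->
  forall s,
  (mu01 [set x | s < psum f n x]%R <=
   \sum_(j < n.+1) ((j`!%:R)^-1 : R)%:E * mu01 [set x | s < psum (fun=> G) j x]%R)%E.
Proof.
move=> mf mG f0 G0 HG s.
have mI : measurable (`]s, +oo[%classic : set R) by [].
have gI := testfun_indic mI.
rewrite gt_setE mu01_psum//.
under eq_bigr => j _ do rewrite gt_setE mu01_psum// conv_const.
apply: le_trans (conv_le_prod1op n mf gI 0) _.
have pf i : posop (tr (nz (f i)) (f i)) by apply: posop_tr => //; exact: weight_nz.
apply: le_trans (prod1op_le_expop pf _ gI (leqnn n) 0) _.
  by move=> i j h gh; apply: tr_comm => //; exact: weight_nz.
apply: le_expop => //.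
- exact: posop_sumop.
- by apply: posop_tr => //; exact: weight1.
- move=> h gh x; rewrite (sumop_tr_nz mf mG)//; exact: tr_nz_le.
Qed.

(** * Tails of the Kruglov operator *)

Section Kruglov.
Variables (R : realType) (P : probability (Omega R) R) (B : nat -> set R).
Hypotheses (HP : product_lebesgue P) (HB : kruglov_partition B).

Lemma kruglov_eq (f : R -> R) (w : nat -> R) (j : nat) : (0 < j)%N -> B j (w 0%N) ->
  kruglov B f w = \sum_(k < j) f (w k.+1).
Proof.
move=> j0 Bj; have [mB tB lB] := HB.
rewrite /kruglov; apply/cvg_lim => //; apply: cvg_near_cst.
exists j.+1 => // N /= jN.
have z n : (0 < n)%N -> n != j -> (\1_(B n) (w 0%N) : R) = 0.
  move=> n0 nj; rewrite indicE; case: (boolP (_ \in _)) => // /set_mem Bn.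
  have := tB n j n0 j0 (ex_intro _ (w 0%N) (conj Bn Bj)).
  by move=> e; rewrite e eqxx in nj.
rewrite (bigD1_seq j) /=; first last.
- exact: iota_uniq.
- by rewrite mem_index_iota j0.
rewrite [X in _ + X]big1_seq ?addr0.
  rewrite big_add1 /= big_mkord; apply: eq_bigr => k _.
  by rewrite indicE mem_set// mulr1.
move=> n /andP[nj]; rewrite mem_index_iota => /andP[n0 _].
by rewrite big1// => k _; rewrite z// mulr0.
Qed.

Lemma kruglov_out (f : R -> R) (w : nat -> R) :
  (forall j, (0 < j)%N -> ~ B j (w 0%N)) -> kruglov B f w = 0.
Proof.
move=> H; rewrite /kruglov; apply/cvg_lim => //; apply: cvg_near_cst.
apply: nearW => N; rewrite big1_seq// => n; rewrite mem_index_iota => /andP[_ /andP[n0 _]].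
by rewrite big1// => k _; rewrite indicE memNset ?mulr0//; exact: H.
Qed.

Lemma measurable_cube : measurable (@cube R : set (Omega R)).
Proof.
rewrite (_ : @cube R = \bigcap_n ((fun w : Omega R => (w n : R)) @^-1` (@I01 R))).
  apply: bigcapT_measurable => n; rewrite -[X in measurable X]setTI.
  by apply: measurable_coord => //; exact: measurable_I01.
by apply/seteqP; split => [w H n _|w H n]; [exact: H|exact: (H n I)].
Qed.

(* the part of a tail event on which exactly [j] terms are added *)
Let ev (f : R -> R) (s : R) (j : nat) : set (Omega R) :=
  [set w : Omega R | [/\ (0 < j)%N, cube w, B j (w 0%N) & s < `|\sum_(k < j) f (w k.+1)|]].

Lemma measurable_abs_gt d (T : measurableType d) (g : T -> R) (s : R) :
  measurable_fun setT g -> measurable [set x | s < `|g x|].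
Proof.
move=> mg; rewrite (_ : mkset _ = (fun x => `|g x|) @^-1` `]s, +oo[%classic).
  by rewrite -[X in measurable X]setTI; apply: (measurableT_comp _ mg).
by apply/seteqP; split => x /=; rewrite in_itv/= andbT.
Qed.

Lemma measurable_ev f s j : measurable_fun setT f -> measurable (ev f s j).
Proof.
move=> mf; case: j => [|j].
  by rewrite (_ : ev f s 0%N = set0)//; apply/seteqP; split => // w [].
have [mB _ _] := HB.
rewrite (_ : ev f s j.+1 = @cube R `&` ((fun w : Omega R => (w 0%N : R)) @^-1` B j.+1)
    `&` [set w : Omega R | s < `|\sum_(k < j.+1) f (w k.+1)|]).
  apply: measurableI; first (apply: measurableI; first exact: measurable_cube).
    by rewrite -[X in measurable X]setTI; apply: measurable_coord => //; exact: (mB _ _).1.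
  apply: measurable_abs_gt; apply: measurable_sum => k.
  by apply: (measurableT_comp mf); exact: measurable_coord.
by apply/seteqP; split => w /=; [move=> [_ ? ? ?]|move=> [[? ?] ?]].
Qed.

Lemma mu_ev f s j : measurable_fun setT f -> 0 <= s ->
  P (ev f s j) = (((expR 1 * j`!%:R)^-1 : R)%:E * mu01 [set x | s < `|psum (fun=> f) j x|]%R)%E.
Proof.
move=> mf s0; case: j => [|j].
  rewrite (_ : ev f s 0%N = set0) ?measure0; last by apply/seteqP; split => // w [].
  rewrite (_ : mkset _ = set0) ?measure0 ?mule0//; apply/seteqP; split => // x /=.
  by rewrite /psum big_ord0 normr0; move=> H; have := le_lt_trans s0 H; rewrite ltxx.
have [mB _ lB] := HB.
have mS : measurable [set x | s < `|psum (fun=> f) j.+1 x|].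
  by apply: measurable_abs_gt; apply: measurable_psum.
rewrite (product_lebesgueE HP); last exact: measurable_ev.
rewrite (_ : _ @^-1` _ = @split1 R @^-1` (B j.+1) `&`
    @split2 R @^-1` [set x | s < `|psum (fun=> f) j.+1 x|]); last first.
  have E x : \sum_(k < j.+1) f (unif k.+1 x) = psum (fun=> f) j.+1 (split2 x).
    by apply: eq_bigr => k _; rewrite unifS.
  apply/seteqP; split => x; rewrite /ev /preimage /= -E; first by move=> [_ _ ? ?].
  by move=> [? ?]; split => // n; rewrite /I01 /= in_itv/= unif_I01.
rewrite mu01_split//; last exact: (mB _ _).1.
congr (_ * _)%E; rewrite mu01E setIidr; last exact: (mB _ _).2.
exact: lB.
Qed.

Lemma kruglov_tail_ev (f : R -> R) (s : R) : 0 <= s ->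
  @cube R `&` [set w | s < `|kruglov B f w|] = \bigcup_j ev f s j.
Proof.
move=> s0; apply/seteqP; split => w /=.
  move=> [cw sw]; have [[j [j0 Bj]]|H] := pselect (exists j, (0 < j)%N /\ B j (w 0%N)).
    by exists j => //; split => //; rewrite -(kruglov_eq f j0 Bj).
  rewrite kruglov_out ?normr0 in sw; first by have := le_lt_trans s0 sw; rewrite ltxx.
  by move=> j j0 Bj; apply: H; exists j.
by move=> [j _ [j0 cw Bj sj]]; split => //; rewrite (kruglov_eq f j0 Bj).
Qed.

Lemma measurable_kruglov_tail (f : R -> R) (s : R) : measurable_fun setT f -> 0 <= s ->
  measurable (@cube R `&` [set w | s < `|kruglov B f w|] : set (Omega R)).
Proof.
move=> mf s0; rewrite kruglov_tail_ev//; apply: bigcupT_measurable => j.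
exact: measurable_ev.
Qed.

(** The first coordinate selects the number [j] of terms, with probability
    [1 / (e j!)] and independently of the terms. *)
Lemma kruglov_tail (f : R -> R) (s : R) : measurable_fun setT f -> 0 <= s ->
  P (@cube R `&` [set w | s < `|kruglov B f w|]) =
  (\sum_(j <oo) ((expR 1 * j`!%:R)^-1 : R)%:E * mu01 [set x | s < `|psum (fun=> f) j x|]%R)%E.
Proof.
move=> mf s0; rewrite kruglov_tail_ev// measure_bigcup//=.
- apply: etrans (eq_eseriesr _); last by move=> j _; exact: mu_ev.
  by apply: eq_eseriesl => j; rewrite in_setT.
- by move=> j _; exact: measurable_ev.
- move=> i j _ _ [w [[i0 _ Bi _] [j0 _ Bj _]]].
  by have [_ tB _] := HB; apply: tB => //; exists (w 0%N).
Qed.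

End Kruglov.

(** * Decreasing rearrangements *)

(** The generalized inverse of a distribution function: rearrangements, for every
    measure space, are of this form. *)
Definition ginv (R : realType) (D : R -> \bar R) (t : R) : R :=
  inf [set s | 0 <= s /\ (D s <= t%:E)%E].

(** Without this the infimum defining [ginv D t] could range over the empty set,
    and take the value zero by convention. *)
Definition vanishing (R : realType) (D : R -> \bar R) :=
  forall t : R, 0 < t -> exists2 s, 0 <= s & (D s <= t%:E)%E.

Lemma ginv_ge0 (R : realType) (D : R -> \bar R) (t : R) : 0 <= ginv D t.
Proof.
rewrite /ginv; set S := [set s | _]; have [->|/set0P S0] := eqVneq S set0.
  by rewrite inf0.
by apply: lb_le_inf => // s [].
Qed.

Lemma ginv_le (R : realType) (D : R -> \bar R) (t s : R) :
  0 <= s -> (D s <= t%:E)%E -> ginv D t <= s.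
Proof. by move=> s0 Ds; apply: ge_inf => //; exists 0 => r []. Qed.

Lemma ginv_gt (R : realType) (D : R -> \bar R) (t s : R) :
  0 <= s -> s < ginv D t -> (t%:E < D s)%E.
Proof.
by move=> s0; rewrite ltNge => H; rewrite ltNge; apply: contra H; exact: ginv_le.
Qed.

Lemma le_ginv (R : realType) (D1 D2 : R -> \bar R) (t : R) :
  (exists2 s, 0 <= s & (D2 s <= t%:E)%E) ->
  (forall s, 0 <= s -> (D1 s <= D2 s)%E) -> ginv D1 t <= ginv D2 t.
Proof.
move=> [s s0 Ds] D12; apply: lb_le_inf; first by exists s.
by move=> r [r0 Dr]; apply: ginv_le => //; apply: le_trans Dr; exact: D12.
Qed.

Lemma ginv_nonincreasing (R : realType) (D : R -> \bar R) (t1 t2 : R) :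
  vanishing D -> 0 < t1 -> t1 <= t2 -> ginv D t2 <= ginv D t1.
Proof.
move=> dD t0 t12; have [s s0 Ds] := dD _ t0.
apply: lb_le_inf; first by exists s.
by move=> r [r0 Dr]; apply: ginv_le => //; apply: le_trans Dr _; rewrite lee_fin.
Qed.

(** On positive numbers [ginv D] is monotone, so that inverse images of rays are
    intervals; at zero monotonicity may fail. *)
Lemma measurable_ginv (R : realType) (D : R -> \bar R) :
  vanishing D -> measurable_fun (`[0, +oo[%classic : set R) (ginv D).
Proof.
move=> dD.
have -> : `[0, +oo[%classic = [set 0] `|` `]0, +oo[%classic :> set R.
  apply/seteqP; split => x; rewrite /= !in_itv/= !andbT.
    by rewrite le_eqVlt => /orP[/eqP <-|->]; [left|right].
  by case=> [->//|/ltW].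
apply/measurable_funU => //; split; first exact: measurable_fun_set1.
apply: (measurability (@RGenOInfty.G R)); first exact: RGenOInfty.measurableE.
move=> _ [_ [u ->] <-]; apply: is_interval_measurable.
move=> x y /= [+ ux] [+ uy] z; rewrite !in_itv/= in ux uy *.
rewrite !andbT in ux uy *.
move=> x0 y0 /andP[xz zy]; split; first exact: lt_le_trans xz.
apply: lt_le_trans uy _; apply: ginv_nonincreasing => //.
exact: lt_le_trans xz.
Qed.

Lemma measurable_ginv01 (R : realType) (D : R -> \bar R) :
  vanishing D -> measurable_fun (@I01 R) (ginv D).
Proof.
move=> /measurable_ginv; apply: measurable_funS; first exact: measurable_itv.
by move=> x; rewrite /I01 /= !in_itv/= andbT => /andP[].
Qed.

Section tails.
Context d (T : measurableType d) (R : realType) (mu : {measure set T -> \bar R}).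
Variables (A : set T) (f : T -> R).
Hypothesis mtail : forall s : R, 0 <= s -> measurable (A `&` [set x | s < `|f x|]).

Let tail_anti (s r : R) : s <= r ->
  A `&` [set x | r < `|f x|] `<=` A `&` [set x | s < `|f x|].
Proof. by move=> sr x [Ax /= rx]; split => //=; exact: le_lt_trans rx. Qed.

Lemma tail_vanishing : (mu (A `&` [set x | (0 < `|f x|)%R]) < +oo)%E ->
  vanishing (fun s => mu (A `&` [set x | s < `|f x|])).
Proof.
move=> fin t t0.
have cap0 : \bigcap_n (A `&` [set x | n%:R < `|f x|]) = set0.
  apply/seteqP; split => // x H.
  have /andP[_ h] := truncn_itv (normr_ge0 (f x)).
  by have [_ /= h'] := H (Num.truncn `|f x|).+1 I; have := lt_trans h h'; rewrite ltxx.
have := @nonincreasing_cvg_mu _ _ _ mu (fun n => A `&` [set x | n%:R < `|f x|]) fin.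
rewrite cap0 measure0 => H.
have {}H : (fun n => mu (A `&` [set x | n%:R < `|f x|])) @ \oo --> 0%E.
  apply: H => //; first by move=> i; exact: mtail.
  by move=> n m nm; apply/subsetPset; apply: tail_anti; rewrite ler_nat.
have := H [set` `]-oo, t%:E[%E].
case.
  apply: open_nbhs_nbhs; split; last by rewrite /= in_itv /= lte_fin.
  exact: lray_open.
move=> N _ /(_ N (leqnn N)) /=; rewrite in_itv /= => HN.
by exists N%:R => //; exact: ltW.
Qed.

(** By right continuity of the distribution function, the infimum that defines
    the rearrangement is attained. *)
Lemma tail_ginv (t : R) :
  (exists2 s, 0 <= s & (mu (A `&` [set x | (s < `|f x|)%R]) <= t%:E)%E) ->
  (mu (A `&` [set x | (rearr mu A f t < `|f x|)%R]) <= t%:E)%E.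
Proof.
move=> [s s00 Hs0]; set a := rearr mu A f t.
have a0 : 0 <= a by exact: ginv_ge0.
pose e (n : nat) := a + n.+1%:R^-1.
have e0 n : 0 <= e n by rewrite addr_ge0.
have cup : A `&` [set x | a < `|f x|] = \bigcup_n (A `&` [set x | e n < `|f x|]).
  apply/seteqP; split => x /=.
    move=> [Ax ax]; have d0 : 0 < `|f x| - a by rewrite subr_gt0.
    have /andP[_ h] := truncn_itv (ltW (divr_gt0 (@ltr01 R) d0)).
    exists (Num.truncn (1 / (`|f x| - a))) => //; split => //=.
    rewrite /e addrC -ltrBrDr invf_plt ?posrE//.
    by move: h; rewrite mul1r.
  move=> [n _ [Ax /= enx]]; split => //=; apply: le_lt_trans enx.
  by rewrite /e lerDl.
have cvgmu : (fun n => mu (A `&` [set x | e n < `|f x|])) @ \oo --> mu (A `&` [set x | a < `|f x|]).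
  rewrite cup; apply: nondecreasing_cvg_mu.
  - by move=> n; exact: mtail.
  - by apply: bigcupT_measurable => n; exact: mtail.
  - move=> n m nm; apply/subsetPset; apply: tail_anti.
    by rewrite /e lerD2l lef_pV2 ?posrE// ler_nat.
rewrite -(cvg_lim _ cvgmu)//; apply: lime_le; first by apply/cvg_ex; eexists; exact: cvgmu.
apply: nearW => n.
have en0 : 0 < n.+1%:R^-1 :> R by [].
have [|r [r0 Dr] ren] := @inf_adherent _ [set s | 0 <= s /\ (mu (A `&` [set x | (s < `|f x|)%R]) <= t%:E)%E] _ en0.
  by split; [exists s|exists 0 => r []].
apply: le_trans Dr; apply: le_measure; rewrite ?inE; [exact: mtail|exact: mtail|].
exact/tail_anti/ltW.
Qed.

(** The distribution function and the rearrangement form a Galois connection. *)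
Lemma rearr_gt (t s : R) : vanishing (fun s => mu (A `&` [set x | s < `|f x|])) ->
  0 < t -> 0 <= s ->
  (s < rearr mu A f t) = (t%:E < mu (A `&` [set x | (s < `|f x|)%R]))%E.
Proof.
move=> dD t0 s0; apply/idP/idP; first exact: ginv_gt.
apply: contraTT; rewrite -leNgt => H; rewrite -leNgt.
apply: le_trans (tail_ginv (dD _ t0)).
apply: le_measure; rewrite ?inE; [exact: mtail|by apply: mtail; exact: ginv_ge0|].
exact: tail_anti.
Qed.

(** Equimeasurability; the tail is cut at one because the rearrangement is
    restricted to the unit interval. *)
Lemma mu01_rearr (s : R) : vanishing (fun s => mu (A `&` [set x | s < `|f x|])) -> 0 <= s ->
  mu01 [set t | s < rearr mu A f t] =
  Order.min (mu (A `&` [set x | (s < `|f x|)%R])) 1%E.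
Proof.
move=> dD s0; set D := mu _; rewrite mu01E.
set E := I01 `&` _.
have mE : measurable E.
  rewrite /E gt_setE; apply: (measurable_ginv01 dD) => //.
  exact: measurable_I01.
pose F := E `&` `]0, +oo[%classic.
have mF : measurable F by apply: measurableI.
have -> : lebesgue_measure E = lebesgue_measure F.
  apply/eqP; rewrite eq_le; apply/andP; split; last first.
    by apply: le_measure; rewrite ?inE//; exact: subIsetl.
  have U : (lebesgue_measure ([set 0%R] `|` F) <= lebesgue_measure F)%E.
    rewrite -[leRHS]add0e -(lebesgue_measure_set1 (0 : R)).
    exact: measureU2.
  apply: le_trans U.
  apply: le_measure; rewrite ?inE//; first exact: measurableU.
  move=> x Ex; have := Ex; rewrite /E /I01 /= in_itv/= => -[/andP[+ _] _].
  rewrite le_eqVlt => /orP[/eqP <-|x0]; [by left|right; split => //].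
  by rewrite /= in_itv/= x0.
have FE t : F t <-> [/\ 0 < t, t <= 1 & (t%:E < D)%E].
  rewrite /F /E /I01 /= !in_itv/= andbT; split.
    by move=> [[/andP[_ t1] +] t0]; rewrite rearr_gt.
  by move=> [t0 t1 tD]; rewrite (ltW t0) t1 rearr_gt.
have [D1|D1] := ltP 1%E D.
  rewrite (_ : F = `]0, 1]%classic) ?lebesgue_itv_bounded// ?subr0//.
  apply/seteqP; split => t; rewrite /= in_itv/=; first by move=> /FE[-> ->].
  by move=> /andP[t0 t1]; apply/FE; split => //; apply: le_lt_trans D1; rewrite lee_fin.
have D0 : (0 <= D)%E by exact: measure_ge0.
have Dfin : D \is a fin_num by rewrite ge0_fin_numE// (le_lt_trans D1) ?ltry.
move: D1 D0 FE; rewrite -(fineK Dfin) !lee_fin; move: (fine D) => d' d1 d0 FE.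
rewrite (_ : F = `]0, d'[%classic) ?lebesgue_itv_bounded// ?subr0//.
apply/seteqP; split => t; rewrite /= in_itv/=.
  by move=> /FE[-> _]; rewrite lte_fin.
by move=> /andP[t0 td]; apply/FE; split; rewrite ?lte_fin//; lra.
Qed.

End tails.

(** * Balls of symmetric spaces *)

Lemma measurable_tail01 (R : realType) (f : R -> R) (s : R) :
  measurable_fun (@I01 R) f -> measurable (@I01 R `&` [set x | s < `|f x|]).
Proof.
move=> mf; have mnf : measurable_fun (@I01 R) (fun x => `|f x|).
  by apply: measurableT_comp => //; exact: normr_measurable.
by rewrite gt_setE; apply: mnf => //; exact: measurable_I01.
Qed.

Lemma vanishing_tail01 (R : realType) (f : R -> R) : measurable_fun (@I01 R) f ->
  vanishing (fun s => lebesgue_measure (@I01 R `&` [set x | s < `|f x|])).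
Proof.
move=> mf; apply: tail_vanishing => [s s0|]; first exact: measurable_tail01.
apply: (@le_lt_trans _ _ (lebesgue_measure (@I01 R))).
  apply: le_measure; rewrite ?inE; [exact: measurable_tail01|exact: measurable_I01|exact: subIsetl].
by rewrite /I01 lebesgue_itv_bounded// ltry.
Qed.

Section symspace_theory.
Variables (R : realType) (X : symspace R).

(** Membership and bound go together in all the arguments, because [ss_norm] is
    meaningless off the space. *)
Definition inball (c : R) (f : R -> R) := ss_car X f /\ ss_norm X f <= c.

Lemma inball_dom (c : R) (f g : R -> R) : measurable_fun (@I01 R) g ->
  (forall s : R, 0 <= s -> (mu01 [set x | (s < `|g x|)%R] <= mu01 [set x | (s < `|f x|)%R])%E) ->
  inball c f -> inball c g.
Proof.
move=> mg gf [Xf nf]; have mf := ss_meas Xf.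
have [] := @ss_symm _ X f g Xf mg.
  move=> t t0; apply: le_ginv; first exact: vanishing_tail01.
  by move=> s s0; rewrite -!mu01E; exact: gf.
by move=> Xg ng; split => //; exact: le_trans nf.
Qed.

Lemma inball_le (c : R) (f g : R -> R) : measurable_fun (@I01 R) g ->
  (forall x, 0 <= x <= 1 -> `|g x| <= `|f x|) -> inball c f -> inball c g.
Proof.
move=> mg gf bf; apply: (inball_dom mg _ bf) => s s0.
rewrite !mu01E; apply: le_measure; rewrite ?inE; [exact: measurable_tail01| |].
  by apply: measurable_tail01; exact: ss_meas bf.1.
move=> x [xI /= sx]; split => //=; apply: lt_le_trans sx _; apply: gf.
by move: xI; rewrite /I01 /= in_itv.
Qed.

Lemma inball_widen (c d : R) (f : R -> R) : c <= d -> inball c f -> inball d f.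
Proof. by move=> cd [Xf nf]; split => //; exact: le_trans cd. Qed.

Lemma inballD (c d : R) (f g : R -> R) :
  inball c f -> inball d g -> inball (c + d) (fun x => f x + g x).
Proof.
move=> [Xf nf] [Xg ng]; split; first exact: (ss_add Xf Xg).
by apply: le_trans (ss_normD Xf Xg) _; exact: lerD.
Qed.

Lemma inballZ (c a : R) (f : R -> R) : 0 <= a ->
  inball c f -> inball (a * c) (fun x => a * f x).
Proof.
move=> a0 [Xf nf]; split; first exact: (ss_scale a Xf).
by rewrite (ss_normZ a Xf) ger0_norm// ler_wpM2l.
Qed.

Lemma inball0 : inball 0 (fun=> 0).
Proof.
split; first exact: ss_zero.
have := ss_normZ 0 (ss_zero X); rewrite normr0 mul0r.
by rewrite (_ : _ \*: _ = fun=> 0) => [->//|]; apply/funext => x; rewrite /= scaler0.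
Qed.

Lemma ss_norm_ge0 (f : R -> R) : ss_car X f -> 0 <= ss_norm X f.
Proof.
move=> Xf; have Xf' := ss_scale (-1) Xf.
have := ss_normD Xf Xf'; rewrite (ss_normZ _ Xf) normrN1 mul1r.
rewrite (_ : _ \+ _ = fun=> 0); last first.
  by apply/funext => x /=; rewrite scaleN1r subrr.
have [_ n0] := inball0.
have := ss_normZ 0 (ss_zero X); rewrite normr0 mul0r.
rewrite (_ : _ \*: _ = fun=> 0) => [->|]; first lra.
by apply/funext => x; rewrite /= scaler0.
Qed.

Lemma inball_sum n (c : 'I_n -> R) (f : 'I_n -> R -> R) :
  (forall i, inball (c i) (f i)) -> inball (\sum_(i < n) c i) (fun x => \sum_(i < n) f i x).
Proof.
elim: n c f => [|n IH] c f H.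
  rewrite big_ord0 (_ : (fun x => _) = fun=> 0); first exact: inball0.
  by apply/funext => x; rewrite big_ord0.
rewrite big_ord_recl (_ : (fun x => _) = fun x => f ord0 x + \sum_(i < n) f (lift ord0 i) x).
  by apply: inballD => //; exact: IH.
by apply/funext => x; rewrite big_ord_recl.
Qed.

Lemma inball_cst (a : R) : 0 <= a -> inball a (fun=> a).
Proof.
move=> a0; have [Xc nc] := ss_normalized X.
have : inball (a * 1) (fun x => a * \1_(`]0, 1[%classic : set R) x).
  by apply: inballZ => //; split => //; rewrite nc.
rewrite mulr1; apply: inball_dom => [|s s0]; first exact: measurable_cst.
rewrite ger0_norm//; have [sa|sa] := ltP s a; last first.
  rewrite (_ : mkset _ = set0) ?measure0//; by apply/seteqP; split.
rewrite (_ : mkset _ = setT) ?[mu01 setT]mu01_setT; last by apply/seteqP; split.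
rewrite mu01E (_ : _ `&` _ = `]0, 1[%classic) ?lebesgue_itv_bounded// ?subr0//.
apply/seteqP; split => x /=; rewrite /I01 /= indicE !in_itv/=.
  move=> [_]; case: (boolP (_ \in _)); first by rewrite inE/= in_itv.
  by rewrite mulr0 normr0 ltNge s0.
move=> x01; have -> : (x \in `]0, 1[%classic) = true by rewrite mem_set//= in_itv.
by rewrite mulr1 ger0_norm//; split => //; lra.
Qed.

Lemma le_inball (a c : R) (f : R -> R) : 0 <= a ->
  (forall x, 0 < x < 1 -> a <= `|f x|) -> inball c f -> a <= c.
Proof.
move=> a0 af bf; have [Xc nc] := ss_normalized X.
rewrite -[a]mulr1 -nc -[X in X * _](ger0_norm a0) -(ss_normZ a Xc).
have := ss_scale a Xc; set g := (X in ss_car _ X) => Xg.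
suff [] : inball c g by [].
apply: inball_le bf => [|x _]; first exact: ss_meas Xg.
rewrite /g /= indicE /GRing.scale /=.
case: (boolP (_ \in _)) => [/set_mem|_]; last by rewrite mulr0 normr0.
by rewrite /= in_itv/= mulr1 ger0_norm//; exact: af.
Qed.

Lemma enorm_le (c : R) (f : R -> R) : (enorm X f <= c%:E)%E <-> inball c f.
Proof.
rewrite /enorm /inball; split.
  by case: asboolP => // Xf; rewrite ?lee_fin.
by move=> [Xf nf]; rewrite (asboolT Xf) lee_fin.
Qed.

Lemma enorm_ge0 (f : R -> R) : (0 <= enorm X f)%E.
Proof.
rewrite /enorm; case: asboolP => // Xf; rewrite lee_fin; exact: ss_norm_ge0.
Qed.

(** [S] is cut into three pieces by the thirds of an independent uniform variable.
    Each piece has a third of the tails of [S], so it is dominated by [W]. *)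
Lemma inball_dilation (c : R) (S W : R -> R) : measurable_fun (@I01 R) S ->
  (forall s : R, 0 <= s -> (mu01 [set x | (s < `|S x|)%R] <= 3%:E * mu01 [set x | (s < `|W x|)%R])%E) ->
  inball c W -> inball (3 * c) S.
Proof.
move=> mS SW bW.
pose S' := S \_ (@I01 R).
have mS' : measurable_fun setT S' by apply: (measurable_restrictT S (@measurable_I01 R)).1.
have SE x : 0 <= x <= 1 -> S' x = S x.
  by move=> x01; rewrite /S' patchE mem_set//= /I01 /= in_itv.
pose J (r : R) : set R := `[r / 3, (r + 1) / 3]%classic.
pose Sr (r x : R) := S' (split1 x) * \1_(J r) (split2 x).
have mSr r : measurable_fun setT (Sr r).
  apply: measurable_funM; first exact: (measurableT_comp mS' (@measurable_split1 R)).
  apply: (measurableT_comp _ (@measurable_split2 R)).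
  by apply: measurable_indic; exact: measurable_itv.
have mtS s : measurable [set x | s < `|S' x|].
  have m : measurable_fun setT (fun x => `|S' x|).
    by apply: measurableT_comp => //; exact: normr_measurable.
  by rewrite gt_setE; apply: measurable_preimage.
have muS s : mu01 [set x | s < `|S' x|] = mu01 [set x | s < `|S x|].
  rewrite !mu01E; congr lebesgue_measure; apply/seteqP; split => x /= [xI sx]; split => //;
    move: sx; rewrite SE//; move: xI; by rewrite /I01 /= in_itv.
have bSr r : 0 <= r <= 2 -> inball c (Sr r).
  move=> r02; apply: inball_dom bW => [|s s0]; first exact: measurable_funTS.
  rewrite (_ : mkset _ = @split1 R @^-1` [set x | s < `|S' x|] `&` @split2 R @^-1` (J r)).
    rewrite mu01_split//; last exact: measurable_itv.
    have -> : mu01 (J r) = (3^-1)%:E.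
      rewrite mu01E (_ : _ `&` _ = J r) ?lebesgue_itv_bounded//.
      - by congr EFin; lra.
      - by lra.
      - by apply/seteqP; split => x; rewrite /I01 /J /= !in_itv/=; [case|move=> ?; split => //; lra].
    rewrite muS muleC.
    apply: (@le_trans _ _ ((3^-1)%:E * (3%:E * mu01 [set x | (s < `|W x|)%R]))%E).
      by apply: lee_wpmul2l; [rewrite lee_fin|exact: SW].
    by rewrite muleA -EFinM mulVf// mul1e.
  apply/seteqP; split => x; rewrite /Sr /=.
    rewrite indicE; case: (boolP (_ \in _)); first by rewrite inE mulr1.
    by rewrite mulr0 normr0 ltNge s0.
  by move=> [H H2]; rewrite indicE mem_set// mulr1.
have b3 : inball (c + c + c) (fun x => Sr 0 x + Sr 1 x + Sr 2 x).
  by apply: inballD; [apply: inballD|]; apply: bSr; lra.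
rewrite (_ : 3 * c = c + c + c); last by lra.
apply: inball_dom b3 => // s s0.
rewrite -muS.
have -> : mu01 [set x | s < `|S' x|] = mu01 (@split1 R @^-1` [set x | s < `|S' x|] `&` @split2 R @^-1` setT).
  by rewrite mu01_split// [X in (_ * X)%E]mu01_setT mule1.
rewrite setIT.
have m3 : measurable_fun setT (fun x => Sr 0 x + Sr 1 x + Sr 2 x).
  by apply: measurable_funD => //; exact: measurable_funD.
apply: le_measure; rewrite ?inE.
- by apply: measurable_preimage => //; exact: measurable_split1.
- by apply: (measurable_abs_gt (T := measurableTypeR R)).
- move=> x /= sx; apply: lt_le_trans sx _; rewrite /Sr -!mulrDr normrM ler_peMr//.
  rewrite ger0_norm ?addr_ge0//.
  have := split2_I01 x; move: (split2 x) => z z01; rewrite !indicE !mem_setE /J.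
  rewrite !in_itv/=.
  have [z1|z1] : z <= 1 / 3 \/ 1 / 3 < z by case: leP; [left|right].
    rewrite (_ : (0 / 3 <= z <= (0 + 1) / 3) = true); last by apply/andP; split; lra.
    by rewrite -addrA lerDl addr_ge0.
  have [z2|z2] : z <= 2 / 3 \/ 2 / 3 < z by case: leP; [left|right].
    rewrite (_ : (1 / 3 <= z <= (1 + 1) / 3) = true); last by apply/andP; split; lra.
    by rewrite addrAC lerDr addr_ge0.
  rewrite (_ : (2 / 3 <= z <= (2 + 1) / 3) = true); last by apply/andP; split; lra.
  by rewrite lerDr addr_ge0.
Qed.

End symspace_theory.

(** * Laws of independent sequences *)

Lemma expR1_le3 (R : realType) : expR 1 <= 3 :> R.
Proof.
have h : 5 / 6 <= expR (- (1 / 6)) :> R.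
  by apply: le_trans (expR_ge1Dx _); lra.
have p : 0 < expR (1 / 6) :> R by exact: expR_gt0.
have h2 : expR (1 / 6) <= 6 / 5 :> R.
  by move: h; rewrite expRN -(ler_pM2r p) mulVf ?gt_eqF//; lra.
have -> : 1 = 6%:R * (1 / 6) :> R by lra.
rewrite expRM_natl; apply: le_trans (_ : (6 / 5) ^+ 6 <= _); last by lra.
by rewrite lerXn2r// ?nnegrE// ltW.
Qed.

Lemma restr01E (R : realType) (f : R -> R) (x : R) : 0 <= x <= 1 -> (f \_ (@I01 R)) x = f x.
Proof. by move=> x01; rewrite patchE mem_set//= /I01 /= in_itv. Qed.

Lemma measurable_restr01 (R : realType) (f : R -> R) :
  measurable_fun (@I01 R) f -> measurable_fun setT (f \_ (@I01 R)).
Proof. by move=> mf; apply: (measurable_restrictT f (@measurable_I01 R)).1. Qed.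

Lemma restr01_ge0 (R : realType) (f : R -> R) (x : R) :
  (forall x, 0 <= x <= 1 -> 0 <= f x) -> 0 <= (f \_ (@I01 R)) x.
Proof.
move=> f0; rewrite patchE; case: ifPn => // /set_mem.
by rewrite /I01 /= in_itv/=; exact: f0.
Qed.

Lemma eq_mu01 (R : realType) (A B : set R) :
  (forall x, 0 <= x <= 1 -> A x <-> B x) -> mu01 A = mu01 B.
Proof.
move=> AB; rewrite !mu01E; congr lebesgue_measure.
by apply/seteqP; split => x [xI Ax]; split => //; apply/AB => //;
  move: xI; rewrite /I01 /= in_itv.
Qed.

(** Both joint laws are product measures with the same marginals, and agree on
    cylinders. *)
Lemma mu01_independent (R : realType) (f : nat -> R -> R) (E : set (Omega R)) :
  (forall k, measurable_fun (@I01 R) (f k)) -> independent_seq f -> measurable E ->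
  mu01 [set x | E (fun k => (f k \_ (@I01 R)) x)] =
  mu01 [set x | E (fun k => (f k \_ (@I01 R)) (unif k x))].
Proof.
move=> mf If mE.
have mf' k := measurable_restr01 (mf k).
have mU k : measurable_fun setT (fun x : measurableTypeR R => (f k \_ (@I01 R)) (unif k x)).
  by apply: (measurableT_comp (mf' k)); exact: measurable_unif.
pose F1 (x : measurableTypeR R) : Omega R := fun k => (f k \_ (@I01 R)) x.
pose F2 (x : measurableTypeR R) : Omega R := fun k => (f k \_ (@I01 R)) (unif k x).
have mF1 : measurable_fun setT F1 by apply: measurable_into_Omega => k; exact: mf'.
have mF2 : measurable_fun setT F2 by apply: measurable_into_Omega => k; exact: mU.
pose M1 : {measure set (Omega R) -> \bar R} :=
  image_measure (T1 := measurableTypeR R) (@mu01 R) mF1.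
pose M2 : {measure set (Omega R) -> \bar R} :=
  image_measure (T1 := measurableTypeR R) (@mu01 R) mF2.
rewrite -[LHS]/(M1 E) -[RHS]/(M2 E).
apply: eq_measure_cylinders => //.
  by rewrite /M1 /= /pushforward preimage_setT [mu01 _]mu01_setT ltry.
move=> n A mA.
have -> : M2 [set w | forall i, (i < n)%N -> A i (w i)] =
    mu01 [set x | forall i, (i < n)%N -> ((f i \_ (@I01 R)) @^-1` A i) (unif i x)] by [].
rewrite (@mu01_unif R n (fun i => (f i \_ (@I01 R)) @^-1` A i)); last first.
  by move=> k; apply: measurable_preimage; [exact: mf'|exact: mA].
have := If (index_iota 0 n) A (iota_uniq _ _) mA.
rewrite big_mkord => H.
transitivity (\prod_(i < n) lebesgue_measure (@I01 R `&` (f i @^-1` A i)))%E; last first.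
  apply: eq_bigr => i _; rewrite -mu01E; apply: eq_mu01 => x x01.
  by rewrite /preimage /= restr01E.
rewrite -H -mu01E; apply: eq_mu01 => x x01; split.
  by move=> Hx i /=; rewrite mem_index_iota => /Hx; rewrite /F1 restr01E.
move=> Hx i ilt; rewrite /F1 restr01E//; apply: Hx => /=.
by rewrite mem_index_iota.
Qed.

Lemma mu01_independent_sum (R : realType) (f : nat -> R -> R) n (s : R) :
  (forall k, measurable_fun (@I01 R) (f k)) -> independent_seq f ->
  mu01 [set x | s < \sum_(k < n) f k x] =
  mu01 [set x | s < psum (fun k => f k \_ (@I01 R)) n x].
Proof.
move=> mf If.
pose E : set (Omega R) := [set w : Omega R | s < \sum_(k < n) w k].
have mE : measurable E.
  have m : measurable_fun setT (fun w : Omega R => \sum_(k < n) w k : R).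
    by apply: measurable_sum => k; exact: measurable_coord.
  rewrite (_ : E = (fun w : Omega R => \sum_(k < n) w k : R) @^-1` `]s, +oo[%classic).
    by rewrite -[X in measurable X]setTI; exact: m.
  by apply/seteqP; split => x /=; rewrite in_itv/= andbT.
rewrite -[RHS](mu01_independent mf If mE); apply: eq_mu01 => x x01.
by rewrite /E /=; under [in X in _ <-> X]eq_bigr => k _ do rewrite restr01E//.
Qed.

Section Kruglov_law.
Variables (R : realType) (P : probability (Omega R) R) (B : nat -> set R).
Hypotheses (HP : product_lebesgue P) (HB : kruglov_partition B).

Lemma kruglov_restr (f : R -> R) (s : R) : 0 <= s ->
  @cube R `&` [set w | s < `|kruglov B f w|] =
  @cube R `&` [set w | s < `|kruglov B (f \_ (@I01 R)) w|].
Proof.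
move=> s0.
have E w : cube w -> kruglov B (f \_ (@I01 R)) w = kruglov B f w.
  move=> cw; have [[j [j0 Bj]]|H] := pselect (exists j, (0 < j)%N /\ B j (w 0%N)).
    rewrite !(kruglov_eq HB _ j0 Bj); apply: eq_bigr => k _; rewrite restr01E//.
    by have := cw k.+1; rewrite /I01 /= in_itv.
  by rewrite !(kruglov_out _) // => j j0 Bj; apply: H; exists j.
by apply/seteqP; split => w [cw sw]; split => //=; move: sw; rewrite /= E.
Qed.

Lemma measurable_kruglov_tail01 (f : R -> R) (s : R) :
  measurable_fun (@I01 R) f -> 0 <= s ->
  measurable (@cube R `&` [set w | s < `|kruglov B f w|] : set (Omega R)).
Proof.
move=> mf s0; rewrite kruglov_restr//; apply: measurable_kruglov_tail => //.
exact: measurable_restr01.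
Qed.

Lemma kruglov_tail01 (f : R -> R) (s : R) : measurable_fun (@I01 R) f -> 0 <= s ->
  P (@cube R `&` [set w | s < `|kruglov B f w|]) =
  (\sum_(j <oo) ((expR 1 * j`!%:R)^-1 : R)%:E *
     mu01 [set x | s < `|psum (fun=> f \_ (@I01 R)) j x|]%R)%E.
Proof.
move=> mf s0; rewrite kruglov_restr// kruglov_tail//; exact: measurable_restr01.
Qed.

Lemma vanishing_kruglov (f : R -> R) : measurable_fun (@I01 R) f ->
  vanishing (fun s => P (@cube R `&` [set w | s < `|kruglov B f w|])).
Proof.
move=> mf; apply: (@tail_vanishing _ (Omega R)) => [s s0|].
  exact: measurable_kruglov_tail01.
rewrite (le_lt_trans (probability_le1 _ _)) ?ltry//.
exact: measurable_kruglov_tail01.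
Qed.

Lemma mu01_rearr_kruglov (f : R -> R) (s : R) : measurable_fun (@I01 R) f -> 0 <= s ->
  mu01 [set t | s < `|rearr P (@cube R) (kruglov B f) t|] =
  P (@cube R `&` [set w | s < `|kruglov B f w|]).
Proof.
move=> mf s0.
rewrite (_ : mkset _ = [set t | s < rearr P (@cube R) (kruglov B f) t]); last first.
  by apply/seteqP; split => t /=; rewrite ger0_norm//; exact: ginv_ge0.
rewrite (@mu01_rearr _ (Omega R)) ?min_l//.
- by apply: probability_le1; exact: measurable_kruglov_tail01.
- by move=> r r0; exact: measurable_kruglov_tail01.
- exact: vanishing_kruglov.
Qed.

Lemma measurable_rearr_kruglov (f : R -> R) : measurable_fun (@I01 R) f ->
  measurable_fun (@I01 R) (rearr P (@cube R) (kruglov B f)).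
Proof. by move=> mf; exact: measurable_ginv01 (vanishing_kruglov mf). Qed.

End Kruglov_law.

Lemma mu01_unif1 (R : realType) (k : nat) (A : set R) : measurable A ->
  mu01 (@unif R k @^-1` A) = mu01 A.
Proof.
move=> mA; elim: k => [|k IH].
  have := mu01_split mA (@measurableT _ R).
  by rewrite preimage_setT setIT [X in (_ * X)%E]mu01_setT mule1.
have mk : measurable (@unif R k @^-1` A).
  by apply: measurable_preimage => //; exact: measurable_unif.
have := mu01_split (@measurableT _ R) mk.
rewrite preimage_setT setTI [X in (X * _)%E]mu01_setT mul1e IH => <-.
by apply: eq_mu01 => x _; rewrite /preimage /= unifS.
Qed.

Lemma independent_unif (R : realType) (g : nat -> R -> R) :
  (forall k, measurable_fun setT (g k)) ->
  independent_seq (fun k x => g k (unif k x)).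
Proof.
move=> mg J A uJ mA.
have mgA k : measurable (g k @^-1` A k) by apply: measurable_preimage.
pose n := (\max_(i <- J) i).+1.
pose A' (i : nat) : set R := if i \in J then g i @^-1` A i else setT.
have mA' i : measurable (A' i) by rewrite /A'; case: ifP.
have Jn i : i \in J -> (i < n)%N by move=> iJ; rewrite ltnS; apply: leq_bigmax_seq.
have := mu01_unif n mA'.
rewrite -(big_mkord xpredT (fun i => mu01 (A' i))).
rewrite (bigID (mem J)) /= [X in (_ * X)%E]big1; last first.
  by move=> i /negPf iJ; rewrite /A' iJ [LHS]mu01_setT.
rewrite mule1 -big_filter (perm_big J); last first.
  apply: uniq_perm => //; first by apply: filter_uniq; exact: iota_uniq.
  by move=> i; rewrite mem_filter mem_index_iota /=; case: (boolP (i \in J)) => // /Jn.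
move=> H; rewrite -mu01E.
rewrite (eq_mu01 (B := [set x | forall i, (i < n)%N -> A' i (unif i x)])).
  rewrite H !big_seq; apply: eq_bigr => i iJ.
  by rewrite -mu01E /A' iJ -(mu01_unif1 i (mgA i)).
move=> x _; split => [Hx i ilt|Hx i iJ].
  by rewrite /A'; case: ifPn => // iJ; exact: Hx.
by have := Hx i (Jn i iJ); rewrite /A' iJ.
Qed.

(** * Disjoint sums of mass at most one *)

Lemma kruglov_norm_ge0 (R : realType) (P : probability (Omega R) R) (B : nat -> set R)
    (X Y : symspace R) : (0 <= kruglov_norm P B X Y)%E.
Proof.
apply: le_trans (enorm_ge0 Y (rearr P (@cube R) (kruglov B (fun=> 0)))) _.
apply: ereal_sup_ubound; exists (fun=> 0) => //.
by have [X0 n0] := inball0 X; split => //; apply: le_trans n0 _.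
Qed.

Section Kruglov_bound.
Variables (R : realType) (X Y : symspace R) (P : probability (Omega R) R) (B : nat -> set R).
Hypotheses (HP : product_lebesgue P) (HB : kruglov_partition B).
Variable kappa : R.
Hypothesis Hk : (kruglov_norm P B X Y <= kappa%:E)%E.

Lemma kruglov_tail_partial (f : R -> R) (s : R) (n : nat) :
  measurable_fun (@I01 R) f -> 0 <= s ->
  (\sum_(j < n) ((expR 1 * j`!%:R)^-1 : R)%:E *
     mu01 [set x | s < `|psum (fun=> f \_ (@I01 R)) j x|]%R <=
   P (@cube R `&` [set w | (s < `|kruglov B f w|)%R]))%E.
Proof.
move=> mf s0; rewrite (kruglov_tail01 HP HB)//.
rewrite -(big_mkord xpredT (fun j => ((expR 1 * j`!%:R)^-1 : R)%:E *
     mu01 [set x | s < `|psum (fun=> f \_ (@I01 R)) j x|]%R)%E).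
apply: nneseries_lim_ge => j _ _.
by rewrite mule_ge0// lee_fin invr_ge0 mulr_ge0// expR_ge0.
Qed.

(** The exponential series has the weights [1 / j!] where the Kruglov operator has
    [1 / (e j!)]; the factor [e <= 3] between the tails is paid by the dilation,
    hence the factor [3] in front of the norm. *)
Lemma inball_indep_sum_unit (f : nat -> R -> R) (G : R -> R) (n : nat) :
  (forall k, measurable_fun (@I01 R) (f k)) -> independent_seq f ->
  (forall k x, 0 <= x <= 1 -> 0 <= f k x) -> (forall x, 0 <= x <= 1 -> 0 <= G x) ->
  (forall s : R, 0 <= s -> mu01 [set x | s < G x] = (\sum_(k < n) mu01 [set x | s < f k x]%R)%E) ->
  inball X 1 G -> inball Y (3 * kappa) (fun x => \sum_(k < n) f k x).
Proof.
move=> mf If f0 G0 HG [XG nG]; have mG := ss_meas XG.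
pose f' k := f k \_ (@I01 R); pose G' := G \_ (@I01 R).
pose W := rearr P (@cube R) (kruglov B G).
have bW : inball Y kappa W.
  apply/enorm_le; apply: le_trans Hk; apply: ereal_sup_ubound.
  by exists G.
have msum : measurable_fun (@I01 R) (fun x => \sum_(k < n) f k x).
  by apply: measurable_sum => k; exact: mf.
apply: (inball_dilation msum _ bW) => s s0.
rewrite (mu01_rearr_kruglov P HB)//.
have HG' (r : R) : 0 <= r -> mu01 [set x | r < G' x] = (\sum_(k < n) mu01 [set x | r < f' k x]%R)%E.
  move=> r0; transitivity (mu01 [set x | r < G x]).
    by apply: eq_mu01 => x x01 /=; rewrite /G' restr01E.
  rewrite HG//; apply: eq_bigr => k _; apply: eq_mu01 => x x01 /=.
  by rewrite /f' restr01E.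
have -> : mu01 [set x | s < `|\sum_(k < n) f k x|] = mu01 [set x | s < \sum_(k < n) f k x].
  apply: eq_mu01 => x x01 /=; rewrite ger0_norm//.
  by apply: sumr_ge0 => k _; exact: f0.
rewrite mu01_independent_sum//.
have := psum_tail_le (fun k => measurable_restr01 (mf k)) (measurable_restr01 mG)
   (fun k x => restr01_ge0 x (f0 k)) (fun x => restr01_ge0 x G0) HG' s.
move=> /le_trans; apply.
apply: (@le_trans _ _ (3%:E * \sum_(j < n.+1) ((expR 1 * j`!%:R)^-1 : R)%:E *
     mu01 [set x | s < `|psum (fun=> G \_ (@I01 R)) j x|]%R)%E); last first.
  by apply: lee_wpmul2l; [rewrite lee_fin|exact: kruglov_tail_partial].
rewrite ge0_sume_distrr; last first.
  by move=> j _; rewrite mule_ge0// lee_fin invr_ge0 mulr_ge0// expR_ge0.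
apply: lee_sum => j _.
have -> : mu01 [set x | s < `|psum (fun=> G \_ (@I01 R)) j x|] =
   mu01 [set x | s < psum (fun=> G \_ (@I01 R)) j x].
  apply: eq_mu01 => x x01 /=; rewrite ger0_norm//.
  by apply: sumr_ge0 => k _; exact: restr01_ge0.
rewrite muleA; apply: lee_wpmul2r => //.
rewrite -EFinM lee_fin invfM mulrA ler_peMl//.
by rewrite ler_pdivlMr ?expR_gt0// mul1r expR1_le3.
Qed.

Lemma kappa_ge0 : 0 <= kappa.
Proof. by rewrite -lee_fin; apply: le_trans Hk; exact: kruglov_norm_ge0.
Qed.

Lemma inball_indep_sum (f : nat -> R -> R) (G : R -> R) (n : nat) (eta : R) :
  (forall k, measurable_fun (@I01 R) (f k)) -> independent_seq f ->
  (forall k x, 0 <= x <= 1 -> 0 <= f k x) -> (forall x, 0 <= x <= 1 -> 0 <= G x) ->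
  (forall s : R, 0 <= s -> mu01 [set x | s < G x] = (\sum_(k < n) mu01 [set x | s < f k x]%R)%E) ->
  inball X eta G -> inball Y (3 * kappa * eta) (fun x => \sum_(k < n) f k x).
Proof.
move=> mf If f0 G0 HG bG.
have eta0 : 0 <= eta by case: bG => XG; apply: le_trans; exact: ss_norm_ge0.
(* [eta] may vanish: normalize by any [e > 0] above it, then let [e] tend to [eta] *)
have main e : 0 < e -> eta <= e -> inball Y (3 * kappa * e) (fun x => \sum_(k < n) f k x).
  move=> e0 etae.
  have bG1 : inball X 1 (fun x => e^-1 * G x).
    apply: inball_widen (inballZ (ltW _) bG); last by rewrite invr_gt0.
    by rewrite mulrC ler_pdivrMr// mul1r.
  have ei0 : 0 <= e^-1 by rewrite invr_ge0 ltW.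
  have := @inball_indep_sum_unit (fun k x => e^-1 * f k x) _ n _ _ _ _ _ bG1.
  case.
  - by move=> k; apply: measurable_funM => //; exact: measurable_cst.
  - move=> J A uJ mA.
    have mA' i : measurable ((fun y : R => e^-1 * y) @^-1` A i).
      by apply: measurable_preimage => //; apply: measurable_funM => //; exact: measurable_cst.
    exact: (If J _ uJ mA').
  - by move=> k x x01; rewrite mulr_ge0//; exact: f0.
  - by move=> x x01; rewrite mulr_ge0//; exact: G0.
  - have E (g : R -> R) (s : R) : [set x | s < e^-1 * g x] = [set x | e * s < g x].
      by apply/seteqP; split => x /=; rewrite [e^-1 * _]mulrC ltr_pdivlMr// [s * e]mulrC.
    move=> s s0; rewrite E HG ?mulr_ge0 ?(ltW e0)//.
    by apply: eq_bigr => k _; rewrite -E.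
  move=> Yf nf.
  have := inballZ (ltW e0) (conj Yf nf); rewrite [e * _]mulrC.
  rewrite (_ : (fun x => _) = fun x => \sum_(k < n) f k x)//.
  apply/funext => x; rewrite mulr_sumr; apply: eq_bigr => k _.
  by rewrite mulrA divff ?mul1r// gt_eqF.
split; first by case: (main (eta + 1)) => //; lra.
apply/ler_addgt0Pr => d d0.
have k0 := kappa_ge0.
have dk : 0 < d / (3 * kappa + 1) by rewrite divr_gt0//; lra.
have [||_ h] := main (eta + d / (3 * kappa + 1)); [lra|lra|].
apply: le_trans h _; rewrite mulrDr lerD2l mulrCA ler_piMr// ?ltW//.
by rewrite ltr_pdivrMr; lra.
Qed.

(** The one-term sequence [1] has norm one in both spaces. *)
Lemma kappa3_ge1 : 1 <= 3 * kappa.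
Proof.
pose f (k : nat) (x : R) : R := 1.
have If : independent_seq f.
  by apply: (@independent_unif R (fun _ _ => 1)) => k; exact: measurable_cst.
have mf k : measurable_fun (@I01 R) (f k) by exact: measurable_cst.
have bS : inball Y (3 * kappa) (fun x => \sum_(k < 1) f k x).
  rewrite -[3 * kappa]mulr1.
  apply: (inball_indep_sum mf If _ _ _ (inball_cst X ler01)) => //.
  by move=> s s0; rewrite big_ord_recl big_ord0 adde0.
have [Y1 n1] := ss_normalized Y; rewrite -{1}n1.
have [|//] := inball_le (ss_meas Y1) _ bS.
move=> x _; rewrite big_ord_recl big_ord0 addr0 normr1 indicE.
by case: (_ \in _); rewrite ?normr1 ?normr0.
Qed.

End Kruglov_bound.

(** * The distribution of a disjoint sum *)

Lemma lebesgue_measure_shift (R : realType) (c : R) (A : set R) : measurable A ->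
  lebesgue_measure [set x | A (x + c)] = lebesgue_measure A.
Proof.
move=> mA.
have mc : measurable_fun setT (fun x : R => x + c) by apply: measurable_funD.
pose M : {measure set (measurableTypeR R) -> \bar R} :=
  image_measure (T1 := measurableTypeR R) (T2 := measurableTypeR R) (@lebesgue_measure R) mc.
rewrite -[LHS]/(M A); symmetry; apply: lebesgue_measure_unique => // _ [[a b] _ <-].
rewrite /M /= /pushforward.
rewrite (_ : _ @^-1` _ = `]a - c, b - c]%classic); last first.
  by apply/seteqP; split => x /=; rewrite !in_itv/=; lra.
rewrite !lebesgue_measure_itv/= !lte_fin ltrD2r; case: ifP => // _.
by rewrite -!EFinB; congr EFin; lra.
Qed.

Lemma lebesgue_measure_rem1 (R : realType) (a : R) (A B : set R) :
  measurable A -> measurable B -> (forall x, x != a -> A x <-> B x) ->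
  lebesgue_measure A = lebesgue_measure B.
Proof.
suff H (C D : set R) : measurable C -> measurable D -> (forall x, x != a -> C x -> D x) ->
    (lebesgue_measure C <= lebesgue_measure D)%E.
  move=> mA mB AB; apply/eqP; rewrite eq_le; apply/andP; split; apply: H => // x xa;
  by case: (AB x xa).
move=> mC mD CD.
have U : (lebesgue_measure ([set a] `|` D) <= lebesgue_measure D)%E.
  rewrite -[leRHS]add0e -(lebesgue_measure_set1 a).
  exact: measureU2.
apply: le_trans U; apply: le_measure; rewrite ?inE//; first exact: measurableU.
by move=> x Cx; have [->|xa] := eqVneq x a; [left|right; exact: CD].
Qed.

Section disjoint_sum.
Variables (R : realType) (f : nat -> R -> R).
Hypothesis mf : forall k, measurable_fun (@I01 R) (f k).

Let piece (s : R) (k : nat) : set R :=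
  [set t | k%:R <= t < k.+1%:R /\ s < `|f k (t - k%:R)|].

Let pieceE s k : piece s k = [set t | (`[0, 1[%classic `&` (@I01 R `&` [set x | s < `|f k x|])) (t + - k%:R)].
Proof.
apply/seteqP; split => t; rewrite /piece /I01 /= !in_itv/= -natr1.
  by move=> [H1 H2]; split; [lra|split => //; lra].
by move=> [H1 [_ H2]]; split => //; lra.
Qed.

Let measurable_piece s k : measurable (piece s k).
Proof.
rewrite pieceE.
have m : measurable_fun setT (fun x : R => x + - k%:R) by apply: measurable_funD.
apply: (measurable_preimage m); apply: measurableI; first exact: measurable_itv.
exact: measurable_tail01.
Qed.

Let lebesgue_piece s k : lebesgue_measure (piece s k) = mu01 [set x | s < `|f k x|].
Proof.
have mI : measurable (`[0, 1[%classic `&` (@I01 R `&` [set x | s < `|f k x|])).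
  by apply: measurableI; [exact: measurable_itv|exact: measurable_tail01].
rewrite pieceE (lebesgue_measure_shift _ mI) mu01E.
apply: (@lebesgue_measure_rem1 _ 1) => //; first exact: measurable_tail01.
move=> x x1; split; first by case.
move=> [xI xs]; split => //; move: xI; rewrite /I01 /= !in_itv/= => /andP[-> /=].
by rewrite le_eqVlt (negPf x1).
Qed.

Lemma disj_sum_piece (n k : nat) (t : R) : (k < n)%N -> k%:R <= t < k.+1%:R ->
  disj_sum f n t = f k (t - k%:R).
Proof.
move=> kn tk; rewrite /disj_sum (bigD1 (Ordinal kn)) //= big1 => [|i ik].
  by rewrite addr0 indicE mem_set ?mulr1//= in_itv.
rewrite indicE memNset ?mulr0//= in_itv/= => ti.
move: ik; rewrite -val_eqE /= => /negP; apply.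
have : (i < k.+1)%N by rewrite -(ltr_nat R); lra.
have : (k < i.+1)%N by rewrite -(ltr_nat R); lra.
by rewrite !ltnS eqn_leq => -> ->.
Qed.

Lemma disj_sum_out (n : nat) (t : R) :
  (forall k, (k < n)%N -> ~ (k%:R <= t < k.+1%:R)) -> disj_sum f n t = 0.
Proof.
move=> H; rewrite /disj_sum big1// => i _.
by rewrite indicE memNset ?mulr0//= in_itv/=; exact: H.
Qed.

Let tailE n s : 0 <= s -> `]0, +oo[%classic `&` [set t | s < `|disj_sum f n t|] =
  `]0, +oo[%classic `&` \bigcup_(k in [set k | (k < n)%N]) piece s k.
Proof.
move=> s0; congr (_ `&` _); apply/seteqP; split => t /=.
  have [[k [kn tk]]|H] := pselect (exists k, (k < n)%N /\ k%:R <= t < k.+1%:R).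
    by rewrite (disj_sum_piece kn tk) => st; exists k.
  rewrite disj_sum_out ?normr0; first by move=> h; have := le_lt_trans s0 h; rewrite ltxx.
  by move=> k kn tk; apply: H; exists k.
by move=> [k kn [tk st]]; rewrite (disj_sum_piece kn tk).
Qed.

Lemma measurable_disj_tail n (s : R) : 0 <= s ->
  measurable (`]0, +oo[%classic `&` [set t | s < `|disj_sum f n t|]).
Proof.
move=> s0; rewrite tailE//; apply: measurableI; first exact: measurable_itv.
by apply: bigcup_measurable => k _; exact: measurable_piece.
Qed.

Lemma lebesgue_disj_tail n (s : R) : 0 <= s ->
  lebesgue_measure (`]0, +oo[%classic `&` [set t | s < `|disj_sum f n t|]) =
  (\sum_(k < n) mu01 [set x | s < `|f k x|]%R)%E.
Proof.
move=> s0; have mt := measurable_disj_tail n s0; move: mt; rewrite tailE// => mt.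
have mU : measurable (\bigcup_(k in [set k | (k < n)%N]) piece s k).
  by apply: bigcup_measurable => k _; exact: measurable_piece.
transitivity (lebesgue_measure (\bigcup_(k in [set k | (k < n)%N]) piece s k)).
  apply: (@lebesgue_measure_rem1 _ 0) => // t t0; split; first by case.
  move=> Ut; split => //; case: Ut => k _ [/andP[kt _] _].
  by rewrite /= in_itv/= andbT lt0r t0 /=; apply: le_trans kt.
rewrite bigcup_mkord measure_bigsetU_ord //.
- by apply: eq_bigr => k _; exact: lebesgue_piece.
- by move=> k; exact: measurable_piece.
- move=> i j _ _ [t [[ti _] [tj _]]]; apply/val_inj/eqP; rewrite /= eqn_leq.
  have : (i < j.+1)%N by rewrite -(ltr_nat R); lra.
  have : (j < i.+1)%N by rewrite -(ltr_nat R); lra.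
  by rewrite !ltnS => -> ->.
Qed.

Lemma vanishing_disj n :
  vanishing (fun s : R => lebesgue_measure (`]0, +oo[%classic `&` [set t | s < `|disj_sum f n t|])).
Proof.
apply: tail_vanishing => [s s0|]; first exact: measurable_disj_tail.
rewrite [X in (X < _)%E](lebesgue_disj_tail n (lexx (0 : R))).
apply/lte_sum_pinfty => k _.
have := measurable_tail01 0 (mf k); rewrite mu01E => m.
apply: (@le_lt_trans _ _ (lebesgue_measure (@I01 R))).
  by apply: le_measure; rewrite ?inE//; exact: measurable_I01.
by rewrite /I01 lebesgue_itv_bounded// ltry.
Qed.

End disjoint_sum.

Lemma independent_comp (R : realType) (f phi : nat -> R -> R) :
  (forall k, measurable_fun setT (phi k)) -> independent_seq f ->
  independent_seq (fun k x => phi k (f k x)).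
Proof.
move=> mphi If J A uJ mA.
exact: (If J (fun i => phi i @^-1` A i) uJ (fun i => measurable_preimage (mphi i) (mA i))).
Qed.

(** * Upper estimate for independent sums *)

(** Upper Riemann sum, of step [c], for the layer-cake formula. *)
Lemma layer_le (R : realType) (N : nat) (y c : R) : 0 <= y -> 0 <= c -> y <= N.+1%:R * c ->
  y <= c + \sum_(r < N) c * ((r.+1%:R * c < y)%R)%:R.
Proof.
move=> y0 c0; elim: N => [|N IH] yN; first by rewrite big_ord0 addr0; lra.
have [yl|yg] := leP y (N.+1%:R * c).
  apply: le_trans (IH yl) _; rewrite lerD2l big_ord_recr /= lerDl mulr_ge0//.
rewrite (eq_bigr (fun=> c)) => [|r _]; last first.
  rewrite (_ : (_ < y) = true) ?mulr1//; apply: le_lt_trans yg.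
  by rewrite ler_wpM2r// ler_nat.
rewrite sumr_const card_ord -mulr_natl.
by move: yN; rewrite -natr1 mulrDl mul1r; lra.
Qed.

(** Lower Riemann sum, of step [c], for the layer-cake formula. *)
Lemma layer_ge (R : realType) (N : nat) (y c : R) : 0 <= y -> 0 <= c ->
  \sum_(r < N) c * ((r.+1%:R * c < y)%R)%:R <= y.
Proof.
move=> y0 c0; elim: N => [|N IH]; first by rewrite big_ord0.
have [yl|yg] := leP y (N.+1%:R * c).
  by rewrite big_ord_recr /= ltNge yl mulr0 addr0.
apply: le_trans (ltW yg); rewrite mulr_natl -[X in _ *+ X]card_ord -sumr_const.
by apply: ler_sum => r _; rewrite ler_piMr//; case: (_ < _).
Qed.

Section upper_estimate.
Variables (R : realType) (X Y : symspace R) (P : probability (Omega R) R) (B : nat -> set R).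
Hypotheses (HP : product_lebesgue P) (HB : kruglov_partition B).
Variable kappa : R.
Hypothesis Hk : (kruglov_norm P B X Y <= kappa%:E)%E.
Variable f : nat -> R -> R.
Hypotheses (mf : forall k, measurable_fun (@I01 R) (f k)) (If : independent_seq f)
  (f0 : forall k x, 0 <= x <= 1 -> 0 <= f k x).

Let above (theta y : R) : R := ((theta < y)%R)%:R.

Let measurable_above theta : measurable_fun setT (above theta).
Proof.
rewrite (_ : above theta = \1_(`]theta, +oo[%classic : set R)).
  exact: measurable_indic.
by apply/funext => y; rewrite indicE /above mem_setE in_itv/= andbT.
Qed.

Let p (theta : R) (k : nat) : R := fine (mu01 [set x | theta < f k x]).

Let measurable_gt01 k theta : measurable (@I01 R `&` [set x | theta < f k x]).
Proof. by rewrite gt_setE; apply: mf => //; exact: measurable_I01. Qed.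

Let mu01_le1 k theta : (mu01 [set x | (theta < f k x)%R] <= 1)%E.
Proof.
have -> : mu01 [set x | (theta < f k x)%R] = mu01 (@I01 R `&` [set x | theta < f k x]).
  by rewrite !mu01E setIA setIid.
by apply: probability_le1; exact: measurable_gt01.
Qed.

Let pE theta k : (p theta k)%:E = mu01 [set x | theta < f k x].
Proof.
by rewrite /p fineK// ge0_fin_numE// (le_lt_trans (mu01_le1 k theta))// ltry.
Qed.

Let p_ge0 theta k : 0 <= p theta k.
Proof. by rewrite -lee_fin pE. Qed.

Let p_le1 theta k : p theta k <= 1.
Proof. by rewrite -lee_fin pE. Qed.

(** The disjoint sum of these indicators has the law of the indicator of an
    interval contained in the unit interval, of norm at most one. *)
Lemma inball_block (theta : R) (i j : nat) : \sum_(i <= k < j) p theta k <= 1 ->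
  inball Y (3 * kappa) (fun x => \sum_(i <= k < j) above theta (f k x)).
Proof.
set sg := \sum_(i <= k < j) p theta k => sg1.
have sg0 : 0 <= sg by apply: sumr_ge0.
pose phi (k : nat) (y : R) : R := if (i <= k)%N then above theta y else 0.
have mphi k : measurable_fun setT (phi k).
  by rewrite /phi; case: (i <= k)%N; [exact: measurable_above|exact: measurable_cst].
pose G : R -> R := \1_(`[0, sg]%classic : set R).
have mG : measurable_fun setT G by apply: measurable_indic; exact: measurable_itv.
have bG : inball X 1 G.
  apply: inball_le (inball_cst X ler01); first exact: measurable_funTS.
  by move=> x _; rewrite normr1 /G indicE; case: (_ \in _); rewrite ?normr1 ?normr0.
have sumE (T : nmodType) (F : nat -> T) :
    \sum_(i <= k < j) F k = \sum_(k < j) (if (i <= k)%N then F k else 0).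
  rewrite -(big_mkord xpredT (fun k => if (i <= k)%N then F k else 0)) -big_mkcond /=.
  by rewrite (big_nat_widenl i 0).
rewrite -[3 * kappa]mulr1.
rewrite (_ : (fun x => _) = fun x => \sum_(k < j) phi k (f k x)); last first.
  by apply/funext => x; rewrite sumE; apply: eq_bigr => k _; rewrite /phi.
apply: (inball_indep_sum HP HB Hk _ (independent_comp mphi If) _ _ _ bG).
- by move=> k; apply: measurableT_comp => //; exact: mphi.
- by move=> k x x01; rewrite /phi; case: ifP => // _; rewrite /above.
- by move=> x _; rewrite /G indicE.
move=> s s0.
have gt01 (b : bool) : (s < b%:R) = (s < 1) && b.
  by case: b; rewrite ?andbT// andbF; apply/negP => h; have := le_lt_trans s0 h; rewrite ltxx.
have [s1'|s1'] := ltP s 1; last first.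
  have z (A : set R) : (forall x, ~ A x) -> mu01 A = 0%E.
    by move=> A0; rewrite (_ : A = set0) ?measure0//; apply/seteqP; split => // x /A0.
  rewrite z; last by move=> x /=; rewrite /G indicE gt01 ltNge s1'.
  rewrite big1// => k _; apply: z => x /=; rewrite /phi /above; case: ifP => _.
    by rewrite gt01 ltNge s1'.
  by move=> h; have := le_lt_trans s0 h; rewrite ltxx.
transitivity (sg%:E).
  rewrite mu01E (_ : _ `&` _ = `[0, sg]%classic) ?lebesgue_itv_bounded ?subr0//.
  apply/seteqP; split => x; rewrite /I01 /G /= indicE gt01 s1' /= !in_itv/=.
    by move=> [_]; rewrite mem_setE in_itv.
  by move=> xs; split; [lra|rewrite mem_setE in_itv].
rewrite /sg sumE -sumEFin; apply: eq_bigr => k _.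
rewrite /phi; case: ifP => _; last first.
  rewrite (_ : mkset _ = set0) ?measure0//; apply/seteqP; split => // x /=.
  by move=> h; have := le_lt_trans s0 h; rewrite ltxx.
rewrite pE; congr mu01; apply/seteqP; split => x /=; rewrite /above gt01 s1' //=.
Qed.

(** Consecutive indicators are grouped greedily into blocks of mass at most one;
    a block together with the index that follows it has mass more than one. *)
Lemma inball_above_sum (theta : R) (n : nat) :
  inball Y (3 * kappa * (2 * (\sum_(k < n) p theta k) + 1))
    (fun x => \sum_(k < n) above theta (f k x)).
Proof.
have k0 : 0 <= 3 * kappa by have := kappa3_ge1 HP HB Hk; lra.
pose e (i j : nat) x := \sum_(i <= k < j) above theta (f k x).
have cat i j k : (i <= j)%N -> (j <= k)%N -> e i k = fun x => e i j x + e j k x.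
  by move=> ij jk; apply/funext => x; rewrite /e (big_cat_nat ij jk).
suff [j [jn bj sj]] : exists j, [/\ (j <= n)%N,
    inball Y (3 * kappa * (2 * \sum_(0 <= k < j) p theta k)) (e 0%N j) &
    \sum_(j <= k < n) p theta k <= 1].
  have : inball Y (3 * kappa * (2 * (\sum_(0 <= k < j) p theta k)) + 3 * kappa) (e 0%N n).
    by rewrite (cat 0%N j n)//; apply: inballD => //; exact: inball_block.
  rewrite /e (_ : (fun x => _) = (fun x => \sum_(k < n) above theta (f k x))); last first.
    by apply/funext => x; rewrite big_mkord.
  apply: inball_widen; rewrite mulrDr mulr1 lerD2r ler_wpM2l// ler_wpM2l//.
  rewrite -(big_mkord xpredT (p theta)) (big_cat_nat (leq0n j) jn)/= lerDl.
  exact: sumr_ge0.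
elim: n => [|n [j [jn bj sj]]].
  exists 0%N; rewrite !big_geq// !mulr0; split => //.
  rewrite /e (_ : (fun x => _) = fun=> 0); first exact: inball0.
  by apply/funext => x; rewrite big_geq.
have [h|h] := leP (\sum_(j <= k < n.+1) p theta k) 1.
  by exists j; split => //; exact: leqW.
exists n.+1; split => //; last by rewrite big_geq.
rewrite (cat 0%N j n.+1)//; last exact: leqW.
rewrite (cat j n n.+1)//.
have b1 : inball Y (3 * kappa) (e j n) by exact: inball_block.
have b2 : inball Y (3 * kappa) (e n n.+1).
  by apply: inball_block; rewrite big_nat1.
apply: inball_widen (inballD bj (inballD b1 b2)).
rewrite (_ : 3 * kappa + 3 * kappa = 3 * kappa * 2); last by lra.
rewrite -mulrDr ler_wpM2l//.
rewrite [in leRHS](big_cat_nat (leq0n j) (leqW jn))/= mulrDr lerD2l.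
by lra.
Qed.

End upper_estimate.

Lemma rearr_disjE (R : realType) (f : nat -> R -> R) (n : nat) (t : R) :
  (forall k, measurable_fun (@I01 R) (f k)) ->
  rearr_pos (disj_sum f n) t = ginv (fun s => \sum_(k < n) mu01 [set x | (s < `|f k x|)%R])%E t.
Proof.
move=> mf; rewrite /rearr_pos /rearr /ginv; congr inf.
by apply/seteqP; split => s [s0 H]; split => //; move: H; rewrite lebesgue_disj_tail.
Qed.

Lemma integral_scaled_indic (R : realType) (c : R) (A : set R) : 0 <= c -> measurable A ->
  (\int[@lebesgue_measure R]_t (c * \1_A t)%:E = c%:E * lebesgue_measure A)%E.
Proof.
move=> c0 mA; under eq_integral do rewrite EFinM.
rewrite ge0_integralZl//.
  by rewrite integral_indic// setIT.
by apply: measurableT_comp => //; exact: measurable_indic.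
Qed.

Section upper_estimate_final.
Variables (R : realType) (X Y : symspace R) (P : probability (Omega R) R) (B : nat -> set R).
Hypotheses (HP : product_lebesgue P) (HB : kruglov_partition B).
Variable kappa : R.
Hypothesis Hk : (kruglov_norm P B X Y <= kappa%:E)%E.

(** With [a] the value at [1] of the rearrangement of the disjoint sum, the part
    of [f] above [a] has mass at most one, and the part below [a] is bounded by
    [N] layers of height [c = a / (N + 1)].  The term [c] lost for each [f k]
    adds up to [n * c <= a], thanks to [N = n]. *)
Lemma inball_sum_ge0 (f : nat -> R -> R) (n : nat) (eta J : R) :
  (forall k, measurable_fun (@I01 R) (f k)) -> independent_seq f ->
  (forall k x, 0 <= x <= 1 -> 0 <= f k x) ->
  inball X eta (rearr_pos (disj_sum f n) \* \1_(@I01 R)) ->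
  (\int[@lebesgue_measure R]_t `|(rearr_pos (disj_sum f n) t * \1_(`[1%R, +oo[%classic : set R) t)%:E| <= J%:E)%E ->
  inball Y (15 * kappa * (eta + J)) (fun x => \sum_(k < n) f k x).
Proof.
move=> mf If f0 bH HJ.
pose FS := rearr_pos (disj_sum f n).
pose a := FS 1; pose N := n; pose c := a / N.+1%:R.
pose p (theta : R) (k : nat) : R := fine (mu01 [set x | theta < f k x]).
pose D (s : R) : R := \sum_(k < n) p s k.
have k1 := kappa3_ge1 HP HB Hk.
have a0 : 0 <= a by exact: ginv_ge0.
have c0 : 0 <= c by rewrite divr_ge0.
have mgt k theta : measurable (@I01 R `&` [set x | theta < f k x]).
  by rewrite gt_setE; apply: mf => //; exact: measurable_I01.
have pE theta k : (p theta k)%:E = mu01 [set x | theta < f k x].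
  rewrite /p fineK// ge0_fin_numE// mu01E (le_lt_trans (y := lebesgue_measure (@I01 R)))//.
    by apply: le_measure; rewrite ?inE//; [exact: mgt|exact: measurable_I01].
  by rewrite /I01 lebesgue_itv_bounded// ltry.
have p0 theta k : 0 <= p theta k by rewrite -lee_fin pE.
have DE s : 0 <= s ->
    lebesgue_measure (`]0, +oo[%classic `&` [set t | s < `|disj_sum f n t|]) = (D s)%:E.
  move=> s0; rewrite lebesgue_disj_tail// /D -sumEFin; apply: eq_bigr => k _.
  by rewrite pE; apply: eq_mu01 => x x01 /=; rewrite ger0_norm// f0.
have dD := vanishing_disj mf n.
have mt s : 0 <= s -> measurable (`]0, +oo[%classic `&` [set t | s < `|disj_sum f n t|]).
  by move=> s0; exact: measurable_disj_tail.
have FSgt (t s : R) : 0 < t -> 0 <= s -> (s < FS t) = (t < D s).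
  move=> t0 s0; rewrite /FS /rearr_pos.
  rewrite (@rearr_gt _ (measurableTypeR R) R (@lebesgue_measure R) _ _ mt t s dD t0 s0).
  by rewrite [X in (_ < X)%E](DE s s0) lte_fin.
have Da : D a <= 1 by rewrite leNgt -FSgt ?ltxx.
have mFS : measurable_fun (`[0, +oo[%classic : set R) FS by exact: measurable_ginv.
have mFS1 : measurable_fun (@I01 R) FS by exact: measurable_ginv01.
have HE x : 0 <= x <= 1 -> (FS \* \1_(@I01 R)) x = FS x.
  by move=> x01; rewrite /= indicE mem_set ?mulr1// /I01 /= in_itv.
have FS0 t : 0 <= FS t by exact: ginv_ge0.
pose phi (y : R) := y * ((a < y)%R)%:R.
have mphi : measurable_fun setT phi.
  apply: measurable_funM => //.
  rewrite (_ : (fun x => _) = \1_(`]a, +oo[%classic : set R)); first exact: measurable_indic.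
  by apply/funext => y; rewrite indicE mem_setE in_itv/= andbT.
have phi0 y : 0 <= y -> 0 <= phi y by move=> y0; rewrite mulr_ge0.
have phi_gt s y : 0 <= s -> (s < phi y) = (Num.max s a < y).
  move=> s0; rewrite gt_max /phi; case: (ltP a y) => ay; first by rewrite mulr1 andbT.
  by rewrite mulr0 andbF; apply/negP => h; have := le_lt_trans s0 h; rewrite ltxx.
(* the part above [a]: its disjoint sum has the law of [phi FS] on [0, 1] *)
have b1 : inball Y (3 * kappa * eta) (fun x => \sum_(k < n) phi (f k x)).
  apply: (@inball_indep_sum R X Y P B HP HB kappa Hk (fun k x => phi (f k x))
    (fun x => phi (FS x))).
  - by move=> k; apply: measurableT_comp.
  - exact: (independent_comp (fun=> mphi) If).
  - by move=> k x x01; apply: phi0; exact: f0.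
  - by move=> x x01; exact: phi0.
  - move=> s s0.
    have m0 : 0 <= Num.max s a by rewrite le_max s0.
    transitivity (mu01 [set x | Num.max s a < FS x]).
      by congr mu01; apply/seteqP; split => x /=; rewrite phi_gt.
    transitivity ((D (Num.max s a))%:E); last first.
      rewrite /D -sumEFin; apply: eq_bigr => k _.
      by rewrite pE; congr mu01; apply/seteqP; split => x /=; rewrite phi_gt.
    have := @mu01_rearr _ (measurableTypeR R) R (@lebesgue_measure R) _ _ mt _ dD m0; rewrite [X in Order.min X _](DE _ m0) => ->.
    rewrite min_l// lee_fin; apply: le_trans Da.
    apply: ler_sum => k _; rewrite -lee_fin !pE !mu01E.
    apply: le_measure; rewrite ?inE; [exact: mgt|exact: mgt|].
    by move=> x [xI /= sx]; split => //=; apply: le_lt_trans sx; rewrite le_max lexx orbT.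
  - apply: inball_le bH; first by apply: measurableT_comp.
    move=> x x01; rewrite HE// ger0_norm ?phi0// ger0_norm//.
    by rewrite /phi ler_piMr//; case: (_ < _).
pose e (r : 'I_N) x : R := \sum_(k < n) ((r.+1%:R * c < f k x)%R)%:R.
have b2 : inball Y (\sum_(r < N) c * (3 * kappa * (2 * D (r.+1%:R * c) + 1)))
    (fun x => \sum_(r < N) c * e r x).
  apply: inball_sum => r; apply: inballZ => //.
  exact: (inball_above_sum HP HB Hk mf If (r.+1%:R * c) n).
have b3 : inball Y (n%:R * c) (fun=> n%:R * c) by apply: inball_cst; rewrite mulr_ge0.
have aeta : a <= eta.
  apply: (le_inball a0 _ bH) => x x01; rewrite HE; last by lra.
  by rewrite ger0_norm//; apply: ginv_nonincreasing => //; lra.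
(* on [[1, +oo[] the layers of [FS] are the intervals [I_ r], by the Galois
   connection *)
have HD : \sum_(r < N) c * (D (r.+1%:R * c) - 1) <= J.
  pose I_ (r : 'I_N) : set R := `[1, D (r.+1%:R * c)[%classic.
  have mI r : measurable (I_ r) by exact: measurable_itv.
  have mcI r : measurable_fun setT (fun t : measurableTypeR R => (c * \1_(I_ r) t)%:E).
    apply: measurableT_comp => //; apply: measurable_funM; first exact: measurable_cst.
    by apply: measurable_indic; exact: mI.
  apply: (@le_trans _ _ (\sum_(r < N) c * Num.max 0 (D (r.+1%:R * c) - 1))).
    by apply: ler_sum => r _; rewrite ler_wpM2l// le_max lexx orbT.
  rewrite -lee_fin; apply: le_trans HJ.
  have -> : ((\sum_(r < N) c * Num.max 0 (D (r.+1%:R * c) - 1))%:E =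
      \int[@lebesgue_measure R]_t (\sum_(r < N) (c * \1_(I_ r) t)%:E))%E.
    rewrite ge0_integral_sum//.
    - rewrite -sumEFin; apply: eq_bigr => r _.
      rewrite [RHS](integral_scaled_indic c0 (mI r)) /I_ EFinM; congr (_ * _)%E.
      have [D1|D1] := leP 1 (D (r.+1%:R * c)).
        by rewrite lebesgue_itv_bounded// max_r//; lra.
      rewrite (_ : [set` _] = set0) ?measure0; last first.
        by apply/seteqP; split => x //=; rewrite in_itv/=; lra.
      by rewrite max_l//; lra.
    - by move=> r t _; rewrite lee_fin mulr_ge0.
  have mG : measurable_fun setT (fun t => FS t * \1_(`[1, +oo[%classic : set R) t).
    rewrite (_ : (fun t => _) = FS \_ `[1, +oo[%classic).
      apply: (measurable_restrictT FS _).1; first exact: measurable_itv.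
      apply: measurable_funS mFS; first exact: measurable_itv.
      by move=> x; rewrite /= !in_itv/= !andbT; exact: le_trans.
    apply/funext => t; rewrite patchE indicE; case: (_ \in _); rewrite ?mulr1 ?mulr0//.
  apply: ge0_le_integral => //.
  - by move=> t _; apply: sume_ge0 => r _; rewrite lee_fin mulr_ge0.
  - by apply: emeasurable_sum => r; exact: mcI.
  - by apply: measurableT_comp => //; apply: measurableT_comp.
  move=> t _; rewrite sumEFin abse_EFin lee_fin ger0_norm ?mulr_ge0//.
  have [t1|t1] := ltP t 1.
    rewrite indicE memNset ?mulr0; last by rewrite /= in_itv/= andbT; lra.
    by rewrite big1// => r _; rewrite indicE memNset ?mulr0// /I_ /= in_itv/=; lra.
  rewrite [X in _ * X]indicE mem_set ?mulr1; last by rewrite /= in_itv/= andbT.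
  apply: le_trans (layer_ge N (FS0 t) c0); apply: ler_sum => r _.
  rewrite FSgt//; [|lra|by rewrite mulr_ge0].
  by rewrite indicE mem_setE in_itv/= t1.
have mS : measurable_fun (@I01 R) (fun x => \sum_(k < n) f k x) by apply: measurable_sum => k.
have Nc : n%:R * c <= a.
  rewrite /c mulrA mulrAC ler_piMl// ler_pdivrMr// mul1r ler_nat; exact: leqnSn.
have J0 : 0 <= J by rewrite -lee_fin; apply: le_trans HJ; apply: integral_ge0.
have ba := inballD b1 (inballD b3 b2).
apply: (@inball_widen _ _ _ _ _ _ (inball_le mS _ ba)).
  have -> : \sum_(r < N) c * (3 * kappa * (2 * D (r.+1%:R * c) + 1)) =
      3 * kappa * (2 * \sum_(r < N) c * (D (r.+1%:R * c) - 1) + 3 * (n%:R * c)).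
    rewrite mulrDr !mulr_sumr (_ : 3 * kappa * (3 * (n%:R * c)) = \sum_(r < N) 3 * kappa * (3 * c)).
      by rewrite -big_split /=; apply: eq_bigr => r _; ring.
    by rewrite sumr_const card_ord -mulr_natl; ring.
  (* [3] for the part above [a], at most [3] for [n * c] and [9] for the layers,
     all times [kappa * eta]; the excess masses bring [6 * kappa * J] *)
  move: HD Nc; move: (\sum_(r < N) _) (n%:R * c) => u v HD Nc.
  have kp : 0 <= kappa by lra.
  have eta0 : 0 <= eta by exact: le_trans aeta.
  have h1 : v <= 3 * kappa * eta by apply: le_trans (_ : eta <= _); [lra|rewrite ler_peMl].
  have h2 : kappa * u <= kappa * J by rewrite ler_wpM2l.
  have h3 : kappa * v <= kappa * eta by rewrite ler_wpM2l//; lra.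
  have h4 : 0 <= kappa * J by rewrite mulr_ge0.
  have h5 : 0 <= kappa * eta by rewrite mulr_ge0.
  by lra.
move=> x x01.
have e0 r : 0 <= e r x by apply: sumr_ge0.
rewrite !ger0_norm; first last.
- by apply: sumr_ge0 => k _; exact: f0.
- rewrite addr_ge0//; first by apply: sumr_ge0 => k _; apply: phi0; exact: f0.
  by rewrite addr_ge0 ?mulr_ge0//; apply: sumr_ge0 => r _; rewrite mulr_ge0.
have -> : n%:R * c = \sum_(k < n) c by rewrite sumr_const card_ord mulr_natl.
have -> : \sum_(r < N) c * e r x =
    \sum_(k < n) \sum_(r < N) c * ((r.+1%:R * c < f k x)%R)%:R.
  by rewrite exchange_big /=; apply: eq_bigr => r _; rewrite mulr_sumr.
rewrite -!big_split /=; apply: ler_sum => k _.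
have s0 : 0 <= \sum_(r < N) c * ((r.+1%:R * c < f k x)%R)%:R.
  by apply: sumr_ge0 => r _; rewrite mulr_ge0.
have fk := f0 k x x01.
have [fa|fa] := leP (f k x) a; last by rewrite /phi fa mulr1; lra.
have := @layer_le R N (f k x) c fk c0; rewrite /c [N.+1%:R * _]mulrC divfK//.
by move=> /(_ fa) h; apply: le_trans h _; rewrite lerDr phi0.
Qed.

End upper_estimate_final.

(** * Thinning: binomial and Poisson weights *)

Section binomial.
Variable R : realType.

Definition binw (a b : R) (n i : nat) : R := 'C(n, i)%:R * a ^+ (n - i) * b ^+ i.

Lemma binw_ge0 a b n i : 0 <= a -> 0 <= b -> 0 <= binw a b n i.
Proof. by move=> a0 b0; rewrite !mulr_ge0// exprn_ge0. Qed.

Lemma binwS a b n i : (i <= n.+1)%N ->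
  binw a b n.+1 i = a * binw a b n i + (if i is j.+1 then b * binw a b n j else 0).
Proof.
case: i => [_|j jn]; rewrite /binw.
  by rewrite !bin0 !subn0 addr0 exprS; ring.
rewrite binS natrD subSS exprS; have [jn'|nj] := ltnP j n.
  by rewrite -(subnSK jn') exprS; ring.
have -> : j = n by apply/eqP; rewrite eqn_leq nj andbT -ltnS.
by rewrite (@bin_small n n.+1)// ; ring.
Qed.

Lemma posop_iter (A : (R -> \bar R) -> R -> \bar R) k : posop A -> posop (iter k A).
Proof.
move=> pA; have [gA dA zA lA] := pA; split.
- by move=> h gh; exact: testfun_iter.
- elim: k => [//|k IH] h1 h2 g1 g2 /=.
  by rewrite IH// dA//; exact: testfun_iter.
- elim: k => [//|k IH] c h c0 gh /=.
  by rewrite IH// zA//; exact: testfun_iter.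
- elim: k => [//|k IH] h1 h2 g1 g2 h12 x /=.
  by apply: lA; [exact: testfun_iter|exact: testfun_iter|exact: IH].
Qed.

(** The binomial theorem for the powers of [a + b T]. *)
Lemma iter_affine_op (A T : (R -> \bar R) -> R -> \bar R) (a b : R) n :
  0 <= a -> 0 <= b -> posop A -> posop T ->
  (forall h, testfun h -> A h = fun x => a%:E * h x + b%:E * T h x)%E ->
  forall h, testfun h -> forall x,
  (iter n A h x = \sum_(i < n.+1) (binw a b n i)%:E * iter i T h x)%E.
Proof.
move=> a0 b0 pA pT AE; elim: n => [|n IH] h gh x.
  by rewrite big_ord_recl big_ord0 /= adde0 /binw bin0 !expr0 !mulr1 mul1e.
have [gT dT zT lT] := pT.
rewrite iterSr (AE h gh).
have [_ d z _] := posop_iter n pA.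
rewrite d; [|exact: testfunZ|by apply: testfunZ => //; exact: gT].
rewrite !z//; last exact: gT.
rewrite !IH//; last exact: gT.
have w0 i : (0 <= (binw a b n i)%:E)%E by rewrite lee_fin binw_ge0.
have t0 i : (0 <= iter i T h x)%E by exact: (testfun_iter i pT gh).2.
have t0' i : (0 <= iter i T (T h) x)%E by exact: (testfun_iter i pT (gT _ gh)).2.
rewrite !ge0_sume_distrr; try by move=> i _; exact: mule_ge0.
transitivity (\sum_(i < n.+2) ((a * binw a b n i)%:E * iter i T h x +
   (if (i : nat) is j.+1 then b * binw a b n j else 0)%:E * iter i T h x))%E; last first.
  apply: eq_bigr => i _; rewrite binwS; last by rewrite -ltnS.
  rewrite EFinD ge0_muleDl//; first by rewrite lee_fin mulr_ge0// binw_ge0.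
  by rewrite lee_fin; case: (i : nat) => // j; rewrite mulr_ge0// binw_ge0.
rewrite big_split /=; congr (_ + _)%E.
  rewrite [RHS]big_ord_recr /= [X in _ = (_ + X)%E](_ : _ = 0%E); last first.
    by rewrite /binw (@bin_small n n.+1)// !mul0r mulr0 mul0e.
  by rewrite adde0; apply: eq_bigr => i _; rewrite EFinM muleA.
rewrite [RHS]big_ord_recl /= mul0e add0e; apply: eq_bigr => i _.
by rewrite add0n EFinM muleA -[T (iter i T h)]/(iter i.+1 T h) iterSr.
Qed.

Lemma ffact_ge (n i : nat) : (0 < n)%N ->
  n%:R ^+ i * (1 - (i * i)%:R / n%:R) <= (n ^_ i)%:R :> R.
Proof.
move=> n0; have p0 : 0 < n%:R :> R by rewrite ltr0n.
elim: i => [|i IH]; first by rewrite expr0 mul1r mul0r subr0 ffactn0.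
have [ni|ni] := leqP n i.
  apply: (@le_trans _ _ 0); last by [].
  rewrite pmulr_rle0 ?exprn_gt0// subr_le0 ler_pdivlMr// mul1r ler_nat; nia.
rewrite ffactnSr [leRHS]natrM natrB ?(ltnW ni)// exprS.
have yx : i%:R <= n%:R :> R by rewrite ler_nat ltnW.
apply: (@le_trans _ _ (n%:R ^+ i * (1 - (i * i)%:R / n%:R) * (n%:R - i%:R))); last first.
  by apply: ler_wpM2r => //; rewrite subr_ge0.
rewrite [n%:R * _]mulrC -!mulrA ler_wpM2l ?exprn_ge0//.
rewrite !natrM -natr1.
have y0 : 0 <= i%:R :> R by [].
move: yx p0 y0; move: (n%:R) (i%:R) => u v vu u0 v0.
rewrite -(ler_pM2r u0).
have -> : u * (1 - (v + 1) * (v + 1) / u) * u = u * u - (v + 1) * (v + 1) * u by field; lra.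
have -> : (1 - v * v / u) * (u - v) * u = (u - v * v) * (u - v) by field; lra.
have : 0 <= v * v * v by rewrite !mulr_ge0.
by nra.
Qed.

Lemma expR_bernoulli (M : nat) : expR (-1) <= (1 - M.+1%:R^-1) ^+ M :> R.
Proof.
case: M => [|M]; first by rewrite expr0 expRN invf_le1 ?expR_gt0// -expR0 ler_expR.
have M0 : 0 < M.+1%:R :> R by [].
have -> : -1 = M.+1%:R * - (M.+1%:R)^-1 :> R by rewrite mulrN mulfV// gt_eqF.
rewrite expRM_natl; apply: lerXn2r; rewrite ?nnegrE ?expR_ge0//.
  by rewrite subr_ge0 invf_le1// ler1n.
rewrite expRN -[leRHS]invrK lef_pV2 ?posrE ?expR_gt0//; last first.
  by rewrite invr_gt0 subr_gt0 invf_lt1// ltr1n.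
apply: le_trans (expR_ge1Dx _).
rewrite -natr1 (_ : (1 - (M.+1%:R + 1)^-1)^-1 = 1 + M.+1%:R^-1) //.
by move: (M.+1%:R) M0 => u u0; field; apply/andP; split; lra.
Qed.

(** The factor [(1 - 1 / n) ^ (n - i)] is at least [1 / e].  The choice of a cube
    for [n] makes [i ^ 2 / n], the loss in replacing a falling factorial by a
    power, at most [1 / (m + 1)]. *)
Lemma binw_ge_poisson (m i n : nat) : (0 < i <= m)%N -> n = (m.+1 ^ 3)%N ->
  (1 - m.+1%:R^-1) * (expR 1 * i`!%:R)^-1 <= binw (1 - n%:R^-1) n%:R^-1 n i.
Proof.
move=> /andP[i0 im] nE.
have n0 : (0 < n)%N by rewrite nE expn_gt0.
have p0 : 0 < n%:R :> R by rewrite ltr0n.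
have h1 : expR (-1) <= (1 - n%:R^-1) ^+ (n - i) :> R.
  apply: le_trans (_ : (1 - n%:R^-1) ^+ n.-1 <= _).
    by have := expR_bernoulli n.-1; rewrite prednK.
  apply: ler_wiXn2l; last by lia.
    by rewrite subr_ge0 invf_le1// ler1n.
  by rewrite gerBl.
have h2 : (1 - m.+1%:R^-1) * (i`!%:R)^-1 <= 'C(n, i)%:R * n%:R^-1 ^+ i :> R.
  have e : 'C(n, i)%:R = (n ^_ i)%:R / i`!%:R :> R.
    by rewrite -bin_ffact natrM mulfK// pnatr_eq0 -lt0n fact_gt0.
  rewrite e mulrAC exprVn ler_pM2r ?invr_gt0 ?ltr0n ?fact_gt0//.
  rewrite ler_pdivlMr ?exprn_gt0// mulrC.
  apply: le_trans (ffact_ge i n0); rewrite ler_wpM2l ?exprn_ge0// lerB//.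
  rewrite ler_pdivrMr// mulrC ler_pdivlMr// -natrM ler_nat nE.
  by rewrite !expnS expn0 muln1 mulnA leq_mul// leq_mul// leqW.
rewrite /binw -mulrA [_ ^+ (n - i) * _]mulrC mulrA.
rewrite invfM -expRN mulrCA [leLHS]mulrC; apply: ler_pM => //.
by rewrite mulr_ge0 ?invr_ge0// subr_ge0 invf_le1// ler1n.
Qed.

End binomial.

Section thinning.
Variables (R : realType) (g : R -> R).
Hypotheses (mg : measurable_fun setT g) (g0 : forall x, 0 <= g x).

(** The first half of the digits of [u] gives the value of [g], the other half
    decides, with probability [1 / n], whether it is kept. *)
Definition thin (n : nat) (u : R) : R :=
  g (split1 u) * \1_(`[0, n%:R^-1]%classic : set R) (split2 u).

Lemma measurable_thin n : measurable_fun setT (thin n).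
Proof.
apply: measurable_funM; first exact: (measurableT_comp mg (@measurable_split1 R)).
apply: (measurableT_comp _ (@measurable_split2 R)).
by apply: measurable_indic; exact: measurable_itv.
Qed.

Lemma thin_ge0 n x : 0 <= thin n x.
Proof. by rewrite mulr_ge0. Qed.

Let mu01_keep (n : nat) : (0 < n)%N -> mu01 (`[0, n%:R^-1]%classic : set R) = (n%:R^-1)%:E.
Proof.
move=> n0; have n1 : n%:R^-1 <= 1 :> R by rewrite invf_le1 ?ler1n// ltr0n.
rewrite mu01E (_ : _ `&` _ = `[0, n%:R^-1]%classic) ?lebesgue_itv_bounded ?subr0//.
apply/seteqP; split => x; rewrite /I01 /= !in_itv/=; first by case.
by move=> ?; split => //; lra.
Qed.

Lemma mu01_thin n (s : R) : (0 < n)%N -> 0 <= s ->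
  mu01 [set x | s < thin n x] = ((n%:R^-1)%:E * mu01 [set x | (s < g x)%R])%E.
Proof.
move=> n0 s0.
rewrite (_ : mkset _ = @split1 R @^-1` [set x | s < g x] `&` @split2 R @^-1` `[0, n%:R^-1]%classic).
  rewrite mu01_split; [|by rewrite gt_setE; exact: measurable_preimage|exact: measurable_itv].
  by rewrite mu01_keep// muleC.
apply/seteqP; split => x; rewrite /thin /preimage /= indicE.
  case: (boolP (_ \in _)) => [/set_mem h|_]; first by rewrite mulr1.
  by rewrite mulr0 => h; have := le_lt_trans s0 h; rewrite ltxx.
by move=> [h1 h2]; rewrite mem_set// mulr1.
Qed.

Lemma tr_thin n h : (0 < n)%N -> testfun h ->
  tr (fun=> 1) (thin n) h =
  (fun x => (1 - n%:R^-1)%:E * h x + (n%:R^-1)%:E * tr (fun=> 1%R) g h x)%E.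
Proof.
move=> n0 gh; apply/funext => x.
have n1 : 0 <= 1 - n%:R^-1 :> R by rewrite subr_ge0 invf_le1 ?ler1n// ltr0n.
pose A : set R := `[0, n%:R^-1]%classic.
have mA : measurable A by exact: measurable_itv.
pose k (z : measurableTypeR R * measurableTypeR R) := h (x + g z.1 * \1_A z.2)%R.
have mk : measurable_fun setT k.
  apply: (measurableT_comp gh.1); apply: measurable_funD => //.
  apply: measurable_funM; first by apply: (measurableT_comp mg); exact: measurable_fst.
  apply: (@measurableT_comp _ _ _ _ _ _ (\1_A : R -> R)); last exact: measurable_snd.
  exact: measurable_indic.
transitivity (\int[@mu01 R]_y k (split1 y, split2 y))%E.
  by apply: eq_integral => y _; rewrite mul1e.
rewrite integral_split//; last by move=> z; exact: gh.2.
have inner u : (\int[@mu01 R]_v k (u, v) =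
    (1 - n%:R^-1)%:E * h x + (n%:R^-1)%:E * h (x + g u)%R)%E.
  transitivity (\int[@mu01 R]_v (h x * (\1_(~` A) v)%:E + h (x + g u)%R * (\1_A v)%:E))%E.
    apply: eq_integral => v _; rewrite /k /= !indicE in_setC; case: (v \in A) => /=.
      by rewrite mulr1 mule0 add0e mule1.
    by rewrite mulr0 addr0 mule0 adde0 mule1.
  have mAC : measurable (~` A) by exact: measurableC.
  have m1 (B : set R) : measurable B -> measurable_fun setT (fun v : measurableTypeR R => (\1_B v)%:E : \bar R).
    by move=> mB; apply: measurableT_comp => //; exact: measurable_indic.
  rewrite ge0_integralD//; first last.
  - by apply: emeasurable_funM; [exact: measurable_cst|exact: m1].
  - by move=> v _; rewrite mule_ge0 ?lee_fin//; exact: gh.2.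
  - by apply: emeasurable_funM; [exact: measurable_cst|exact: m1].
  - by move=> v _; rewrite mule_ge0 ?lee_fin//; exact: gh.2.
  have I (B : set R) : measurable B -> (\int[@mu01 R]_v (\1_B v)%:E = mu01 B)%E.
    by move=> mB; rewrite integral_indic// setIT.
  have Z (c : \bar R) (B : set R) : (0 <= c)%E -> measurable B ->
      (\int[@mu01 R]_v (c * (\1_B v)%:E) = c * mu01 B)%E.
    by move=> c0 mB; rewrite ge0_integralZl//; [rewrite I|exact: m1].
  rewrite !Z//; try exact: gh.2.
  have -> : mu01 (~` A) = (1 - n%:R^-1)%:E.
    rewrite [LHS](@probability_setC _ _ _ (@mu01 R) A mA).
    by rewrite [X in (1 - X)%E](mu01_keep n0).
  by rewrite (mu01_keep n0) muleC; congr (_ + _)%E; rewrite muleC.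
transitivity (\int[@mu01 R]_u (cst ((1 - n%:R^-1)%:E * h x)%E u + (n%:R^-1)%:E * h (x + g u)%R))%E.
  by apply: eq_integral => u _; rewrite inner.
have G := testfun_tr_integrand x (@weight1 R) mg gh.
have gg : testfun (fun u => h (x + g u)%R).
  by case: G => [a b]; split => [|u]; [move: a; under eq_fun do rewrite mul1e|have := b u; rewrite mul1e].
rewrite ge0_integralD//.
- rewrite mu01_integral_cst mu01_integralZl//; congr (_ + _ * _)%E.
  by apply: eq_integral => u _; rewrite mul1e.
- by move=> u _; rewrite mule_ge0 ?lee_fin//; exact: gh.2.
- by move=> u _; rewrite mule_ge0 ?lee_fin//; exact: gg.2.
- by apply: emeasurable_funM; [exact: measurable_cst|exact: gg.1].
Qed.

End thinning.

(** The number of variables that are kept is binomial. *)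
Lemma thin_sum_tail (R : realType) (g : R -> R) (n : nat) (s : R) :
  measurable_fun setT g -> (0 < n)%N ->
  mu01 [set x | s < psum (fun=> thin g n) n x] =
  (\sum_(i < n.+1) (binw (1 - n%:R^-1) n%:R^-1 n i)%:E *
     mu01 [set x | (s < psum (fun=> g) i x)%R])%E.
Proof.
move=> mg n0.
have mI : measurable (`]s, +oo[%classic : set R) by [].
have gI := testfun_indic mI.
have n1 : 0 <= 1 - n%:R^-1 :> R by rewrite subr_ge0 invf_le1 ?ler1n// ltr0n.
have mt := measurable_thin mg n.
rewrite gt_setE mu01_psum// conv_const.
have ninv : 0 <= n%:R^-1 :> R by rewrite invr_ge0.
have pA : posop (tr (fun=> 1) (thin g n)) by apply: posop_tr => //; exact: weight1.
have pT : posop (tr (fun=> 1) g) by apply: posop_tr => //; exact: weight1.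
rewrite (iter_affine_op n n1 ninv pA pT (fun h gh => tr_thin mg n0 gh) gI).
by apply: eq_bigr => i _; rewrite gt_setE mu01_psum// conv_const.
Qed.

(** * Lower estimate by thinning *)

Section lower_estimate.
Variables (R : realType) (X Y : symspace R) (P : probability (Omega R) R) (B : nat -> set R).
Hypotheses (HP : product_lebesgue P) (HB : kruglov_partition B).
Hypothesis FY : fatou_property Y.
Variable C : R.
Hypothesis HC : forall f : nat -> R -> R,
  (forall k, ss_car X (f k)) -> independent_seq f ->
  (forall n, (\sum_(k < n)
     lebesgue_measure (I01 `&` [set x | f k x != 0%R]) <= 1)%E) ->
  forall n, (enorm Y (fun x => \sum_(k < n) f k x)%R <=
            C%:E * head_norm X (disj_sum f n))%E.

Section one_function.
Variable g : R -> R.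
Hypotheses (mg : measurable_fun setT g) (g0 : forall x, 0 <= g x) (bg : inball X 1 g).

Let H := rearr (@lebesgue_measure R) (@I01 R) g \* \1_(@I01 R).

Let mg01 : measurable_fun (@I01 R) g.
Proof. exact: measurable_funTS. Qed.

Let mu01_H (s : R) : 0 <= s -> mu01 [set x | s < `|H x|] = mu01 [set x | s < `|g x|].
Proof.
move=> s0.
have dg := vanishing_tail01 mg01.
have mt (r : R) : 0 <= r -> measurable (@I01 R `&` [set x | r < `|g x|]).
  by move=> r0; exact: measurable_tail01.
have := @mu01_rearr _ (measurableTypeR R) R (@lebesgue_measure R) _ _ mt _ dg s0.
have le1 : (lebesgue_measure (@I01 R `&` [set x | (s < `|g x|)%R]) <= 1)%E.
  by have := probability_le1 (@mu01 R) (mt s s0); rewrite [X in (X <= _)%E]mu01E setIA setIid.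
rewrite min_l; last exact: le1.
move=> E; rewrite [RHS]mu01E; apply: etrans E; apply: eq_mu01 => x x01.
by rewrite /H /= indicE mem_set ?mulr1 ?ger0_norm ?ginv_ge0// /I01 /= in_itv.
Qed.

Let mH : measurable_fun (@I01 R) H.
Proof.
apply: measurable_funM; first exact: measurable_ginv01 (vanishing_tail01 mg01).
by apply: measurable_indic; exact: measurable_I01.
Qed.

Lemma inball_rearr c : inball X c H <-> inball X c g.
Proof.
split; apply: inball_dom => // s s0; rewrite mu01_H//.
Qed.

(** The disjoint sum of [n] thinned copies of [g] has the law of [g]. *)
Lemma thin_sum_estimate n : (0 < n)%N ->
  (enorm Y (psum (fun=> thin g n) n) <= C%:E * enorm X H)%E.
Proof.
move=> n0.
(* the hypothesis speaks of infinite sequences: extend the [n] copies by zero *)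
pose F (k : nat) (u : R) : R := if (k < n)%N then thin g n u else 0.
have mF k : measurable_fun setT (F k).
  by rewrite /F; case: (k < n)%N; [exact: measurable_thin|exact: measurable_cst].
have F0 k u : 0 <= F k u by rewrite /F; case: ifP => // _; exact: thin_ge0.
pose f (k : nat) (x : R) : R := F k (unif k x).
have mf k : measurable_fun setT (f k).
  by apply: (measurableT_comp (mF k)); exact: measurable_unif.
have mtf k s : measurable [set u | s < F k u].
  by rewrite gt_setE; apply: measurable_preimage.
have mu_f k s : 0 <= s -> mu01 [set x | s < f k x] =
    (if (k < n)%N then (n%:R^-1)%:E * mu01 [set x | (s < g x)%R] else 0)%E.
  move=> s0; rewrite -[LHS]/(mu01 (@unif R k @^-1` [set u | s < F k u])) mu01_unif1//.
  rewrite /F; case: ifP => kn; first by rewrite mu01_thin.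
  rewrite (_ : mkset _ = set0) ?measure0//; apply/seteqP; split => // x /= h.
  by have := le_lt_trans s0 h; rewrite ltxx.
have ninv : 0 <= (n%:R^-1 : R) <= 1 by rewrite invr_ge0 ler0n invf_le1 ?ler1n// ltr0n.
have mu1 (A : set R) : measurable A -> (mu01 A <= 1)%E by move=> mA; exact: probability_le1.
have mtg s : measurable [set x | s < g x] by rewrite gt_setE; apply: measurable_preimage.
have absf k s : [set x | s < `|f k x|] = [set x | s < f k x].
  by apply/seteqP; split => x /=; rewrite ger0_norm// F0.
have absg s : [set x | s < `|g x|] = [set x | s < g x].
  by apply/seteqP; split => x /=; rewrite ger0_norm.
have nn : n%:R != 0 :> R by rewrite pnatr_eq0 -lt0n.
have sumE s : 0 <= s -> (\sum_(k < n) mu01 [set x | s < `|f k x|]%R = mu01 [set x | (s < `|g x|)%R])%E.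
  move=> s0; rewrite absg.
  have fin : mu01 [set x | s < g x] \is a fin_num.
    by rewrite ge0_fin_numE// (le_lt_trans (mu1 _ (mtg s)))// ltry.
  rewrite -(fineK fin) (eq_bigr (fun=> (n%:R^-1 * fine (mu01 [set x | s < g x]))%:E)).
    rewrite sumEFin; congr EFin; rewrite sumr_const card_ord.
    by rewrite -[LHS]mulr_natl mulrA mulfV// mul1r.
  by move=> k _; rewrite absf mu_f// ltn_ord EFinM fineK.
have := @HC f _ _ _ n.
rewrite (_ : (fun x => _) = psum (fun=> thin g n) n); last first.
  by apply/funext => x; apply: eq_bigr => k _; rewrite /f /F ltn_ord.
rewrite (_ : head_norm X (disj_sum f n) = enorm X H); last first.
  rewrite /head_norm /H; congr (enorm X (_ \* _)); apply/funext => t.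
  rewrite rearr_disjE; last by move=> k; exact: measurable_funTS.
  rewrite /rearr /ginv; congr inf; apply/seteqP; split => s /= [s0 Hs]; split => //;
    by move: Hs; rewrite -mu01E sumE.
apply.
- move=> k; suff [] : inball X 1 (f k) by [].
  apply: inball_dom bg => [|s s0]; first exact: measurable_funTS.
  rewrite absf absg.
  rewrite mu_f//; case: ifP => // _.
  rewrite -[leRHS]mul1e; apply: lee_wpmul2r => //.
  by rewrite lee_fin; case/andP: ninv.
- exact: independent_unif.
- move=> N.
  apply: (@le_trans _ _ (\sum_(k < N) (if (k < n)%N then (n%:R^-1)%:E else 0%E))%E).
    apply: lee_sum => k _; rewrite -mu01E.
    rewrite (_ : mkset _ = [set x | 0 < f k x]); last first.
      by apply/seteqP; split => x /=; rewrite lt0r F0 andbT.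
    rewrite mu_f//; case: ifP => // _; rewrite -[leRHS]mule1.
    by apply: lee_wpmul2l; [rewrite lee_fin; case/andP: ninv|exact: mu1].
  rewrite (eq_bigr (fun k : 'I_N => (if (k < n)%N then n%:R^-1 else 0)%:E)); last first.
    by move=> k _; case: ifP.
  have -> : (\sum_(k < N) (if (k < n)%N then n%:R^-1 else 0)%:E = ((minn N n)%:R / n%:R : R)%:E)%E.
    rewrite sumEFin; congr EFin; elim: N => [|N IH]; first by rewrite big_ord0 min0n mul0r.
    rewrite big_ord_recr /= IH; case: ltnP => Nn.
      by rewrite (minn_idPl Nn) -natr1 mulrDl mul1r.
    by rewrite addr0 (minn_idPr (leqW Nn)).
  by rewrite lee_fin ler_pdivrMr ?ltr0n// mul1r ler_nat geq_minr.
Qed.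

End one_function.

Lemma enorm_inball (Z : symspace R) (c : R) (f : R -> R) : inball Z c f ->
  enorm Z f = (ss_norm Z f)%:E.
Proof. by move=> [Zf _]; rewrite /enorm (asboolT Zf). Qed.

(** The constant function [1] has a positive norm in [X]. *)
Lemma C_ge0 : 0 <= C.
Proof.
have m1 : measurable_fun setT (fun _ : R => 1 : R) by exact: measurable_cst.
have b1 := inball_cst X (@ler01 R).
have := thin_sum_estimate m1 (fun=> ler01) b1 (ltn0Sn 0).
have bH := (inball_rearr m1 1).2 b1.
rewrite (enorm_inball bH); set h := ss_norm X _ => hE.
have h1 : 1 <= h.
  apply: (@le_inball R X 1 h (fun=> 1)) => //; first by move=> x _; rewrite normr1.
  by apply/(inball_rearr m1); split; [exact: bH.1|].
have := le_trans (enorm_ge0 _ _) hE; rewrite -EFinM lee_fin => Ch.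
by rewrite -(pmulr_lge0 _ (lt_le_trans ltr01 h1)).
Qed.

Lemma inball_thin_sum (g : R -> R) n : measurable_fun setT g -> (forall x, 0 <= g x) ->
  inball X 1 g -> (0 < n)%N -> inball Y C (psum (fun=> thin g n) n).
Proof.
move=> mg g0 bg n0; apply/enorm_le; apply: le_trans (thin_sum_estimate mg g0 bg n0) _.
have bH := (inball_rearr mg 1).2 bg.
rewrite (enorm_inball bH) -EFinM lee_fin -[leRHS]mulr1.
by apply: ler_wpM2l; [exact: C_ge0|exact: bH.2].
Qed.

Section limit.
Variable f : R -> R.
Hypothesis bf : inball X 1 f.

Let mf : measurable_fun (@I01 R) f := ss_meas bf.1.
Let f' := f \_ (@I01 R).
Let mf' : measurable_fun setT f' := measurable_restr01 mf.
Let g (x : R) := `|f' x|.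

Let mg : measurable_fun setT g.
Proof. by apply: measurableT_comp => //; exact: normr_measurable. Qed.

Let g0 x : 0 <= g x. Proof. exact: normr_ge0. Qed.

Let bg : inball X 1 g.
Proof.
apply: inball_le bf => [|x x01]; first exact: measurable_funTS.
by rewrite /g normr_id /f' restr01E.
Qed.

Let q (i : nat) (s : R) : \bar R := mu01 [set x | s < `|psum (fun=> f') i x|].

Let mq i s : measurable [set x | s < `|psum (fun=> f') i x|].
Proof. by apply: measurable_abs_gt; apply: measurable_psum. Qed.

Let q_le i (s : R) : (q i s <= mu01 [set x | (s < psum (fun=> g) i x)%R])%E.
Proof.
apply: le_measure; rewrite ?inE; [exact: mq| |].
  by rewrite gt_setE; apply: measurable_preimage => //; exact: measurable_psum.
move=> x /= sx; apply: lt_le_trans sx _; exact: ler_norm_sum.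
Qed.

Let q_anti i (s r : R) : s <= r -> (q i r <= q i s)%E.
Proof.
move=> sr; apply: le_measure; rewrite ?inE; [exact: mq|exact: mq|].
by move=> x /=; exact: le_lt_trans.
Qed.

Let q_ge0 i s : (0 <= q i s)%E. Proof. exact: measure_ge0. Qed.

Let w (i : nat) : R := (expR 1 * i`!%:R)^-1.

Let w_ge0 i : 0 <= w i. Proof. by rewrite invr_ge0 mulr_ge0// expR_ge0. Qed.

Let c (m : nat) : R := 1 - m.+1%:R^-1.

Let c01 m : 0 <= c m <= 1.
Proof. by rewrite subr_ge0 invf_le1// ler1n/= gerBl. Qed.

(* lower bounds, increasing with [m], for the tails of [K f]; each one is also
   below the tail of a sum of thinned variables *)
Let D (m : nat) (s : R) : \bar R := (\sum_(i < m.+1) (c m * w i)%:E * q i s)%E.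

Let Dlim (s : R) : \bar R := P (@cube R `&` [set t | s < `|kruglov B f t|]).

Let Dlim_sum s : 0 <= s -> Dlim s = (\sum_(i <oo) (w i)%:E * q i s)%E.
Proof. by move=> s0; exact: kruglov_tail01. Qed.

Let Dlim_le1 s : 0 <= s -> (Dlim s <= 1)%E.
Proof. by move=> s0; apply: probability_le1; exact: measurable_kruglov_tail01. Qed.

Let partial_le s k : 0 <= s -> (\sum_(i < k) (w i)%:E * q i s <= Dlim s)%E.
Proof. by move=> s0; exact: kruglov_tail_partial. Qed.

Let D_le_thin m (s : R) : 0 <= s ->
  (D m s <= mu01 [set x | (s < psum (fun=> thin g (m.+1 ^ 3)) (m.+1 ^ 3) x)%R])%E.
Proof.
move=> s0; set n := (m.+1 ^ 3)%N.
have n0 : (0 < n)%N by rewrite expn_gt0.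
have mn : (m.+1 <= n.+1)%N by rewrite ltnS /n; apply: leq_trans (leqnSn m) _; rewrite -{1}[m.+1]expn1 leq_pexp2l.
have n1 : 0 <= 1 - n%:R^-1 :> R by rewrite subr_ge0 invf_le1 ?ler1n// ltr0n.
rewrite thin_sum_tail//.
apply: (@le_trans _ _ (\sum_(i < m.+1) (binw (1 - n%:R^-1) n%:R^-1 n i)%:E *
     mu01 [set x | (s < psum (fun=> g) i x)%R])%E).
  apply: lee_sum => i _; case: i => -[|i] /= im.
    rewrite (_ : q 0 s = 0%E); last first.
      rewrite /q (_ : mkset _ = set0) ?measure0//; apply/seteqP; split => // x /=.
      by rewrite /psum big_ord0 normr0 ltNge s0.
    by rewrite mule0 mule_ge0// lee_fin binw_ge0// invr_ge0.
  apply: (@le_trans _ _ ((binw (1 - n%:R^-1) n%:R^-1 n i.+1)%:E * q i.+1 s)%E).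
    by apply: lee_wpmul2r => //; rewrite lee_fin; apply: binw_ge_poisson.
  by apply: lee_wpmul2l; [rewrite lee_fin binw_ge0// invr_ge0|exact: q_le].
rewrite -(big_mkord xpredT (fun i => (binw (1 - n%:R^-1) n%:R^-1 n i)%:E *
     mu01 [set x | (s < psum (fun=> g) i x)%R])%E).
rewrite -(big_mkord xpredT (fun i => (binw (1 - n%:R^-1) n%:R^-1 n i)%:E *
     mu01 [set x | (s < psum (fun=> g) i x)%R])%E).
rewrite (big_cat_nat (leq0n m.+1) mn)/= leeDl// sume_ge0// => i _.
by rewrite mule_ge0// lee_fin binw_ge0// invr_ge0.
Qed.

Let D_le_lim m s : 0 <= s -> (D m s <= Dlim s)%E.
Proof.
move=> s0; apply: le_trans (partial_le m.+1 s0); apply: lee_sum => i _.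
apply: lee_wpmul2r => //; rewrite lee_fin ler_piMl//.
by case/andP: (c01 m).
Qed.

Let c_mono m p : (m <= p)%N -> c m <= c p.
Proof. by move=> mp; rewrite lerD2l lerN2 lef_pV2 ?posrE// ler_nat. Qed.

Let D_mono m s : (D m s <= D m.+1 s)%E.
Proof.
rewrite /D [leRHS]big_ord_recr /=.
apply: (@le_trans _ _ (\sum_(i < m.+1) (c m.+1 * w i)%:E * q i s)%E).
  apply: lee_sum => i _; apply: lee_wpmul2r => //; rewrite lee_fin.
  by rewrite ler_wpM2r// c_mono.
by rewrite leeDl// mule_ge0// lee_fin mulr_ge0//; case/andP: (c01 m.+1).
Qed.

Let D_anti m (s r : R) : s <= r -> (D m r <= D m s)%E.
Proof.
move=> sr; apply: lee_sum => i _; apply: lee_wpmul2l; last exact: q_anti.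
by rewrite lee_fin mulr_ge0//; case/andP: (c01 m).
Qed.

Let vanishing_lim : vanishing Dlim. Proof. exact: vanishing_kruglov. Qed.

Let vanishing_D m : vanishing (D m).
Proof.
move=> t t0; have [s s0 Ds] := vanishing_lim t0.
by exists s => //; apply: le_trans Ds; exact: D_le_lim.
Qed.

Let lim_le (s t : R) : 0 <= s -> (forall m, D m s <= t%:E)%E -> (Dlim s <= t%:E)%E.
Proof.
move=> s0 Dt; rewrite Dlim_sum//.
have pos i : (0 <= (w i)%:E * q i s)%E by rewrite mule_ge0// lee_fin.
apply: lime_le; first by apply: is_cvg_nneseries => i _ _; exact: pos.
apply: nearW => k; rewrite big_mkord.
set A := (\sum_(i < k) _)%E.
have A0 : (0 <= A)%E by apply: sume_ge0 => i _; exact: pos.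
have A1 : (A <= 1)%E by apply: le_trans (Dlim_le1 s0); exact: partial_le.
have Af : A \is a fin_num by rewrite ge0_fin_numE// (le_lt_trans A1) ?ltry.
have cA m : (k <= m)%N -> ((c m)%:E * A <= t%:E)%E.
  move=> km; apply: le_trans (Dt m); rewrite /D ge0_sume_distrr; last by move=> i _; exact: pos.
  rewrite -(big_mkord xpredT (fun i => (c m)%:E * ((w i)%:E * q i s))%E).
  rewrite -(big_mkord xpredT (fun i => (c m * w i)%:E * q i s)%E).
  rewrite (big_cat_nat (leq0n k) (leqW km))/=.
  under eq_bigr => i _ do rewrite muleA -EFinM.
  rewrite leeDl// sume_ge0// => i _.
  by rewrite mule_ge0// lee_fin mulr_ge0//; case/andP: (c01 m).
move: A1 A0 cA; rewrite -(fineK Af) !lee_fin; move: (fine A) => a a1 a0 cA.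
apply/ler_addgt0Pr => e e0.
pose m := maxn k (Num.truncn e^-1).
have := cA m (leq_maxl _ _); rewrite -EFinM lee_fin /c => h.
have em : m.+1%:R^-1 <= e.
  have ei0 : 0 <= e^-1 by rewrite invr_ge0 ltW.
  have /andP[_ h2] := truncn_itv ei0.
  rewrite -[leRHS]invrK lef_pV2 ?posrE ?invr_gt0//.
  by apply: le_trans (ltW h2) _; rewrite ler_nat ltnS leq_maxr.
have m0 : 0 <= m.+1%:R^-1 :> R by rewrite invr_ge0.
move: h em m0; rewrite mulrBl mul1r; move: (m.+1%:R^-1) => v h em v0.
have : v * a <= v * 1 by rewrite ler_wpM2l.
by lra.
Qed.

(* the approximations are set to zero off [0 < t], where rearrangements are
   not monotone *)
Let u (m : nat) (t : R) : R := ginv (D m) t * \1_(`]0, +oo[%classic : set R) t.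

Let ulim (t : R) : R := ginv Dlim t * \1_(`]0, +oo[%classic : set R) t.

Let u_mono m t : u m t <= u m.+1 t.
Proof.
rewrite /u indicE; case: (boolP (_ \in _)) => [/set_mem|_]; last by rewrite !mulr0.
rewrite /= in_itv/= andbT !mulr1 => t0; apply: le_ginv; last by move=> s _; exact: D_mono.
exact: vanishing_D.
Qed.

Let u_ge0 m t : 0 <= u m t.
Proof. by rewrite mulr_ge0// ginv_ge0. Qed.

Let u_cvg t : (u ^~ t) @ \oo --> ulim t.
Proof.
rewrite /u /ulim indicE; case: (boolP (_ \in _)) => [/set_mem|_]; last first.
  under eq_fun do rewrite mulr0.
  by rewrite mulr0; exact: cvg_cst.
rewrite /= in_itv/= andbT => t0.
under eq_fun do rewrite mulr1.
rewrite mulr1.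
have ub m : ginv (D m) t <= ginv Dlim t.
  by apply: le_ginv; [exact: vanishing_lim|move=> s; exact: D_le_lim].
have hub : has_ubound (range (fun m => ginv (D m) t)).
  by exists (ginv Dlim t) => _ [m _ <-].
have mono : nondecreasing_seq (fun m => ginv (D m) t).
  apply/nondecreasing_seqP => m; apply: le_ginv; last by move=> s _; exact: D_mono.
  exact: vanishing_D.
have := nondecreasing_cvgn mono hub.
suff -> : ginv Dlim t = sup (range (fun m => ginv (D m) t)) by [].
apply/eqP; rewrite eq_le; apply/andP; split; last first.
  by apply: ge_sup => [|_ [m _ <-]//]; exists (ginv (D 0) t), 0%N.
set L := sup _.
have Lm m : ginv (D m) t <= L by apply: ub_le_sup => //; exists m.
have L0 : 0 <= L by apply: le_trans (Lm 0%N); exact: ginv_ge0.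
apply/ler_addgt0Pr => e e0; apply: ginv_le; first by rewrite addr_ge0// ltW.
apply: lim_le => [|m]; first by rewrite addr_ge0// ltW.
have [|s [s0 Ds] sL] := @inf_adherent _ [set s | 0 <= s /\ (D m s <= t%:E)%E] _ e0.
  split; last by exists 0 => r [].
  by have [s s0 Ds] := vanishing_D m t0; exists s.
apply: le_trans Ds; apply: D_anti; apply: ltW; apply: lt_le_trans sL _.
by rewrite lerD2r; exact: Lm.
Qed.

Let measurable_cut (E : R -> \bar R) : vanishing E ->
  measurable_fun (@I01 R) (fun t => ginv E t * \1_(`]0, +oo[%classic : set R) t).
Proof.
move=> dE; apply: measurable_funM; first exact: measurable_ginv01.
by apply: measurable_indic; exact: measurable_itv.
Qed.

Let bu m : inball Y C (u m).
Proof.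
have n0 : (0 < m.+1 ^ 3)%N by rewrite expn_gt0.
apply: inball_dom (inball_thin_sum mg g0 bg n0); first exact: measurable_cut.
move=> s s0.
apply: (@le_trans _ _ (D m s)); last first.
  apply: le_trans (D_le_thin m s0) _.
  rewrite (_ : [set x | s < `|_|] = [set x | s < psum (fun=> thin g (m.+1 ^ 3)) (m.+1 ^ 3) x])//.
  apply/seteqP; split => x /=; rewrite ger0_norm// sumr_ge0// => k _; exact: thin_ge0.
have D0 : (0 <= D m s)%E.
  by apply: sume_ge0 => i _; rewrite mule_ge0// lee_fin mulr_ge0//; case/andP: (c01 m).
have Df : D m s \is a fin_num.
  rewrite ge0_fin_numE// (le_lt_trans (D_le_lim m s0))//.
  by rewrite (le_lt_trans (Dlim_le1 s0)) ?ltry.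
rewrite mu01E -(fineK Df) -[fine _]subr0 -(@lebesgue_itv_bounded R true true); last exact: fine_ge0.
apply: le_measure; rewrite ?inE.
- by apply: measurable_tail01; exact: measurable_cut.
- exact: measurable_itv.
move=> t [tI] /=; rewrite /u indicE; case: (boolP (_ \in _)) => [/set_mem|_]; last first.
  by rewrite mulr0 normr0 ltNge s0.
rewrite /= !in_itv/= andbT mulr1 => t0; rewrite ger0_norm ?ginv_ge0// => /(ginv_gt s0).
by rewrite -{1}(fineK Df) lte_fin (ltW t0).
Qed.

(** The functions [u m] increase to the rearrangement of [K f] except at zero, and
    lie in the ball of radius [C], so that the Fatou property applies. *)
Lemma inball_rearr_kruglov : inball Y C (rearr P (@cube R) (kruglov B f)).
Proof.
have mu' : measurable_fun (@I01 R) ulim by exact: measurable_cut.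
have nmono : nondecreasing_seq (fun m => ss_norm Y (u m)).
  apply/nondecreasing_seqP => m.
  have [Yu _] := bu m.+1.
  suff [] : inball Y (ss_norm Y (u m.+1)) (u m) by [].
  apply: (@inball_le R Y (ss_norm Y (u m.+1)) (u m.+1)) => //; first exact: measurable_cut.
  by move=> x _; rewrite !ger0_norm.
have nub : has_ubound (range (fun m => ss_norm Y (u m))).
  by exists C => _ [m _ <-]; exact: (bu m).2.
have ncvg := nondecreasing_cvgn nmono nub.
have ae0 m : {ae lebesgue_measure, forall x, @I01 R x -> 0 <= u m x}.
  by apply: aeW => x _; exact: u_ge0.
have ae1 : {ae lebesgue_measure, forall x, @I01 R x ->
    nondecreasing_seq (u ^~ x) /\ u ^~ x @ \oo --> ulim x}.
  apply: aeW => x _; split; last exact: u_cvg.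
  by apply/nondecreasing_seqP => m; exact: u_mono.
have [Yl nl] := FY (fun m => (bu m).1) mu' ae0 ae1 ncvg.
have bl : inball Y C ulim.
  split => //; rewrite nl; apply: ge_sup => [|_ [m _ <-]]; last exact: (bu m).2.
  by exists (ss_norm Y (u 0%N)), 0%N.
apply: inball_dom bl => [|s s0]; first exact: measurable_rearr_kruglov.
rewrite !mu01E (@lebesgue_measure_rem1 _ 0 _ (@I01 R `&` [set x | s < `|ulim x|]))//.
- by apply: measurable_tail01; exact: measurable_rearr_kruglov.
- exact: measurable_tail01.
- move=> t t0; have H : I01 t -> ulim t = rearr P (@cube R) (kruglov B f) t.
    rewrite /I01 /= in_itv/= /ulim indicE => /andP[t0' _].
    by rewrite mem_set ?mulr1//= in_itv/= andbT lt0r t0.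
  by split => -[tI /= st]; split => //=; move: st; rewrite H.
Qed.

End limit.
End lower_estimate.

(** * The theorem *)

Lemma ZX_norm_fin_or_pinfty (R : realType) (X : symspace R) (F : R -> R) :
  ZX_norm X F = +oo%E \/
  exists eta J : R,
    [/\ ZX_norm X F = (eta + J)%:E, inball X eta (rearr_pos F \* \1_(@I01 R)) &
     (\int[@lebesgue_measure R]_t
        `|(rearr_pos F t * \1_(`[1%R, +oo[%classic : set R) t)%:E| <= J%:E)%E].
Proof.
rewrite /ZX_norm /head_norm Lnorm1 /=; set N := (\int[_]_x _)%E.
have N0 : (0 <= N)%E by exact: integral_ge0.
rewrite /enorm; case: asboolP => XF; last first.
  by left; rewrite addye// gt_eqF// (lt_le_trans _ N0)// ltNyr.
have [->|Noo] := eqVneq N +oo%E; first by left; rewrite addey.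
have Nfin : N \is a fin_num by rewrite ge0_fin_numE// lt_neqAle Noo leey.
right; exists (ss_norm X (rearr_pos F \* \1_I01)), (fine N); split => //.
  by rewrite EFinD fineK.
by rewrite fineK.
Qed.

Theorem theorem1 (R : realType) :
  (forall (X Y : symspace R) (P : probability (Omega R) R) (B : nat -> set R),
     ss_car X `<=` ss_car Y -> fatou_property Y ->
     product_lebesgue P -> kruglov_partition B ->
     forall C : R,
     (forall f : nat -> R -> R,
        (forall k, ss_car X (f k)) -> independent_seq f ->
        (forall n, (\sum_(k < n)
           lebesgue_measure (I01 `&` [set x | f k x != 0%R]) <= 1)%E) ->
        forall n, (enorm Y (fun x => \sum_(k < n) f k x)%R <=
                   C%:E * head_norm X (disj_sum f n))%E) ->
     (kruglov_norm P B X Y < +oo)%E /\ (kruglov_norm P B X Y <= C%:E)%E) /\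
  (exists2 alpha : R, 0 < alpha &
   forall (X Y : symspace R) (P : probability (Omega R) R) (B : nat -> set R),
     ss_car X `<=` ss_car Y -> fatou_property Y ->
     product_lebesgue P -> kruglov_partition B ->
     (kruglov_norm P B X Y < +oo)%E ->
     forall f : nat -> R -> R,
       (forall k, ss_car X (f k)) -> independent_seq f ->
       forall n, (enorm Y (fun x => \sum_(k < n) f k x)%R <=
                  alpha%:E * kruglov_norm P B X Y *
                  ZX_norm X (disj_sum f n))%E).
Proof.
split.
  move=> X Y P B _ FY HP HB C HC.
  have le : (kruglov_norm P B X Y <= C%:E)%E.
    apply: ge_ereal_sup => _ [f [Xf nf] <-]; apply/enorm_le.
    exact: (inball_rearr_kruglov HP HB FY HC (conj Xf nf)).
  by split => //; apply: le_lt_trans le _; exact: ltry.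
exists 15 => // X Y P B _ _ HP HB kfin f Xf If n.
have k0 := kruglov_norm_ge0 P B X Y.
have kE : kruglov_norm P B X Y = (fine (kruglov_norm P B X Y))%:E.
  by rewrite fineK// ge0_fin_numE.
have Hk : (kruglov_norm P B X Y <= (fine (kruglov_norm P B X Y))%:E)%E by rewrite -kE.
rewrite kE; move: (fine _) Hk => kappa Hk {k0 kE kfin}.
have k1 := kappa3_ge1 HP HB Hk.
pose af k x := `|f k x|.
have mf k : measurable_fun (@I01 R) (f k) by exact: ss_meas (Xf k).
have maf k : measurable_fun (@I01 R) (af k).
  by apply: measurableT_comp => //; exact: normr_measurable.
have Iaf : independent_seq af.
  by apply: (independent_comp (phi := fun _ y => `|y|)) => // k; exact: normr_measurable.
have rE : rearr_pos (disj_sum f n) = rearr_pos (disj_sum af n).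
  apply/funext => t; rewrite !rearr_disjE//; congr (ginv _ t); apply/funext => s.
  by apply: eq_bigr => k _; congr mu01; apply/seteqP; split => x /=; rewrite /af normr_id.
have [->|[eta [J [-> bH HJ]]]] := ZX_norm_fin_or_pinfty X (disj_sum f n).
  rewrite -EFinM gt0_muley ?leey// lte_fin; lra.
rewrite -!EFinM; apply/enorm_le.
have := inball_sum_ge0 HP HB Hk (n := n) (eta := eta) (J := J) maf Iaf.
rewrite -rE => H; have {}H := H (fun k x _ => normr_ge0 _) bH HJ.
apply: inball_le H; first by apply: measurable_sum => k.
move=> x _; rewrite (@ger0_norm _ (\sum_(k < n) af k x)); last by apply: sumr_ge0 => k _; exact: normr_ge0.
exact: ler_norm_sum.
Qed.
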